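(* Let $n\ge 1$ and consider $\mathbb{R}\times\mathbb{R}^{2n}$ with the co-oriented contact structure $\xi_{\mathrm{st}}=\ker\big(\mathrm{d}b+\tfrac12(\mathbf{x}\,\mathrm{d}\mathbf{y}-\mathbf{y}\,\mathrm{d}\mathbf{x})\big)$. Let $(S,V_S,f_\pm)$ and $(T,V_T,g_\pm)$ be equivalent shapes in $\mathbb{R}\times\mathbb{R}^{2n}$ whose common shadow set $V_S=V_T$ is an open round ball about $0$ in $\mathbb{R}^{2n}$. Assume that $f_+,f_-,g_+,g_-$ are all radially symmetric. Then the domains $(D_S,\xi_{\mathrm{st}})$ and $(D_T,\xi_{\mathrm{st}})$ are co-orientation preserving contactomorphic up to the boundary if and only if $f_+''(0)=g_+''(0)$ and $f_-''(0)=g_-''(0)$.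
   Context: Coordinates on $\mathbb{R}\times\mathbb{R}^{2n}$ are $(b,\mathbf{x},\mathbf{y})$. Shapes. Let $V$ be a smooth manifold. A strict vertically convex hypersurface in $\mathbb{R}\times V$ is a connected, compact smooth hypersurface $S\subset\mathbb{R}\times V$ that bounds a (unique) relatively compact domain, and for which there are an open subset $V_S\subset V$ (the shadow set) and smooth functions $f_\pm:V_S\to\mathbb{R}$ with $f_-<f_+$, both extending continuously to $\partial V_S$ with $f_-=f_+$ along $\partial V_S$, such that $S$ is the disjoint union of the graph $S^-$ of $f_-$ (entrance set), the graph $S^+$ of $f_+$ (exit set) and the graph of $f_\pm|_{\partial V_S}$ (equatorial set). The triple $(S,V_S,f_\pm)$ is called a shape. The closure of the relatively compact domain bounded by $S$ is denoted $D_S$ and called the domain of $S$. Two shapes $(S,V_S,f_\pm)$ and $(T,V_T,g_\pm)$ in $\mathbb{R}\times V$ are equivalent if $V_S=V_T$ and the germs along $\partial V_S=\partial V_T$ of the continuous functions $f_+$ and $g_+$, and those of $f_-$ and $g_-$, coincide (i.e. $f_\pm=g_\pm$ on a neighbourhood of $\partial V_S$ in $\overline{V_S}$). Co-orientation preserving contactomorphic up to the boundary means: there is a diffeomorphism $D_S\to D_T$ of compact manifolds with boundary that maps the contact structure to the contact structure, preserving the co-orientations defined by the given contact form. A function $f$ on an open ball about $0$ in $\mathbb{R}^{2n}$ is radially symmetric if it is invariant under the orthogonal group; then $f(\mathbf{x},\mathbf{y})$ is identified with a function $f(r)$ of $r=|(\mathbf{x},\mathbf{y})|$ (an even function of one variable),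 and $f''(0)$ is the second derivative of $r\mapsto f(r)$ at $r=0$. *)

(* Defs.v *)
(* Written with MathComp-Analysis. *)
From mathcomp Require Import all_boot all_order all_algebra.
From mathcomp Require Import all_classical all_reals all_analysis.
Set Implicit Arguments.
Unset Strict Implicit.
Unset Printing Implicit Defensive.
Import Order.TTheory GRing.Theory Num.Theory.
Import numFieldNormedType.Exports.
Local Open Scope classical_set_scope.
Local Open Scope ring_scope.

Section Smoothness.
Variable R : realType.
Implicit Types V W : normedModType R.

(* C^oo on U: every iterated directional derivative is (Frechet)
   differentiable at every point of U.  Meant for open U in a
   finite-dimensional V. *)
Definition smooth_on V W (U : set V) (f : V -> W) : Prop :=
  forall (vs : seq V) (x : V), U x ->
    differentiable (foldr (fun v (g : V -> W) y => 'D_v g y) f vs) x.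

(* Maps on an arbitrary subset A (in particular on a compact domain with
   boundary) are encoded as total functions whose values outside A are
   irrelevant; smoothness and differentials are those of smooth extensions
   to an open neighbourhood of p. *)
Definition local_extension V W (A : set V) (f : V -> W) (p : V)
    (g : V -> W) : Prop :=
  exists U : set V, [/\ open U, U p, smooth_on U g
    & forall q, A q -> U q -> g q = f q].

Definition smooth_map V W (A : set V) (f : V -> W) : Prop :=
  forall p, A p -> exists g, local_extension A f p g.

Definition diffeomorphism V W (A : set V) (B : set W) (f : V -> W) : Prop :=
  smooth_map A f /\
  exists g : W -> V,
    [/\ smooth_map B g,
        forall p, A p -> B (f p) /\ g (f p) = p
      & forall q, B q -> A (g q) /\ f (g q) = q].

Definition smooth_hypersurface V (S : set V) : Prop :=
  forall p, S p ->
    exists (U : set V) (F : V -> R^o),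
      [/\ open U, U p, smooth_on U F,
          exists v, 'd F p v != 0
        & forall q, U q -> (S q <-> F q = 0)].

End Smoothness.

Section Shapes.
Variable R : realType.

Definition frontier (T : topologicalType) (A : set T) : set T :=
  closure A `\` interior A.

(* U is a relatively compact domain bounded by S. *)
Definition bounds (T : topologicalType) (S U : set T) : Prop :=
  [/\ U !=set0, open U, connected U, compact (closure U) & frontier U = S].

(* A function on the closure of the shadow set is encoded as a total function
   on V with irrelevant values elsewhere; its values on the frontier are those
   of the continuous extension.  The three pieces of S are automatically
   disjoint, since VS is open and fm < fp on VS. *)
Definition vertically_convex (V : normedModType R) (S : set (R^o * V))
    (VS : set V) (fm fp : V -> R^o) : Prop :=
  [/\ [/\ S !=set0, connected S, compact S & smooth_hypersurface S],
      exists! U : set (R^o * V), bounds S U,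
      [/\ open VS, smooth_on VS fm & smooth_on VS fp],
      [/\ {within closure VS, continuous fm},
          {within closure VS, continuous fp},
          forall z, VS z -> fm z < fp z
        & forall z, frontier VS z -> fm z = fp z]
    & S = [set p | VS p.2 /\ p.1 = fm p.2]
      `|` [set p | VS p.2 /\ p.1 = fp p.2]
      `|` [set p | frontier VS p.2 /\ p.1 = fp p.2]].

Record vshape (V : normedModType R) := Shape {
  hypersurface :> set (R^o * V);
  shadow : set V;
  fminus : V -> R^o;
  fplus : V -> R^o;
  shapeP : vertically_convex hypersurface shadow fminus fplus
}.

Definition shape_domain (V : normedModType R) (S : vshape V) :
    set (R^o * V) :=
  closure (xget set0 [set U | bounds S U]).

Definition shape_equiv (V : normedModType R) (S T : vshape V) : Prop :=
  shadow S = shadow T /\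
  exists N : set V, [/\ open N, frontier (shadow S) `<=` N
    & forall z, closure (shadow S) z -> N z ->
        fplus S z = fplus T z /\ fminus S z = fminus T z].

End Shapes.

Section StandardContact.
Variables (R : realType) (n : nat).

(* Points (x, y) of R^2n are row vectors of length n + n, and points
   (b, (x, y)) of R x R^2n are pairs. *)
Definition space := (R^o * 'rV[R]_(n + n))%type.

(* The value at p of db + (x dy - y dx)/2 on the tangent vector v. *)
Definition alpha_st (p v : space) : R :=
  v.1 + 2^-1 * \sum_(j < n) (lsubmx p.2 0 j * rsubmx v.2 0 j
                             - rsubmx p.2 0 j * lsubmx v.2 0 j).

Definition xi_st (p : space) : set space := [set v | alpha_st p v = 0].

Definition positive_side (p : space) : set space :=
  [set v | 0 < alpha_st p v].

(* When A is the closure of an open set the differential at p of a local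
   extension does not depend on the extension. *)
Definition cooriented_contactomorphism (A B : set space)
    (f : space -> space) : Prop :=
  diffeomorphism A B f /\
  forall p g, A p -> local_extension A f p g ->
    'd g p @` xi_st p = xi_st (f p) /\
    'd g p @` positive_side p = positive_side (f p).

Definition cooriented_contactomorphic (A B : set space) : Prop :=
  exists f, cooriented_contactomorphism A B f.

(* The topology of 'rV[R]_(n + n) comes from the sup norm, so the round ball
   is spelled out with the Euclidean norm. *)
Definition euclidean_norm (z : 'rV[R]_(n + n)) : R :=
  Num.sqrt (\sum_i z 0 i ^+ 2).

Definition round_ball (r : R) : set 'rV[R]_(n + n) :=
  [set z | euclidean_norm z < r].

Definition radially_symmetric (B : set 'rV[R]_(n + n))
    (f : 'rV[R]_(n + n) -> R^o) : Prop :=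
  forall (A : 'M[R]_(n + n)) (z : 'rV[R]_(n + n)),
    A *m A^T = 1%:M -> B z -> f (z *m A) = f z.

(* A radially symmetric f as a function of one variable: its restriction to
   the first coordinate axis. *)
Definition radial_profile (f : 'rV[R]_(n + n) -> R^o) (r : R) : R^o :=
  f (r *: \row_(j < n + n) (j == 0 :> nat)%:R).

End StandardContact.

(* Main.v *)
(* Write [r] for the radius and [w] for the difference of the upper and the lower function.

   Existence.  A rotation-equivariant contactomorphism has the form
   [(b, z) |-> (B, expR q * exp (i * theta) z)], and it preserves the contact structure exactly when
   [(b, u) |-> (B, U)] preserves area, where [u = 1 / r^2] and [U] is the inverse square of the new
   radius.  We take the map which is affine on vertical columns, [B = e * b + k]; it maps one domain
   onto the other as soon as [q] equates the areas of the column regions, that is, the integrals of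
   [w du].  These areas diverge like [w(0) u + (w''(0) / 2) ln u] at the axis; equality of the second
   derivatives cancels the logarithms, so that [q] solves an equation which extends smoothly to
   [r = 0], and it makes the rotation angle smooth there as well.  Near the boundary the map is the
   identity.

   Obstruction.  On the boundary [T S = xi] only at the two poles.  As a contactomorphism [f] maps
   boundary to boundary (otherwise a defining function of the boundary, composed with a local
   inverse, would have an interior maximum and vanishing differential), it maps poles to poles, and
   co-orientation preserves the upper and the lower one.  The restriction of the contact form to
   the upper or lower sheet is [dF + (x dy - y dx) / 2]; its linear part at the pole is
   [F''(0) <w, v> + <J w, v> / 2] with [J (x, y) = (- y, x)], which [f] preserves up to a positive
   factor and a linear isomorphism [A].  So [A] is conformal both for the metric and for the
   symplectic form, with necessarily the same factor, and [F''(0)] is an invariant (if [F''(0) = 0],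
   only the symplectic form is left, and [F''(0)] remains zero). *)
From HB Require Import structures.
Require Import Defs.
From mathcomp Require Import all_boot all_order all_algebra.
From mathcomp Require Import all_classical all_reals all_analysis.
From mathcomp Require Import ring lra.
Import Order.TTheory GRing.Theory Num.Theory.
Import numFieldNormedType.Exports.
Local Open Scope classical_set_scope.
Local Open Scope ring_scope.
Set Implicit Arguments.
Unset Strict Implicit.
Unset Printing Implicit Defensive.

(** * Smooth maps *)

(** For [r > 0], the contact form divided by [r^2 / 2] is [2 u db + <J z, dz> / r^2]. An equivariant
    map that rotates by an angle [phi] turns this into [2 U dB + <J z, dz> / r^2 + dphi], so it is
    contact exactly when [dphi = 2 u db - 2 U dB]. Closedness of the right side is the area
    condition, and the angle is a primitive of it. The obstacle is the axis, where [u] is infinite.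
    Every coefficient is therefore kept as an even smooth function of [r], derivatives enter only
    after division by [r], and the area equation is multiplied by [r^2] before it is solved for [q].
    The other delicate place is the equator, where the sheets are only known to be continuous. The
    existence part avoids it by a map that is the identity there. The obstruction part never
    parametrises the image near the equator: it tests the image of a pole with functions that are
    nonpositive on the target domain and vanish at that image. *)

Section SmoothCalculus.
Variable R : realType.
Implicit Types V W X : normedModType R.

Lemma is_diff_eps V W (f : V -> W) (L : {linear V -> W}) x :
  continuous L ->
  (forall e, 0 < e -> \forall h \near (0 : V), `|f (h + x) - f x - L h| <= e * `|h|) ->
  is_diff x f L.
Proof.
move=> cL H.
have K : f \o shift x = cst (f x) + L +o_ 0 id.
  apply/eqaddoP => e e0; have := H e e0.
  apply: filterS => h /=.
  by rewrite !fctE opprD addrA.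
have E : 'd f x = L :> (V -> W) by apply: diff_unique.
apply: DiffDef => //; apply/diff_locallyP; split; first by rewrite E.
by rewrite E.
Qed.

Lemma is_diff_epsE V W (f L : V -> W) x : is_diff x f L ->
  (forall e, 0 < e -> \forall h \near (0 : V), `|f (h + x) - f x - L h| <= e * `|h|).
Proof.
move=> [df <-] e e0; have := diff_locally df => /eqaddoP/(_ e e0).
apply: filterS => h /=.
by rewrite !fctE opprD addrA.
Qed.

(** Packaged as a bilinear map so that the general formula for differentials of bilinear maps yields
    the product rule [is_diffS]. *)
Definition scale_fun W (k : R^o) (w : W) : W := k *: w.

Lemma scale_fun_is_bilinear W :
  bilinear_for
    (GRing.Scale.Law.clone _ _ *:%R _) (GRing.Scale.Law.clone _ _ *:%R _)
    (@scale_fun W).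
Proof.
rewrite /scale_fun.
split=> [w a x y|k a x y] /=; first by rewrite scalerDl scalerA.
by rewrite scalerDr !scalerA mulrC.
Qed.

HB.instance Definition _ W := bilinear_isBilinear.Build R R^o W W _ _ 
  (@scale_fun W) (@scale_fun_is_bilinear W).

Lemma is_diffS V W (k dk : V -> R^o) (g dg : V -> W) x :
  is_diff x k dk -> is_diff x g dg ->
  is_diff x (fun y => k y *: g y) (fun v => k x *: dg v + dk v *: g x).
Proof.
move=> hk hg.
pose B : {bilinear R^o -> W -> W} := @scale_fun W.
have cB : continuous (fun p : R^o * W => B p.1 p.2).
  by move=> p; exact: (@scale_continuous R W p).
have hB : is_diff (k x, g x) (fun p : R^o * W => B p.1 p.2)
   (fun q => B (k x) q.2 + B q.1 (g x)).
  by apply: DiffDef; [exact: differentiable_bilin|rewrite diff_bilin].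
exact: (is_diff_comp (is_diff_pair hk hg) hB).
Qed.

(** An order-by-order form of [smooth_on]. Closure under products and compositions is proved by
    induction on [k] with the functions generalised: one derivative of a product is a sum of
    products, each of one order less. *)
Fixpoint Ck k V W (U : set V) (f : V -> W) : Prop :=
  (forall x, U x -> differentiable f x) /\
  (if k is k'.+1 then forall v, Ck k' U (fun x => 'D_v f x) else True).

Lemma Ck_diff k V W (U : set V) (f : V -> W) x : Ck k U f -> U x -> differentiable f x.
Proof. by case: k => [|k] [H _]; apply: H. Qed.

Lemma Ck_derive k V W (U : set V) (f : V -> W) v :
  Ck k.+1 U f -> Ck k U (fun x => 'D_v f x).
Proof. by move=> [_]; apply. Qed.

Lemma CkW k V W (U : set V) (f : V -> W) : Ck k.+1 U f -> Ck k U f.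
Proof.
elim: k f => [|k IH] f [H1 H2]; first by split.
by split => // v; apply: IH; apply: H2.
Qed.

Lemma smooth_onP V W (U : set V) (f : V -> W) : smooth_on U f <-> forall k, Ck k U f.
Proof.
split=> [H k|H vs].
  elim: k f H => [|k IH] f H; first by split => // x Ux; exact: (H [::] x Ux).
  split=> [x Ux|v]; first exact: (H [::] x Ux).
  by apply: IH => vs x Ux; have := H (rcons vs v) x Ux; rewrite foldr_rcons.
(* [foldr] differentiates first along the last direction of the list, so the list is peeled from its
   right end. *)
elim/last_ind: vs f H => [|vs v IH] f H x Ux; first exact: Ck_diff (H 0%N) Ux.
by rewrite foldr_rcons; apply: IH => // k; apply: Ck_derive; exact: H.
Qed.

Lemma differentiable_near_eq V W (f g : V -> W) x :
  (\near x, f x = g x) -> differentiable f x -> differentiable g x.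
Proof.
move=> fg dfx; have df := is_diff_epsE (differentiableP dfx).
suff [] : is_diff x g ('d f x) by [].
apply: is_diff_eps => [|e e0]; first exact: diff_continuous dfx.
have := df e e0; have: \forall h \near (0 : V), f (h + x) = g (h + x).
  by move: fg; rewrite (near_shift 0) subr0.
have E := nbhs_singleton fg.
apply: filterS2 => h ->; by rewrite E.
Qed.

Section OpenSet.
Variables (V : normedModType R) (U : set V).
Hypothesis oU : open U.

(** Derivatives are total functions whose formulas hold only on [U]; openness of [U] makes such an
    equality survive differentiation. *)
Lemma Ck_eq k W (f g : V -> W) : (forall x, U x -> f x = g x) -> Ck k U f -> Ck k U g.
Proof.
elim: k f g => [|k IH] f g fg [H1 H2].
  split => // x Ux; apply: differentiable_near_eq (H1 x Ux).
  by near=> y; apply: fg; near: y; apply: open_nbhs_nbhs.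
have N x : U x -> \near x, f x = g x.
  by move=> Ux; near=> y; apply: fg; near: y; apply: open_nbhs_nbhs.
split => [x Ux|v]; first exact: differentiable_near_eq (N x Ux) (H1 x Ux).
by apply: IH (H2 v) => x Ux; apply: near_eq_derive; exact: N.
Unshelve. all: by end_near. Qed.

Lemma Ck_is_diff k W (f : V -> W) (df : V -> V -> W) :
  (forall x, U x -> is_diff x f (df x)) -> (forall v, Ck k U (df^~ v)) -> Ck k.+1 U f.
Proof.
move=> H1 H2; split => [x /H1 []//|v].
by apply: Ck_eq (H2 v) => x /H1 [df1 df2]; rewrite deriveE// df2.
Qed.

Lemma CkP k W (f : V -> W) x : Ck k U f -> U x -> is_diff x f (fun v => 'D_v f x).
Proof.
move=> H Ux; have df := Ck_diff H Ux; apply: DiffDef => //.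
by apply/funext => v; rewrite deriveE.
Qed.

Lemma Ck_cst k W (a : W) : Ck k U (fun=> a).
Proof.
elim: k a => [|k IH] a; first by split => // x _; exact: differentiable_cst.
by apply: (@Ck_is_diff k W _ (fun _ _ => 0)) => v; exact: IH.
Qed.

Lemma CkD k W (f g : V -> W) : Ck k U f -> Ck k U g -> Ck k U (fun x => f x + g x).
Proof.
elim: k f g => [|k IH] f g Hf Hg.
  by split=> // x Ux; apply: differentiableD; [exact: Ck_diff Hf Ux|exact: Ck_diff Hg Ux].
apply: (@Ck_is_diff _ _ _ (fun x v => 'D_v f x + 'D_v g x)) => [x Ux|v].
  exact: is_diffD (CkP Hf Ux) (CkP Hg Ux).
by apply: IH; apply: Ck_derive.
Qed.

Lemma Ck_sum k W m (F : 'I_m -> V -> W) : (forall i, Ck k U (F i)) ->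
  Ck k U (fun x => \sum_i F i x).
Proof.
move=> H; elim: m F H => [|m IH] F H.
  by apply: (@Ck_eq _ _ (fun=> 0)) => [x _|]; [rewrite big_ord0|exact: Ck_cst].
apply: (@Ck_eq _ _ (fun x => \sum_i F (widen_ord (leqnSn m) i) x + F ord_max x)).
  by move=> x _; rewrite big_ord_recr.
by apply: CkD => //; apply: IH.
Qed.

Lemma CkZ k W (c : V -> R^o) (g : V -> W) : Ck k U c -> Ck k U g ->
  Ck k U (fun x => c x *: g x).
Proof.
elim: k c g => [|k IH] c g Hc Hg.
  split=> // x Ux.
  by have [] := is_diffS (CkP Hc Ux) (CkP Hg Ux).
apply: (@Ck_is_diff _ _ _ (fun x v => c x *: 'D_v g x + 'D_v c x *: g x)) => [x Ux|v].
  exact: is_diffS (CkP Hc Ux) (CkP Hg Ux).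
by apply: CkD; apply: IH; rewrite ?(CkW Hc) ?(CkW Hg)//; [exact: CkW|exact: Ck_derive|exact: Ck_derive|exact: CkW].
Qed.

Lemma CkM k (f g : V -> R^o) : Ck k U f -> Ck k U g -> Ck k U (fun x => f x * g x : R^o).
Proof. exact: CkZ. Qed.

Lemma Ck_lin_comp k W X (L : {linear W -> X}) (f : V -> W) : continuous L ->
  Ck k U f -> Ck k U (fun x => L (f x)).
Proof.
move=> cL; have dL w : is_diff w L L.
  by apply: DiffDef; [exact: linear_differentiable|exact: diff_lin].
elim: k f => [|k IH] f Hf.
  split=> // x Ux.
  by have [] := is_diff_comp (CkP Hf Ux) (dL _).
apply: (@Ck_is_diff _ _ _ (fun x v => L ('D_v f x))) => [x Ux|v].
  exact: is_diff_comp (CkP Hf Ux) (dL _).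
by apply: IH; apply: Ck_derive.
Qed.

Lemma Ck_id k : Ck k U id.
Proof.
case: k => [|k]; first by split.
by apply: (@Ck_is_diff _ _ _ (fun _ => id)) => v; exact: Ck_cst.
Qed.

Lemma Ck_pair k W X (f : V -> W) (g : V -> X) : Ck k U f -> Ck k U g ->
  Ck k U (fun x => (f x, g x)).
Proof.
elim: k f g => [|k IH] f g Hf Hg.
  by split=> // x Ux; apply: differentiable_pair; [exact: Ck_diff Hf Ux|exact: Ck_diff Hg Ux].
apply: (@Ck_is_diff _ _ _ (fun x v => ('D_v f x, 'D_v g x))) => [x Ux|v].
  exact: is_diff_pair (CkP Hf Ux) (CkP Hg Ux).
by apply: IH; apply: Ck_derive.
Qed.

(** The finite-dimensionality that the chain rule needs: the differential of [g] at [f x], applied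
    to ['D_v f x], becomes a finite sum of coordinates of ['D_v f x] times directional derivatives
    of [g] at [f x]. Each term is again a product with a composition, so induction applies. *)
Definition framed W := exists m (c : 'I_m -> {linear W -> R^o}) (e : 'I_m -> W),
  (forall i, continuous (c i)) /\ forall w, w = \sum_i c i w *: e i.

Lemma Ck_comp k W X (U' : set W) (f : V -> W) (g : W -> X) : framed W ->
  open U' -> (forall x, U x -> U' (f x)) ->
  Ck k U f -> Ck k U' g -> Ck k U (fun x => g (f x)).
Proof.
move=> [m [c [e [cc ce]]]] oU' fU.
elim: k g => [|k IH] g Hf Hg.
  split=> // x Ux; apply: differentiable_comp; first exact: Ck_diff Hf Ux.
  exact: Ck_diff Hg (fU _ Ux).
apply: (@Ck_is_diff _ _ _ (fun x v => \sum_i c i ('D_v f x) *: 'D_(e i) g (f x))) => [x Ux|v].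
  apply: is_diff_eq (is_diff_comp (CkP Hf Ux) (differentiableP (Ck_diff Hg (fU _ Ux)))) _.
  apply/funext => v /=; rewrite {1}(ce ('D_v f x)) linear_sum; apply: eq_bigr => i _.
  by rewrite linearZ/= (deriveE _ (Ck_diff Hg (fU _ Ux))).
apply: Ck_sum => i; apply: CkZ.
  by apply: Ck_lin_comp => //; apply: Ck_derive.
by apply: (IH (fun w => 'D_(e i) g w)); [exact: CkW|exact: Ck_derive].
Qed.

End OpenSet.

Section Frames.

Lemma framed_reals : framed (R^o : normedModType R).
Proof.
exists 1%N, (fun _ => idfun), (fun _ => 1); split=> [i x //|w].
by rewrite big_ord1/= [RHS]mulr1.
Qed.

Lemma framed_prod V W : framed V -> framed W -> framed (V * W)%type.
Proof.
move=> [m [c [e [cc ce]]]] [p [d [f [cd cf]]]].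
exists (m + p)%N, (fun i => match fintype.split i with
   | inl i => (c i \o fst : {linear (V * W)%type -> R^o})
   | inr i => (d i \o snd : {linear (V * W)%type -> R^o}) end),
  (fun i => match fintype.split i with inl i => (e i, 0) | inr i => (0, f i) end).
split=> [i x|[v w]].
  case: (fintype.split i) => j.
    by apply: continuous_comp; [exact: cvg_fst|exact: cc].
  by apply: continuous_comp; [exact: cvg_snd|exact: cd].
rewrite big_split_ord/=.
under eq_bigr do rewrite (unsplitK (inl _)).
under [X in _ + X]eq_bigr do rewrite (unsplitK (inr _)).
rewrite {1}(ce v) {1}(cf w).
have E1 : \sum_(i < m) c i v *: (e i, 0 : W) = (\sum_(i < m) c i v *: e i, 0).
  elim/big_rec2: _ => // i a b _ ->.
  by apply: injective_projections; rewrite //= scaler0 addr0.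
have E2 : \sum_(i < p) d i w *: (0 : V, f i) = (0, \sum_(i < p) d i w *: f i).
  elim/big_rec2: _ => // i a b _ ->.
  by apply: injective_projections; rewrite //= scaler0 addr0.
by rewrite /= E1 E2; congr pair; rewrite ?addr0 ?add0r.
Qed.

Definition coord_fun n (i : 'I_n) (z : 'rV[R]_n) : R^o := z 0 i.

Lemma coord_fun_is_linear n (i : 'I_n) : linear (@coord_fun n i).
Proof. by move=> a x y; rewrite /coord_fun !mxE. Qed.

HB.instance Definition _ n (i : 'I_n) :=
  GRing.isLinear.Build R 'rV[R]_n R^o _ (@coord_fun n i) (@coord_fun_is_linear n i).

Lemma continuous_coord_fun n (i : 'I_n) : continuous (@coord_fun n i).
Proof. exact: coord_continuous. Qed.

Lemma framed_row n : framed ('rV[R]_n : normedModType R).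
Proof.
exists n, (fun i => (@coord_fun n i : {linear _ -> _})), (fun i => delta_mx 0 i).
split=> [i|w]; first exact: continuous_coord_fun.
exact: row_sum_delta.
Qed.

End Frames.

Lemma is_diff_derive1 W (f : R -> W) (x : R) (d : W) :
  is_derive x (1 : R) f d -> is_diff (x : R^o) (f : R^o -> W) (fun v => v *: d).
Proof.
move=> [df <-]; have dfx : differentiable f x by apply/derivable1_diffP.
by apply: DiffDef => //; rewrite diff1E//; apply/funext => v; rewrite derive1E.
Qed.

Lemma is_derive_diff V W (f df : V -> W) x v :
  is_diff x f df -> is_derive x v f (df v).
Proof.
by move=> [d1 d2]; apply: DeriveDef; [exact: diff_derivable|rewrite deriveE// d2].
Qed.

Lemma is_diff_fst V W (x : V * W) : is_diff x (fst : V * W -> V) fst.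
Proof.
have cs : continuous (fst : V * W -> V) by move=> y; exact: cvg_fst.
by apply: DiffDef; [exact: (linear_differentiable (f := fst : {linear (V * W)%type -> V}))
  |exact: (diff_lin (f := fst : {linear (V * W)%type -> V}))].
Qed.

Lemma is_diff_snd V W (x : V * W) : is_diff x (snd : V * W -> W) snd.
Proof.
have cs : continuous (snd : V * W -> W) by move=> y; exact: cvg_snd.
by apply: DiffDef; [exact: (linear_differentiable (f := snd : {linear (V * W)%type -> W}))
  |exact: (diff_lin (f := snd : {linear (V * W)%type -> W}))].
Qed.

Section SmoothOn.
Variables (V : normedModType R) (U : set V).
Hypothesis oU : open U.

Lemma smooth_diff W (f : V -> W) x : smooth_on U f -> U x -> differentiable f x.
Proof. by move=> H Ux; exact: (H [::] x Ux). Qed.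

Lemma smooth_is_diff W (f : V -> W) x : smooth_on U f -> U x ->
  is_diff x f (fun v => 'D_v f x).
Proof. by move=> /smooth_onP H; exact: CkP (H 0%N). Qed.

Lemma smooth_derive W (f : V -> W) v : smooth_on U f -> smooth_on U (fun x => 'D_v f x).
Proof. by move=> /smooth_onP H; apply/smooth_onP => k; apply: Ck_derive; exact: H. Qed.

Lemma smooth_continuous W (f : V -> W) x : smooth_on U f -> U x -> {for x, continuous f}.
Proof. by move=> H Ux; apply: differentiable_continuous; exact: smooth_diff H Ux. Qed.

Lemma smooth_sub W (U' : set V) (f : V -> W) : U' `<=` U -> smooth_on U f -> smooth_on U' f.
Proof. by move=> UU H vs x /UU; exact: H. Qed.

Lemma smooth_eq W (f g : V -> W) : (forall x, U x -> f x = g x) ->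
  smooth_on U f -> smooth_on U g.
Proof. by move=> fg /smooth_onP H; apply/smooth_onP => k; exact: Ck_eq fg (H k). Qed.

Lemma smooth_cst W (a : W) : smooth_on U (fun=> a).
Proof. by apply/smooth_onP => k; exact: Ck_cst. Qed.

Lemma smooth_id : smooth_on U id.
Proof. by apply/smooth_onP => k; exact: Ck_id. Qed.

Lemma smoothD W (f g : V -> W) : smooth_on U f -> smooth_on U g ->
  smooth_on U (fun x => f x + g x).
Proof. by move=> /smooth_onP Hf /smooth_onP Hg; apply/smooth_onP => k; exact: CkD. Qed.

Lemma smoothZ W (c : V -> R^o) (g : V -> W) : smooth_on U c -> smooth_on U g ->
  smooth_on U (fun x => c x *: g x).
Proof. by move=> /smooth_onP Hf /smooth_onP Hg; apply/smooth_onP => k; exact: CkZ. Qed.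

Lemma smoothM (f g : V -> R^o) : smooth_on U f -> smooth_on U g ->
  smooth_on U (fun x => f x * g x : R^o).
Proof. exact: smoothZ. Qed.

Lemma smooth_lin_comp W X (L : {linear W -> X}) (f : V -> W) : continuous L ->
  smooth_on U f -> smooth_on U (fun x => L (f x)).
Proof. by move=> cL /smooth_onP Hf; apply/smooth_onP => k; exact: Ck_lin_comp. Qed.

Lemma smoothN W (f : V -> W) : smooth_on U f -> smooth_on U (fun x => - f x).
Proof.
move=> Hf; apply: (@smooth_eq _ (fun x => (-1 : R^o) *: f x)).
  by move=> x _; rewrite scaleN1r.
by apply: smoothZ => //; exact: smooth_cst.
Qed.

Lemma smoothB W (f g : V -> W) : smooth_on U f -> smooth_on U g ->
  smooth_on U (fun x => f x - g x).
Proof. by move=> Hf Hg; apply: smoothD => //; exact: smoothN. Qed.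

Lemma smoothX (f : V -> R^o) n : smooth_on U f -> smooth_on U (fun x => f x ^+ n : R^o).
Proof.
move=> Hf; elim: n => [|n IH]; first exact: smooth_cst.
apply: (@smooth_eq _ (fun x => f x * f x ^+ n : R^o)) => [x _|]; first by rewrite exprS.
exact: smoothM.
Qed.

Lemma smooth_pair W X (f : V -> W) (g : V -> X) : smooth_on U f -> smooth_on U g ->
  smooth_on U (fun x => (f x, g x)).
Proof. by move=> /smooth_onP Hf /smooth_onP Hg; apply/smooth_onP => k; exact: Ck_pair. Qed.

Lemma smooth_comp W X (U' : set W) (f : V -> W) (g : W -> X) : framed W ->
  open U' -> (forall x, U x -> U' (f x)) ->
  smooth_on U f -> smooth_on U' g -> smooth_on U (fun x => g (f x)).
Proof.
move=> fW oU' fU /smooth_onP Hf /smooth_onP Hg; apply/smooth_onP => k.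
exact: Ck_comp fW oU' fU (Hf k) (Hg k).
Qed.

Lemma smooth_fst W X (U' : set (W * X)%type) : open U' -> smooth_on U' (fst : W * X -> W).
Proof.
move=> oU'; apply/smooth_onP => k.
apply: (@Ck_lin_comp _ _ oU' k _ _ (fst : {linear (W * X)%type -> W}) id); last exact: Ck_id.
by move=> x; exact: cvg_fst.
Qed.

Lemma smooth_snd W X (U' : set (W * X)%type) : open U' -> smooth_on U' (snd : W * X -> X).
Proof.
move=> oU'; apply/smooth_onP => k.
apply: (@Ck_lin_comp _ _ oU' k _ _ (snd : {linear (W * X)%type -> X}) id); last exact: Ck_id.
by move=> x; exact: cvg_snd.
Qed.

End SmoothOn.

Lemma smooth_expR : smooth_on setT (expR : R^o -> R^o).
Proof.
apply/smooth_onP; elim=> [|k IH].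
  by split => // x _; apply/derivable1_diffP; exact: ex_derive.
apply: (@Ck_is_diff R^o _ _ k R^o _ (fun x v => v * expR x : R^o)) => [|x _|v]; first exact: openT.
  by apply: is_diff_derive1; exact: is_derive_expR.
by apply: CkM; [exact: openT|exact: Ck_cst openT _ _ _|exact: IH].
Qed.

Lemma Ck_cos_sin k : Ck k setT (cos : R^o -> R^o) /\ Ck k setT (sin : R^o -> R^o).
Proof.
elim: k => [|k [IHc IHs]].
  by split; split => // x _; apply/derivable1_diffP; exact: ex_derive.
split.
  apply: (@Ck_is_diff R^o _ _ k R^o _ (fun x v => (- v) * sin x : R^o)) => [|x _|v]; first exact: openT.
    by apply: is_diff_eq (is_diff_derive1 (is_derive_cos x)) _; apply/funext => v; rewrite mulNr -mulrN.
  by apply: CkM; [exact: openT|exact: Ck_cst openT _ _ _|exact: IHs].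
apply: (@Ck_is_diff R^o _ _ k R^o _ (fun x v => v * cos x : R^o)) => [|x _|v]; first exact: openT.
  exact: is_diff_derive1.
by apply: CkM; [exact: openT|exact: Ck_cst openT _ _ _|exact: IHc].
Qed.

Lemma smooth_cos : smooth_on setT (cos : R^o -> R^o).
Proof. by apply/smooth_onP => k; case: (Ck_cos_sin k). Qed.

Lemma smooth_sin : smooth_on setT (sin : R^o -> R^o).
Proof. by apply/smooth_onP => k; case: (Ck_cos_sin k). Qed.

Lemma open_neq0 : open [set x : R^o | x != 0].
Proof. exact: open_neq. Qed.

Lemma smooth_inv : smooth_on [set x : R^o | x != 0] (GRing.inv : R^o -> R^o).
Proof.
apply/smooth_onP; elim=> [|k IH].
  by split => // x /= x0; exact: differentiable_Rinv.
apply: (@Ck_is_diff R^o _ _ k R^o _ (fun x v => (- v) * (x^-1 * x^-1) : R^o)) => [|x /= x0|v].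
- exact: open_neq0.
- apply: DiffDef; first exact: differentiable_Rinv.
  rewrite diff_Rinv//; apply/funext => v.
  by rewrite expr2 invfM [LHS]mulNr mulNr mulrC.
by apply: CkM; [exact: open_neq0|exact: Ck_cst open_neq0 _ _ _|apply: CkM => //; exact: open_neq0].
Qed.

Section SmoothElementary.
Variables (V : normedModType R) (U : set V).
Hypothesis oU : open U.
Implicit Type f : V -> R^o.

Lemma smooth_exp f : smooth_on U f -> smooth_on U (fun x => expR (f x) : R^o).
Proof. by move=> Hf; exact: smooth_comp framed_reals openT _ Hf smooth_expR. Qed.

Lemma smooth_cos_comp f : smooth_on U f -> smooth_on U (fun x => cos (f x) : R^o).
Proof. by move=> Hf; exact: smooth_comp framed_reals openT _ Hf smooth_cos. Qed.

Lemma smooth_sin_comp f : smooth_on U f -> smooth_on U (fun x => sin (f x) : R^o).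
Proof. by move=> Hf; exact: smooth_comp framed_reals openT _ Hf smooth_sin. Qed.

Lemma smoothV f : (forall x, U x -> f x != 0) -> smooth_on U f ->
  smooth_on U (fun x => (f x)^-1 : R^o).
Proof. by move=> f0 Hf; exact: smooth_comp framed_reals open_neq0 f0 Hf smooth_inv. Qed.

End SmoothElementary.

End SmoothCalculus.

(** * Even functions of one variable *)

Section PointwiseDerivatives.
Variables (R : realType) (V : normedModType R).
Implicit Types (f g : V -> R) (x v : V).

Lemma derD f g x v a b : is_derive x v f a -> is_derive x v g b ->
  is_derive x v (fun y => f y + g y) (a + b).
Proof. by move=> ? ?; exact: is_deriveD. Qed.

Lemma derN f x v a : is_derive x v f a -> is_derive x v (fun y => - f y) (- a).
Proof. by move=> ?; exact: is_deriveN. Qed.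

Lemma derB f g x v a b : is_derive x v f a -> is_derive x v g b ->
  is_derive x v (fun y => f y - g y) (a - b).
Proof. by move=> ? ?; exact: is_deriveB. Qed.

Lemma derM f g x v a b : is_derive x v f a -> is_derive x v g b ->
  is_derive x v (fun y => f y * g y) (f x * b + a * g x).
Proof. by move=> fa gb; rewrite [a * _]mulrC; exact: is_deriveM. Qed.

Lemma derZ c f x v a : is_derive x v f a -> is_derive x v (fun y => c * f y) (c * a).
Proof. by move=> fa; exact: is_deriveZ. Qed.

Lemma derX n f x v a : is_derive x v f a ->
  is_derive x v (fun y => f y ^+ n) (n%:R * f x ^+ n.-1 * a).
Proof.
move=> fa; have := is_deriveX n fa; rewrite (_ : f ^+ n = fun y => f y ^+ n) //.
by apply/funext => y; rewrite exprfctE.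
Qed.

Lemma der1_comp f (g : R -> R) x v a b : differentiable f x -> is_derive x v f a -> is_derive (f x) (1 : R) g b ->
  is_derive x v (fun y => g (f y)) (b * a).
Proof.
move=> df [_ fa] gb; have gd := is_diff_derive1 gb.
have D := is_diff_comp (differentiableP df) gd.
by have := is_derive_diff v D; rewrite /= -deriveE// fa mulrC.
Qed.

End PointwiseDerivatives.

Section RealDerivatives.
Variable R : realType.
Implicit Types (f g : R -> R) (x : R).

Lemma der_comp f g x a b : is_derive x (1:R) f a -> is_derive (f x) (1 : R) g b ->
  is_derive x (1:R) (fun y => g (f y)) (b * a).
Proof.
move=> fa gb; have df : differentiable f x by apply/derivable1_diffP; case: fa.
exact: der1_comp df fa gb.
Qed.

Lemma der_id x : is_derive x (1:R) (fun y : R => y) 1.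
Proof. exact: is_derive_id. Qed.

Lemma der_cst (c x : R) : is_derive x (1:R) (fun=> c) 0.
Proof. exact: is_derive_cst. Qed.

Lemma der_inv f x a : f x != 0 -> is_derive x (1:R) f a ->
  is_derive x (1:R) (fun y => (f y)^-1) (- a / f x ^+ 2).
Proof.
by move=> f0 /(is_deriveV f0) H; apply: is_derive_eq H _; rewrite [LHS]mulNr mulNr mulrC.
Qed.

Lemma der_exp f x a : is_derive x (1:R) f a ->
  is_derive x (1:R) (fun y => expR (f y)) (expR (f x) * a).
Proof. by move=> fa; exact: der_comp fa (is_derive_expR _). Qed.

End RealDerivatives.

Section EvenFunctions.
Variable R : realType.

Definition symm_itv (a : R) : set R^o := [set r : R^o | `|r| < a].

Lemma open_symm_itv a : open (symm_itv a).
Proof.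
rewrite (_ : symm_itv a = (fun r : R^o => `|r|) @^-1` [set x : R | x < a]) //.
by apply: open_comp => [r _|]; [exact: norm_continuous|exact: open_lt].
Qed.

Lemma MVT_symm (f df : R -> R) (a x y : R) :
  (forall r : R, `|r| < a -> is_derive r 1 f (df r)) -> `|x| < a -> `|y| < a ->
  exists c, [/\ Num.min x y <= c, c <= Num.max x y & f y - f x = df c * (y - x)].
Proof.
move=> H.
have K u v : `|u| < a -> `|v| < a -> u <= v ->
    exists c, [/\ u <= c, c <= v & f v - f u = df c * (v - u)].
  move=> ua va uv.
  have D r : r \in `[u, v] -> is_derive r 1 f (df r).
    rewrite in_itv/= => /andP[ur rv]; apply: H; rewrite ltr_norml.
    by move: ua va; rewrite !ltr_norml => /andP[? ?] /andP[? ?]; apply/andP; split; lra.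
  have D1 r : r \in `]u, v[ -> is_derive r 1 f (df r).
    by move=> ruv; apply: D; exact: subset_itv_oo_cc ruv.
  have D2 : {within `[u, v], continuous f}.
    by apply: derivable_within_continuous => r /D [].
  have [c cuv E] := MVT_segment uv D1 D2.
  by exists c; move: cuv; rewrite in_itv/= => /andP[-> ->].
move=> xa ya; case: (leP x y) => xy.
  by have [c [? ? ?]] := K _ _ xa ya xy; exists c; split.
have [c [? ? E]] := K _ _ ya xa (ltW xy); exists c; split => //.
by rewrite -opprB E; ring.
Qed.

Lemma derive0_const (f : R -> R) (a x y : R) :
  (forall r : R, `|r| < a -> is_derive r 1 f 0) -> `|x| < a -> `|y| < a -> f x = f y.
Proof.
move=> H xa ya; have [c [_ _ /eqP]] := MVT_symm H xa ya.
by rewrite mul0r subr_eq0 => /eqP.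
Qed.

Lemma derive0_const_itv (f : R -> R) (a b x y : R) :
  (forall r : R, b < r -> r < a -> is_derive r (1:R) f 0) ->
  b < x -> x < a -> b < y -> y < a -> f x = f y.
Proof.
move=> df bx xa bY ya; pose t0 := (a + b) / 2; pose h := (a - b) / 2.
have D (u : R) : `|u| < h -> is_derive u (1:R) (fun u => f (u + t0)) 0.
  rewrite ltr_norml => /andP[u1 u2].
  have dt : is_derive (u + t0) (1:R) f 0 by apply: df; move: u1 u2; rewrite /t0 /h; lra.
  by apply: is_derive_eq (der_comp (derD (der_id u) (der_cst t0 u)) dt) _; rewrite mul0r.
have xh : `|x - t0| < h by rewrite ltr_norml /h /t0; apply/andP; split; lra.
have yh : `|y - t0| < h by rewrite ltr_norml /h /t0; apply/andP; split; lra.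
by have := derive0_const D xh yh; rewrite !subrK.
Qed.

(* The data of a map [(b, z) |-> (e b + k, expR q * exp (i (m b + l)) z)] with coefficients
   depending on [r = |z|]; the radius of the inverse map is [r * expR p], and [e1] stands for
   [e' / r], etc.  The fields [cd_em], [cd_em1] and [cd_kl1] express that the contact form is
   multiplied by [expR (2 * q)]. *)
Lemma smooth_is_derive1 (U : set R^o) (f : R^o -> R^o) (r : R) : smooth_on U f -> U r ->
  is_derive r (1 : R) (f : R -> R) ('D_(1 : R^o) f r).
Proof. by move=> fs Ur; exact: is_derive_diff (smooth_is_diff fs Ur). Qed.

Lemma Ck_is_derive1 k (U : set R^o) (f d : R^o -> R^o) : open U ->
  (forall r : R, U r -> is_derive r (1 : R) (f : R -> R) (d r)) -> Ck k U d -> Ck k.+1 U f.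
Proof.
move=> oU fd dk; apply: (@Ck_is_diff _ _ _ oU k R^o f (fun x v => v * d x : R^o)).
  by move=> x Ux; exact: is_diff_derive1 (fd x Ux).
by move=> v; apply: CkM => //; exact: Ck_cst.
Qed.

Lemma smooth_of_derive1 (U : set R^o) (f d : R^o -> R^o) : open U ->
  (forall r : R, U r -> is_derive r (1 : R) (f : R -> R) (d r)) -> smooth_on U d -> smooth_on U f.
Proof.
move=> oU fd /smooth_onP ds; apply/smooth_onP => k; apply: CkW; exact: Ck_is_derive1 fd (ds k).
Qed.

(** The value at [0] is the limit of the quotient when [H 0 = 0] and [H' = r ^ k * h], since then
    [H] behaves like [h 0 * r ^ k.+1 / k.+1]. *)
Definition divq k (H h : R -> R) : R -> R :=
  fun r => if r == 0 then h 0 / k.+1%:R else H r / r ^+ k.+1.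

(* The derivative is again of the form [divq]; hence [divq] is smooth by induction. *)
Lemma divq_derive k (H h h' : R -> R) (a : R) :
  (forall r : R, `|r| < a -> is_derive r (1:R) H (r ^+ k * h r)) -> H 0 = 0 ->
  (forall r : R, `|r| < a -> is_derive r (1:R) h (h' r)) ->
  forall r : R, `|r| < a ->
  is_derive r (1:R) (divq k H h) (divq k.+1 (fun r => r ^+ k.+1 * h r - k.+1%:R * H r) h' r).
Proof.
move=> dH H0 dh r ra; rewrite {2}/divq; case: eqP => [r0|/eqP r0]; last first.
  have nr : \forall x \near r, x != 0.
    by apply: open_nbhs_nbhs; split => //; exact: open_neq.
  apply: (@near_eq_is_derive _ _ _ (fun x => H x / x ^+ k.+1)).
    by near=> x; rewrite /divq ifN//; near: x.
  have D1 := dH r ra.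
  have D2 : is_derive r (1 : R) (fun x : R => (x ^+ k.+1)^-1)
     (- (k.+1%:R * r ^+ k * 1) / (r ^+ k.+1) ^+ 2).
    apply: (@der_inv _ (fun x => x ^+ k.+1)); first by rewrite expf_neq0.
    exact: derX (der_id r).
  apply: is_derive_eq (derM D1 D2) _.
  by rewrite !exprS; field; rewrite r0 expf_neq0.
have a0 : 0 < a by apply: le_lt_trans ra; rewrite normr_ge0.
subst r; pose L (v : R^o) : R^o := v * (h' 0 / k.+2%:R).
have linL : linear L by move=> c u v; rewrite /L mulrDl -mulrA.
pose lM := GRing.isLinear.Build R R^o R^o _ L linL.
pose LL : {linear R^o -> R^o} := HB.pack L lM.
have cL : continuous LL by move=> x; apply: (@mulrr_continuous R (h' 0 / k.+2%:R)).
have D : is_diff (0 : R^o) (divq k H h : R^o -> R^o) LL.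
  apply: is_diff_eps => // e e0.
  have := is_diff_epsE (is_diff_derive1 (dh 0 ra)) e0.
  move=> /nbhs_ballP[d /= d0 Hd].
  near=> r.
  have rd : `|r| < d /\ `|r| < a.
    by split; near: r; apply: open_nbhs_nbhs; (split; [exact: open_symm_itv|rewrite /symm_itv/= normr0]).
  have [{}rd {}ra'] := rd.
  rewrite addr0 {2}/divq eqxx /LL/= /L.
  have [->|r0] := eqVneq r 0.
    by rewrite /divq eqxx subrr mul0r subr0 normr0 mulr0.
  rewrite /divq ifN//.
  (* [E] is [H] minus its expected Taylor part of degree [k.+2]. Its derivative is [x ^ k] times the
     first-order remainder of [h], so the mean value theorem bounds it by [e * |r| ^ k.+2], which is
     what remains small after division by [r ^ k.+1]. *)
  pose E (x : R) := H x - h 0 / k.+1%:R * x ^+ k.+1 - h' 0 / k.+2%:R * x ^+ k.+2.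
  have dE (x : R) : `|x| < a -> is_derive x (1:R) E (x ^+ k * (h x - h 0 - x * h' 0)).
    move=> xa; apply: is_derive_eq.
      apply: derB; [apply: derB|]; [exact: dH| | ];
      apply: derZ; exact: derX (der_id x).
    rewrite !mulr1 /=  exprS; field.
    by apply/andP; split; apply: lt0r_neq0; have := ler0n R k; lra.
  have [c [c1 c2]] := MVT_symm dE ra ra'.
  rewrite {2}/E H0 !expr0n /= !mulr0 !subr0 => EE.
  have cr : `|c| <= `|r|.
    move: c1 c2; case: (leP 0 r) => r0'.
      by move=> c0 cr; rewrite !ger0_norm// ?(ltW r0').
    by move=> c0 cr; rewrite !ler0_norm// ?(ltW r0') ?lerN2.
  have Hc : `|h c - h 0 - c * h' 0| <= e * `|c|.
    have := Hd c; rewrite /ball/= sub0r normrN addr0; apply.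
    exact: le_lt_trans cr rd.
  have F : H r / r ^+ k.+1 - h 0 / k.+1%:R - r * (h' 0 / k.+2%:R) = E r / r ^+ k.+1.
    rewrite /E !exprS; field.
    by rewrite r0 expf_neq0//=; apply/andP; split; apply: lt0r_neq0; have := ler0n R k; lra.
  rewrite F EE !normrM normfV !normrX ler_pdivrMr ?exprn_gt0 ?normr_gt0//.
  rewrite (_ : e * `|r| * `|r| ^+ k.+1 = `|r| ^+ k * (e * `|r|) * `|r|); last by rewrite exprS; ring.
  apply: ler_wpM2r => //; apply: ler_pM => //.
    by apply: lerXn2r; rewrite ?nnegrE.
  by apply: le_trans Hc _; rewrite ler_pM2l.
have := is_derive_diff (1 : R^o) D.
by move=> H1; apply: is_derive_eq H1 _; rewrite /LL/= /L mul1r.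
Unshelve. all: by end_near. Qed.

Lemma divq_smooth k (H h : R -> R) (a : R) :
  (forall r : R, `|r| < a -> is_derive r (1:R) H (r ^+ k * h r)) -> H 0 = 0 ->
  smooth_on (symm_itv a) (h : R^o -> R^o) ->
  smooth_on (symm_itv a) (divq k H h : R^o -> R^o).
Proof.
move=> dH H0 sh; apply/smooth_onP => m.
elim: m k H h dH H0 sh => [|m IH] k H h dH H0 sh.
  split=> // r ra; apply/derivable1_diffP.
  have dh (x : R) : `|x| < a -> is_derive x (1:R) h ('D_(1 : R^o) (h : R^o -> R^o) x).
    by move=> xa; exact: smooth_is_derive1 sh xa.
  by case: (divq_derive dH H0 dh ra).
have dh (x : R) : `|x| < a -> is_derive x (1:R) h ('D_(1 : R^o) (h : R^o -> R^o) x).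
  by move=> xa; exact: smooth_is_derive1 sh xa.
apply: (Ck_is_derive1 (@open_symm_itv a) (divq_derive dH H0 dh)).
(* In the derivative of the new numerator [r ^ k.+1 * h - k.+1 * H] the terms with [r ^ k] cancel
   and [r ^ k.+1 * h'] is left: the hypotheses recur with [k.+1] and [h']. *)
apply: IH => [x xa||]; last exact: smooth_derive.
  apply: is_derive_eq.
    apply: derB; first by apply: derM (dh x xa); exact: derX (der_id x).
    by apply: derZ; exact: dH.
  by rewrite /= !exprS; ring.
by rewrite expr0n/= mul0r H0 mulr0 subr0.
Qed.

(** These are the functions [E] for which [E(|z|)] is smooth across the origin, as [radial_smooth]
    shows. *)
Definition even_smooth (a : R) (f : R -> R) : Prop :=
  smooth_on (symm_itv a) (f : R^o -> R^o) /\ forall r, `|r| < a -> f (- r) = f r.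

(** The derivative of an even function is odd, hence vanishes at [0], and its quotient by [r] is
    even and smooth. This quotient, not the derivative, appears in the differential of [E(|z|)],
    namely [(E'/r) <z, v>]. *)
Lemma even_smooth_radial_derivative a f : 0 < a -> even_smooth a f ->
  exists2 f1, even_smooth a f1 & forall r : R, `|r| < a -> is_derive r (1:R) f (r * f1 r).
Proof.
move=> a0 [fs fe].
pose g (r : R) : R := 'D_(1 : R^o) (f : R^o -> R^o) r.
have dg (r : R) : `|r| < a -> is_derive r (1:R) f (g r).
  by move=> ra; exact: smooth_is_derive1 fs ra.
have gs : smooth_on (symm_itv a) (g : R^o -> R^o) by exact: smooth_derive.
have go (r : R) : `|r| < a -> g (- r) = - g r.
  move=> ra; have D1 : is_derive r (1:R) (fun x => f (- x)) (g (- r) * - 1).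
    by apply: (der_comp (derN (der_id r))); apply: dg; rewrite normrN.
  have D2 : is_derive r (1:R) (fun x => f (- x)) (g r).
    apply: near_eq_is_derive (dg r ra).
    near=> x; rewrite fe//; near: x.
    by apply: open_nbhs_nbhs; split => //; exact: open_symm_itv.
  have := @derive_val _ _ _ _ _ _ _ D1; rewrite (@derive_val _ _ _ _ _ _ _ D2).
  by rewrite mulrN1 => ->; rewrite opprK.
have g0 : g 0 = 0.
  have := go 0; rewrite normr0 oppr0 => /(_ a0) /eqP.
  by rewrite -addr_eq0 -mulr2n mulrn_eq0 => /eqP.
pose h (r : R) : R := 'D_(1 : R^o) (g : R^o -> R^o) r.
exists (divq 0 g h).
  split=> [|r ra].
    apply: divq_smooth => //; last exact: smooth_derive.
    by move=> r ra; rewrite expr0 mul1r; exact: smooth_is_derive1 gs ra.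
  by rewrite /divq oppr_eq0; case: eqP => // _; rewrite go// !expr1 invrN mulrNN.
move=> r ra; apply: is_derive_eq (dg r ra) _.
rewrite /divq; case: eqP => [->|/eqP r0]; first by rewrite mul0r.
by rewrite expr1 mulrC divfK.
Unshelve. all: by end_near. Qed.

Lemma even_smooth_div_sqr a f : 0 < a -> even_smooth a f -> f 0 = 0 ->
  exists2 g, even_smooth a g & forall r : R, `|r| < a -> f r = r ^+ 2 * g r.
Proof.
move=> a0 fe f0; have [f1 [f1s f1e] df] := even_smooth_radial_derivative a0 fe.
exists (divq 1 f f1).
  split=> [|r ra].
    by apply: divq_smooth => // r ra; rewrite expr1; exact: df.
  by rewrite /divq oppr_eq0; case: eqP => // _; rewrite fe.2// sqrrN.
move=> r ra; rewrite /divq; case: eqP => [->|/eqP r0]; first by rewrite f0 expr0n mul0r.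
by rewrite mulrC divfK// expf_neq0.
Qed.

(** [h] may fail to be integrable up to the endpoints, so primitives on smaller intervals,
    normalised at [0], are glued. Two of them agree on their common interval because their
    difference has derivative zero. *)
Lemma antiderivative (a : R) (h : R -> R) : 0 < a ->
  (forall r : R, `|r| < a -> {for r, continuous h}) ->
  exists2 G : R -> R, G 0 = 0 & forall r : R, `|r| < a -> is_derive r (1:R) G (h r).
Proof.
move=> a0 ch.
have loc c : c < a -> exists G : R -> R, forall r : R, `|r| < c -> is_derive r (1:R) G (h r).
  move=> ca; pose G x := (\int[lebesgue_measure]_(t in [set` Interval (BLeft (- c)) (BRight x)]) h t)%R.
  exists G => r; rewrite ltr_norml => /andP[r1 r2].
  have [|||D1 D2] := @continuous_FTC1 R h (BLeft (- c)) r c r2.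
  - apply: continuous_compact_integrable; first exact: segment_compact.
    apply: continuous_in_subspaceT => x; rewrite inE/= in_itv/= => /andP[x1 x2].
    by apply: ch; rewrite ltr_norml; apply/andP; split; lra.
  - by [].
  - by apply: ch; rewrite ltr_norml; apply/andP; split; lra.
  apply: DeriveDef; first exact: D1.
  by have := D2; rewrite derive1E.
pose mid (r : R) := (`|r| + a) / 2.
have mida (r : R) : `|r| < a -> mid r < a by rewrite /mid => ?; lra.
have midr (r : R) : `|r| < a -> `|r| < mid r by rewrite /mid => ?; lra.
have : forall r : R, exists G : R -> R, `|r| < a -> G 0 = 0 /\ forall x : R, `|x| < mid r -> is_derive x (1:R) G (h x).
  move=> r; have [ra|] := boolP (`|r| < a); last by exists (fun=> 0).
  have [G HG] := loc _ (mida _ ra); exists (fun x => G x - G 0) => _.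
  split=> [|x xa]; first by rewrite subrr.
  by apply: is_derive_eq (derB (HG x xa) (der_cst _ _)) _; rewrite subr0.
move=> /choice[G HG]; exists (fun r => G r r) => [|r ra].
  by have [] := HG 0; rewrite ?normr0.
apply: (@near_eq_is_derive _ _ _ (G r)); last first.
  by have [_] := HG r ra; apply; exact: midr.
near=> x.
have xr : `|x| < mid r.
  by near: x; apply: open_nbhs_nbhs; split; [exact: open_symm_itv|exact: midr].
have xa : `|x| < a by exact: lt_trans xr (mida _ ra).
have [G0 dG] := HG r ra; have [G0' dG'] := HG x xa.
have m0 : 0 < Num.min (mid r) (mid x).
  rewrite lt_min (le_lt_trans (normr_ge0 r) (midr _ ra)).
  by rewrite (le_lt_trans (normr_ge0 x) (midr _ xa)).
have D y : `|y| < Num.min (mid r) (mid x) -> is_derive y (1:R) (fun y => G r y - G x y) 0.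
  rewrite lt_min => /andP[y1 y2].
  by apply: is_derive_eq (derB (dG y y1) (dG' y y2)) _; rewrite subrr.
have := @derive0_const _ _ x 0 D; rewrite G0 G0' subrr normr0 => H.
by apply/eqP; rewrite -subr_eq0; apply/eqP; apply: H => //; rewrite lt_min xr midr.
Unshelve. all: by end_near. Qed.

(** The integrand [r * f r] is odd, so [F(-r) - F(r)] has derivative zero and vanishes at [0]. *)
Lemma even_smooth_antiderivative a f : 0 < a -> even_smooth a f ->
  exists2 F, even_smooth a F & forall r : R, `|r| < a -> is_derive r (1:R) F (r * f r).
Proof.
move=> a0 [fs fe].
have sm : smooth_on (symm_itv a) (fun r : R^o => r * f r : R^o).
  by apply: (smoothM (@open_symm_itv a)) => //; apply: smooth_id; exact: open_symm_itv.
have [F F0 dF] : exists2 F : R -> R, F 0 = 0 & forall r : R, `|r| < a -> is_derive r (1:R) F (r * f r).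
  by apply: antiderivative => // r ra; exact: smooth_continuous sm ra.
exists F => //; split; first exact: smooth_of_derive1 (@open_symm_itv a) dF sm.
have D r : `|r| < a -> is_derive r (1:R) (fun y => F (- y) - F y) 0.
  move=> ra; apply: is_derive_eq.
    apply: derB (dF r ra); apply: (der_comp (derN (der_id r))).
    by apply: dF; rewrite normrN.
  by rewrite fe//; ring.
move=> r ra; have a0' : `|0 : R| < a by rewrite normr0.
have := derive0_const D ra a0'; rewrite oppr0 subrr => /eqP.
by rewrite subr_eq0 => /eqP.
Qed.

End EvenFunctions.

(** * Implicit functions *)

Lemma near_symm_itv (R : realType) (a r : R) : `|r| < a ->
  \forall h \near (0 : R^o), `|h + r| < a.
Proof.
move=> ra; have cv : (fun h : R^o => h + r) @ (0 : R^o) --> (r : R^o).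
  by rewrite -[X in _ --> X]add0r; apply: cvgD; [exact: cvg_id|exact: cvg_cst].
by apply: (cv (symm_itv a)); apply: open_nbhs_nbhs; split => //; exact: open_symm_itv.
Qed.

Section ImplicitFunction.
Variable R : realType.
Variables (a : R) (O : set (R^o * R^o)) (Psi : R^o * R^o -> R^o) (q : R -> R).
Hypothesis oO : open O.
Hypothesis sPsi : smooth_on O Psi.
Hypothesis Oq : forall r : R, `|r| < a -> O (r, q r).
Hypothesis Psiq : forall r : R, `|r| < a -> Psi (r, q r) = 0.
Hypothesis dPsi : forall p, O p -> 'D_(0 : R^o, 1 : R^o) Psi p < 0.
Hypothesis convO : forall r x y z : R, O (r, x) -> O (r, z) -> x <= y -> y <= z -> O (r, y).

Lemma slice_derive (r t : R) : O (r, t) ->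
  is_derive t (1:R) (fun t => Psi (r, t)) ('D_(0 : R^o, 1 : R^o) Psi (r, t)).
Proof.
move=> Ort.
have D1 : is_diff (t : R^o) (fun t : R^o => (r : R^o, t)) (fun v => (0, v)).
  exact: (is_diff_pair (is_diff_cst (r : R^o) (t : R^o)) (is_diff_id (t : R^o))).
have D2 := smooth_is_diff sPsi Ort.
exact: (is_derive_diff (1 : R^o) (is_diff_comp D1 D2)).
Qed.

Lemma slice_decr (r x y : R) : O (r, x) -> O (r, y) -> x < y -> Psi (r, y) < Psi (r, x).
Proof.
move=> Ox Oy xy.
have D t : t \in `[x, y] -> O (r, t).
  by rewrite in_itv/= => /andP[? ?]; exact: (convO Ox Oy).
have D1 t : t \in `]x, y[ -> is_derive t (1:R) (fun t => Psi (r, t)) ('D_(0 : R^o, 1 : R^o) Psi (r, t)).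
  by move=> tt; apply: slice_derive; apply: D; exact: subset_itv_oo_cc tt.
have D2 : {within `[x, y], continuous (fun t => Psi (r, t))}.
  by apply: derivable_within_continuous => t /D/slice_derive[].
have [c cxy E] := MVT_segment (ltW xy) D1 D2.
by rewrite -subr_lt0 E nmulr_rlt0 ?subr_gt0//; apply: dPsi; exact: D.
Qed.

(** Nothing is assumed about the regularity of [q]. The opposite signs of [Psi] slightly above and
    slightly below [q r] persist for nearby radii, and strict monotonicity on each slice traps the
    root between the two heights. *)
Lemma implicit_continuous (r : R) (e : R) : `|r| < a -> 0 < e ->
  \forall h \near (0 : R^o), `|q (h + r) - q r| < e.
Proof.
move=> ra e0.
have /nbhs_ballP[d /= d0 Hd] : nbhs (r : R^o, q r : R^o) O.
  by apply: open_nbhs_nbhs; split => //; exact: Oq.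
pose e' := Num.min e d / 2.
have m0 : 0 < Num.min e d by rewrite lt_min e0.
have e'0 : 0 < e' by rewrite divr_gt0.
have e'e : e' < e by apply: lt_le_trans (_ : Num.min e d <= e); [rewrite /e'; lra|rewrite ge_min lexx].
have e'd : e' < d by apply: lt_le_trans (_ : Num.min e d <= d); [rewrite /e'; lra|rewrite ge_min lexx orbT].
have O1 : O (r, q r + e').
  by apply: Hd; split => /=; [exact: ballxx|rewrite /ball/= opprD addNKr normrN gtr0_norm].
have O2 : O (r, q r - e').
  by apply: Hd; split => /=; [exact: ballxx|rewrite /ball/= opprB addrC subrK gtr0_norm].
have P1 : Psi (r, q r + e') < 0.
  by rewrite -(Psiq ra); apply: slice_decr => //; [exact: Oq|rewrite ltrDl].
have P2 : 0 < Psi (r, q r - e').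
  by rewrite -(Psiq ra); apply: slice_decr => //; [exact: Oq|rewrite gtrDl oppr_lt0].
have cp (y : R) : (fun h : R^o => (h + r, y) : R^o * R^o) @ (0 : R^o) --> ((r, y) : R^o * R^o).
  have [d1 _] := is_diff_pair (is_diffD (is_diff_id (0 : R^o)) (is_diff_cst (r : R^o) (0 : R^o)))
    (is_diff_cst (y : R^o) (0 : R^o)).
  by rewrite -[in X in _ --> X](add0r r); exact: differentiable_continuous d1.
have nO (y : R) : O (r, y) -> \forall h \near (0 : R^o), O (h + r, y).
  by move=> Oy; apply: (cp y); apply: open_nbhs_nbhs; split.
have nP (y : R) (S : set R) : open S -> O (r, y) -> S (Psi (r, y)) -> \forall h \near (0 : R^o), S (Psi (h + r, y)).
  move=> oS Oy Sy; have c := smooth_continuous sPsi Oy.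
  by apply: (cvg_comp _ _ (cp y) c); apply: open_nbhs_nbhs; split.
have A1 := nO _ O1. have A2 := nO _ O2.
have B1 := nP _ _ (@open_lt R 0) O1 P1. have B2 := nP _ _ (@open_gt R 0) O2 P2.
near=> h.
have ha : `|h + r| < a.
  by near: h; exact: near_symm_itv.
have Oh := Oq ha; have Ph := Psiq ha.
have h1 : O (h + r, q r + e') by near: h.
have h2 : O (h + r, q r - e') by near: h.
have h3 : Psi (h + r, q r + e') < 0 by near: h.
have h4 : 0 < Psi (h + r, q r - e') by near: h.
apply: lt_trans e'e; rewrite ltr_norml; apply/andP; split.
  rewrite ltrBrDl ltNge; apply/negP; rewrite le_eqVlt => /orP[/eqP E|/(slice_decr Oh h2)].
    by move: h4; rewrite -E Ph ltxx.
  by rewrite Ph ltNge (ltW h4).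
rewrite ltrBlDl ltNge; apply/negP; rewrite le_eqVlt => /orP[/eqP E|/(slice_decr h1 Oh)].
  by move: h3; rewrite E Ph ltxx.
by rewrite Ph ltNge (ltW h3).
Unshelve. all: by end_near. Qed.

Lemma implicit_derive (r : R) : `|r| < a ->
  is_derive r (1:R) q (- ('D_(1 : R^o, 0 : R^o) Psi (r, q r)) / 'D_(0 : R^o, 1 : R^o) Psi (r, q r)).
Proof.
move=> ra; set A := 'D_(1 : R^o, 0 : R^o) _ _; set C := 'D_(0 : R^o, 1 : R^o) _ _.
have C0 : C < 0 by apply: dPsi; exact: Oq.
pose L (v : R^o) : R^o := v * (- A / C).
have linL : linear L by move=> c u v; rewrite /L mulrDl -mulrA.
pose lM := GRing.isLinear.Build R R^o R^o _ L linL.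
pose LL : {linear R^o -> R^o} := HB.pack L lM.
have cL : continuous LL by move=> x; apply: (@mulrr_continuous R (- A / C)).
suff D : is_diff (r : R^o) (q : R^o -> R^o) LL.
  by apply: is_derive_eq (is_derive_diff (1 : R^o) D) _; rewrite /LL/= /L mul1r.
apply: is_diff_eps => // e e0.
have D := smooth_is_diff sPsi (Oq ra).
have DL (t k : R) : 'D_(t : R^o, k : R^o) Psi (r, q r) = t * A + k * C.
  have [d1 _] := D.
  rewrite /A /C !deriveE//.
  rewrite (_ : (t, k) = t *: (1 : R^o, 0 : R^o) + k *: (0 : R^o, 1 : R^o)).
    by rewrite linearD !linearZ.
  by apply: injective_projections; rewrite /= !scaler0 ?addr0 ?add0r [RHS]mulr1.
pose c := - C. have c0 : 0 < c by rewrite oppr_gt0.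
(* [Psi] vanishes at both points, so [|t A + k C| <= eta (|t| + |k|)]. The bound [eta <= c / 2]
   absorbs the term with [k] and gives [|k| <= M |t|]; the bound [eta <= e c / (1 + M)] then makes
   the error at most [e |t|]. *)
pose M := (2 * `|A| + c) / c.
have M0 : 0 < M by rewrite divr_gt0// ltr_wpDl// mulr_ge0.
pose eta := Num.min (c / 2) (e * c / (1 + M)).
have eta0 : 0 < eta.
  by rewrite lt_min !divr_gt0// ?mulr_gt0// addr_gt0.
have /nbhs_ballP[d /= d0 Hd] := is_diff_epsE D eta0.
have nc := implicit_continuous ra d0.
near=> t.
have td : `|t| < d.
  by near: t; apply: open_nbhs_nbhs; split; [exact: open_symm_itv|rewrite /symm_itv/= normr0].
have ta : `|t + r| < a.
  by near: t; exact: near_symm_itv.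
pose k := q (t + r) - q r.
have kd : `|k| < d by rewrite /k; near: t; exact: nc.
have := Hd (t, k); rewrite /ball/=.
have bb : ball ((0 : R^o, 0 : R^o) : R^o * R^o) d (t, k).
  by split; rewrite /ball/= sub0r normrN.
move=> /(_ bb); rewrite DL.
rewrite (_ : (t, k) + (r, q r) = (t + r, q (t + r))); last first.
  by apply: injective_projections; rewrite //= /k subrK.
rewrite Psiq// Psiq// subrr sub0r normrN => H.
have N : `|(t, k)| <= `|t| + `|k|.
  by change (Num.max `|t| `|k| <= `|t| + `|k|); rewrite ge_max lerDl lerDr !normr_ge0.
have H1 : `|t * A + k * C| <= eta * (`|t| + `|k|).
  by apply: le_trans H _; rewrite ler_pM2l.
have eta1 : eta <= c / 2 by rewrite ge_min lexx.
have eta2 : eta <= e * c / (1 + M) by rewrite ge_min lexx orbT.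
have H2 : `|k| <= M * `|t|.
  have : c * `|k| <= `|t * A + k * C| + `|A| * `|t|.
    have -> : c * `|k| = `|(t * A + k * C) - A * t|.
      rewrite (_ : t * A + k * C - A * t = - (c * k)); last by rewrite /c; ring.
      by rewrite normrN normrM gtr0_norm.
    by rewrite -normrM; exact: ler_normB.
  move=> H2.
  have H3 : eta * (`|t| + `|k|) <= c / 2 * (`|t| + `|k|) by rewrite ler_wpM2r// addr_ge0.
  rewrite /M mulrAC ler_pdivlMr//.
  by nra.
rewrite /LL/= /L -/k.
rewrite (_ : k - t * (- A / C) = (t * A + k * C) / C); last by field; rewrite lt_eqF.
rewrite normrM normfV (ltr0_norm C0) -/c ler_pdivrMr//.
apply: le_trans H1 _.
apply: (@le_trans _ _ (eta * ((1 + M) * `|t|))).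
  by rewrite ler_pM2l// mulrDl mul1r lerD2l.
have : eta * ((1 + M) * `|t|) <= e * c / (1 + M) * ((1 + M) * `|t|).
  by rewrite ler_wpM2r// mulr_ge0// addr_ge0// ltW.
move=> /le_trans; apply; rewrite le_eqVlt; apply/orP; left; apply/eqP.
by field; rewrite lt0r_neq0// addr_gt0.
Unshelve. all: by end_near. Qed.

(** Bootstrapping: the formula for [q'] is a smooth function of [(r, q r)], so [q] of class [k] has
    a derivative of class [k]. *)
Lemma implicit_smooth : smooth_on (symm_itv a) (q : R^o -> R^o).
Proof.
apply/smooth_onP; elim=> [|k IH].
  by split=> // r ra; apply/derivable1_diffP; case: (implicit_derive ra).
apply: (Ck_is_derive1 (@open_symm_itv _ a) implicit_derive).
have oI := @open_symm_itv R a.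
have cq : Ck k (symm_itv a) (fun r : R^o => (r, q r) : R^o * R^o).
  by apply: Ck_pair => //; exact: Ck_id.
have comp (F : R^o * R^o -> R^o) : smooth_on O F -> Ck k (symm_itv a) (fun r : R^o => F (r, q r)).
  move=> /smooth_onP sF; apply: (Ck_comp oI _ oO _ cq (sF k)); last exact: Oq.
  by apply: framed_prod; exact: framed_reals.
apply: CkM => //.
  apply: (comp (fun p => - 'D_(1 : R^o, 0 : R^o) Psi p)).
  by apply: smoothN => //; exact: smooth_derive.
apply: (comp (fun p => ('D_(0 : R^o, 1 : R^o) Psi p)^-1)).
apply: smoothV => // [p /dPsi|]; first by move/lt_eqF => ->.
exact: smooth_derive.
Qed.

End ImplicitFunction.

(** * Transport of areas *)

Section RadialTransport.
Variable R : realType.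
Implicit Types (f g N : R -> R) (r q : R).

(** Order four is what the substitution [u = 1 / r^2] requires: [r^4 E du = - 2 r E dr] has a smooth
    even primitive, while the two lower terms produce [u] and [ln u]. *)
Lemma quartic_remainder (a : R) (f f1 : R -> R) : 0 < a -> even_smooth a f -> even_smooth a f1 ->
  (forall r : R, `|r| < a -> is_derive r (1:R) f (r * f1 r)) ->
  exists2 E : R -> R, even_smooth a E & forall r, `|r| < a ->
    f r = f 0 + f1 0 / 2 * r ^+ 2 + r ^+ 4 * E r.
Proof.
move=> a0 [fs fe] [f1s f1e] df.
have [Y [Ys Ye] HY] : exists2 Y : R -> R, even_smooth a Y &
    forall r : R, `|r| < a -> f1 r - f1 0 = r ^+ 2 * Y r.
  apply: (@even_smooth_div_sqr _ a (fun r => f1 r - f1 0)) => //; last exact: subrr.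
  split=> [|r ra]; last by rewrite f1e.
  by apply: (smoothB (@open_symm_itv _ a)) => //; apply: smooth_cst; exact: open_symm_itv.
pose D (r : R) := f r - f 0 - f1 0 / 2 * r ^+ 2.
have dD r : `|r| < a -> is_derive r (1:R) D (r ^+ 3 * Y r).
  move=> ra; apply: is_derive_eq (derB (derB (df r ra) (der_cst (f 0) r))
    (derZ (f1 0 / 2) (derX 2 (der_id r)))) _.
  rewrite (_ : r ^+ 3 * Y r = r * (r ^+ 2 * Y r)); last by ring.
  by rewrite -HY//=; field.
have D0 : D 0 = 0 by rewrite /D subrr expr0n mulr0 subr0.
exists (divq 3 D Y).
  split=> [|r ra]; first exact: divq_smooth.
  rewrite /divq oppr_eq0; case: eqP => // _.
  by rewrite /D fe// !sqrrN -[4%N]/(2 * 2)%N !exprM sqrrN.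
move=> r ra; rewrite /divq; case: eqP => [->|/eqP r0].
  by rewrite !expr0n/= mulr0 mul0r !addr0.
by rewrite [r ^+ 4 * _]mulrC divfK ?expf_neq0// /D; ring.
Qed.

(* With [u = 1 / (r * expR q) ^+ 2], the quotient [level N w0 w1 r q / r ^+ 2] is the primitive
   [w0 * u + w1 * ln u - N (r * expR q)] of the width with respect to [u], plus [2 * w1 * ln r];
   the factor [r ^+ 2] and the added logarithm make it smooth at [r = 0]. *)
Definition level N (w0 w1 r q : R) : R :=
  w0 * expR (- 2 * q) - 2 * w1 * r ^+ 2 * q - r ^+ 2 * N (r * expR q).

Definition level_domain (a : R) : set (R^o * R^o) :=
  [set p | `|p.1| < a /\ `|p.1 * expR p.2| < a].

(** Both sides measure the area at the same final radius. The factor is the quotient of the two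
    normalisations by the squared radius, and the extra term is the change of the added logarithm
    [2 w1 ln r]. *)
Lemma level_shift N w0 w1 r s q :
  level N w0 w1 (r * expR s) q = expR (2 * s) * (level N w0 w1 r (q + s) + 2 * w1 * r ^+ 2 * s).
Proof.
have e1 : expR (2 * s) = expR s ^+ 2.
  by rewrite expr2 -expRD; congr expR; ring.
have e2 : expR (- 2 * (q + s)) = expR (- 2 * q) / expR s ^+ 2.
  by rewrite expr2 -expRD -expRN -expRD; congr expR; ring.
have e3 : r * expR (q + s) = r * expR s * expR q by rewrite expRD; ring.
rewrite /level e1 e2 e3; field.
by rewrite lt0r_neq0// expR_gt0.
Qed.

Section OneProfile.
Variables (a w0 w1 : R) (w E N : R -> R).
Hypothesis a0 : 0 < a.
Hypothesis Ns : even_smooth a N.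
Hypothesis dN : forall r : R, `|r| < a -> is_derive r (1:R) N (r * (2 * E r)).
Hypothesis wE : forall r, `|r| < a -> w r = w0 + w1 * r ^+ 2 + r ^+ 4 * E r.
Hypothesis w_gt0 : forall r, `|r| < a -> 0 < w r.

(** For [u = 1 / (r e^q)^2] one has [du/dq = - 2 u] and [r^2 u = e^(-2q)], while the derivative of
    the primitive with respect to [u] is the width. *)
Lemma level_derive r q : `|r * expR q| < a ->
  is_derive q (1:R) (level N w0 w1 r) (- 2 * expR (- 2 * q) * w (r * expR q)).
Proof.
move=> ra; apply: is_derive_eq (derB (derB (derZ w0 (der_exp (derZ (- 2) (der_id q))))
  (derZ (2 * w1 * r ^+ 2) (der_id q)))
  (derZ (r ^+ 2) (der_comp (derZ r (der_exp (der_id q))) (dN ra)))) _.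
rewrite wE// (_ : - 2 * q = - q + - q); last by rewrite mulNr mulr_natl mulr2n opprD.
rewrite expRD !expRN; field.
by rewrite lt0r_neq0// expR_gt0.
Qed.

Lemma level_dom_conv r x y : `|r * expR y| < a -> x <= y -> `|r * expR x| < a.
Proof.
move=> ry xy; apply: le_lt_trans ry.
by rewrite !normrM ler_wpM2l// !(ger0_norm (expR_ge0 _)) ler_expR.
Qed.

Lemma level_decr r x y : `|r * expR y| < a -> x < y -> level N w0 w1 r y < level N w0 w1 r x.
Proof.
move=> ry xy.
have D t : t \in `[x, y] -> is_derive t (1:R) (level N w0 w1 r) (- 2 * expR (- 2 * t) * w (r * expR t)).
  by rewrite in_itv/= => /andP[_ ty]; apply: level_derive; exact: level_dom_conv ty.
have D1 t : t \in `]x, y[ -> is_derive t (1:R) (level N w0 w1 r) (- 2 * expR (- 2 * t) * w (r * expR t)).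
  by move=> tt; apply: D; exact: subset_itv_oo_cc tt.
have D2 : {within `[x, y], continuous (level N w0 w1 r)}.
  by apply: derivable_within_continuous => t /D[].
have [c cxy Ec] := MVT_segment (ltW xy) D1 D2.
rewrite -subr_lt0 Ec nmulr_rlt0 ?subr_gt0// !mulNr oppr_lt0 !mulr_gt0// ?expR_gt0//.
by apply: w_gt0; move: cxy; rewrite in_itv/= => /andP[_ cy]; exact: level_dom_conv cy.
Qed.

Lemma level_inj r x y : `|r * expR x| < a -> `|r * expR y| < a ->
  level N w0 w1 r x = level N w0 w1 r y -> x = y.
Proof.
move=> rx ry xy; case: (ltgtP x y) => // l.
  by have := level_decr ry l; rewrite xy ltxx.
by have := level_decr rx l; rewrite xy ltxx.
Qed.

Lemma level_even r q : `|r * expR q| < a -> level N w0 w1 (- r) q = level N w0 w1 r q.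
Proof. by move=> ra; rewrite /level (mulNr r) Ns.2// !sqrrN. Qed.

(** As [q] tends to minus infinity, [e^(-2q)] dominates the linear term, and [N] stays bounded
    because its argument remains in the compact interval of radius [|r|]. *)
Lemma level_large r v : `|r| < a -> exists2 q, q <= 0 & v <= level N w0 w1 r q.
Proof.
move=> ra.
have w00 : 0 < w0.
  by have := w_gt0 (r := 0); rewrite wE ?normr0// !expr0n/= mulr0 mul0r !addr0; apply.
have [M HM] : exists M, forall q, q <= 0 -> N (r * expR q) <= M.
  have cN : {within `[- `|r|, `|r|], continuous N}.
    apply: derivable_within_continuous => t; rewrite in_itv/= => /andP[t1 t2].
    have ta : `|t| < a by apply: le_lt_trans ra; rewrite ler_norml t1 t2.
    by case: (dN ta).
  have [|c _ Hc] := EVT_max _ cN; first by rewrite -subr_ge0 opprK addr_ge0.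
  exists (N c) => q q0; apply: Hc; rewrite in_itv/= -ler_norml normrM (ger0_norm (expR_ge0 q)).
  have : expR q <= expR 0 by rewrite ler_expR.
  by rewrite expR0 => ?; rewrite ler_piMr.
(* [C] collects the coefficients of all competing terms. With [x = C / w0] one gets
   [w0 (1 + x) >= C], so [w0 e^(2x) >= w0 (1 + x)^2 >= C (1 + x)], which beats both the linear and
   the constant contributions. *)
pose C := 2 * `|w1| * r ^+ 2 + r ^+ 2 * `|M| + `|v|.
have r2 := sqr_ge0 r.
have C0 : 0 <= C.
  by apply: addr_ge0 => //; apply: addr_ge0; apply: mulr_ge0 => //; rewrite mulr_ge0.
pose x := C / w0; have x0 : 0 <= x by rewrite divr_ge0// ltW.
exists (- x); first by rewrite oppr_le0.
have e1 : (1 + x) ^+ 2 <= expR (- 2 * - x).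
  rewrite mulrNN (_ : 2 * x = x + x); last by ring.
  rewrite expRD -expr2; apply: lerXn2r; rewrite ?nnegrE ?expR_ge0//; first lra.
  exact: expR_ge1Dx.
have e2 : w0 * (1 + x) ^+ 2 <= w0 * expR (- 2 * - x) by rewrite ler_pM2l.
have e3 : C * (1 + x) <= w0 * (1 + x) ^+ 2.
  rewrite expr2 mulrA ler_wpM2r//; first lra.
  by rewrite mulrDr mulr1 /x [w0 * _]mulrC divfK ?lt0r_neq0// lerDr ltW.
have e4 : r ^+ 2 * N (r * expR (- x)) <= r ^+ 2 * `|M|.
  by rewrite ler_wpM2l //; apply: le_trans (ler_norm M); apply: HM; rewrite oppr_le0.
have e5 : - (2 * `|w1| * r ^+ 2 * x) <= 2 * w1 * r ^+ 2 * x.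
  have h1 : - `|w1| <= w1 by rewrite lerNl -normrN ler_norm.
  have h2 : 0 <= r ^+ 2 * x by apply: mulr_ge0.
  have := ler_wpM2r h2 h1; lra.
have e6 : v <= `|v| by exact: ler_norm.
rewrite /level.
have : (r ^+ 2 * `|M| + `|v|) * 1 <= (r ^+ 2 * `|M| + `|v|) * (1 + x).
  by apply: ler_wpM2l; [apply: addr_ge0 => //; apply: mulr_ge0|lra].
have : 2 * `|w1| * r ^+ 2 * x <= 2 * `|w1| * r ^+ 2 * (1 + x).
  by apply: ler_wpM2l; [apply: mulr_ge0 => //; apply: mulr_ge0|lra].
move: e3; rewrite /C !mulrDl; lra.
Qed.

Lemma open_level_domain : open (level_domain a).
Proof.
have sf := @smooth_fst R R^o R^o setT openT.
have ss := @smooth_snd R R^o R^o setT openT.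
apply: openI.
  apply: (@open_comp _ _ (fst : R^o * R^o -> R^o) (symm_itv a)); last exact: open_symm_itv.
  by move=> p _; exact: (smooth_continuous sf).
apply: (@open_comp _ _ (fun p : R^o * R^o => p.1 * expR p.2 : R^o) (symm_itv a)); last exact: open_symm_itv.
move=> p _; have sm := smoothM openT sf (smooth_exp openT ss).
exact: (smooth_continuous sm).
Qed.

Lemma level_smooth : smooth_on (level_domain a) (fun p : R^o * R^o => level N w0 w1 p.1 p.2 : R^o).
Proof.
have oD := open_level_domain.
have sf := @smooth_fst R R^o R^o _ oD.
have ss := @smooth_snd R R^o R^o _ oD.
have c k := @smooth_cst R (R^o * R^o)%type _ oD R^o k.
have sM u v := @smoothM R (R^o * R^o)%type _ oD u v.
have sB u v := @smoothB R (R^o * R^o)%type _ oD R^o u v.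
have sX n u := @smoothX R (R^o * R^o)%type _ oD u n.
apply: (sB _ _); first apply: (sB _ _).
- by apply: (sM _ _ (c w0)); apply: smooth_exp => //; apply: (sM _ _ (c (- 2))).
- by apply: (sM _ _) => //; apply: (sM _ _); [exact: c|exact: (sX 2%N)].
apply: (sM _ _); first exact: (sX 2%N).
apply: (smooth_comp oD (@framed_reals R) (@open_symm_itv R a) _ _ Ns.1); first by move=> p [].
by apply: (sM _ _) => //; exact: smooth_exp.
Qed.

End OneProfile.

Section TwoProfiles.
Variables (a b w1 : R) (f g EF EG NF NG : R -> R).
Hypothesis b0 : 0 <= b.
Hypothesis ba : b < a.
Hypothesis NFs : even_smooth a NF.
Hypothesis NGs : even_smooth a NG.
Hypothesis dNF : forall r : R, `|r| < a -> is_derive r (1:R) NF (r * (2 * EF r)).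
Hypothesis dNG : forall r : R, `|r| < a -> is_derive r (1:R) NG (r * (2 * EG r)).
Hypothesis fE : forall r, `|r| < a -> f r = f 0 + w1 * r ^+ 2 + r ^+ 4 * EF r.
Hypothesis gE : forall r, `|r| < a -> g r = g 0 + w1 * r ^+ 2 + r ^+ 4 * EG r.
Hypothesis f_gt0 : forall r, `|r| < a -> 0 < f r.
Hypothesis g_gt0 : forall r, `|r| < a -> 0 < g r.
Hypothesis NFG : forall t, b < `|t| -> `|t| < a -> NF t - NG t = (f 0 - g 0) / t ^+ 2.

Let a0 : 0 < a. Proof. exact: le_lt_trans ba. Qed.

Notation LF := (level NF (f 0) w1).
Notation LG := (level NG (g 0) w1).

(** With [u = 1 / t^2], hypothesis [NFG] says [f 0 * u - NF t = g 0 * u - NG t]: the primitives of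
    the two widths agree where the shapes do. The logarithmic terms agree because [w1] is common. *)
Lemma level_eq_outside r q : b < `|r * expR q| -> `|r * expR q| < a -> LF r q = LG r q.
Proof.
move=> br ra; have := NFG br ra; set t := r * expR q => Ht.
have t0 : t != 0 by rewrite -normr_gt0; exact: le_lt_trans br.
have r0 : r != 0 by apply: contra_neq t0 => r0; rewrite /t r0 mul0r.
have e2 : expR (- 2 * q) = r ^+ 2 / t ^+ 2.
  have -> : - 2 * q = - q + - q by ring.
  rewrite expRD expRN /t; field.
  by rewrite r0 lt0r_neq0// expR_gt0.
apply/eqP; rewrite -subr_eq0; apply/eqP.
have -> : LF r q - LG r q = (f 0 - g 0) * expR (- 2 * q) - r ^+ 2 * (NF t - NG t).
  by rewrite /level /t; ring.
by rewrite Ht e2; field.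
Qed.

Lemma transport_exists r : `|r| < a -> exists q, `|r * expR q| < a /\ LG r q = LF r 0.
Proof.
move=> ra; have [->|r0] := eqVneq r 0.
  have F0 : 0 < f 0 by apply: f_gt0; rewrite normr0.
  have G0 : 0 < g 0 by apply: g_gt0; rewrite normr0.
  (* On the axis the equation degenerates to [g 0 * e^(-2q) = f 0]. *)
  exists (ln (g 0 / f 0) / 2); rewrite mul0r normr0; split => //.
  rewrite /level expr0n/= !mulr0 !mul0r !subr0 expR0 mulr1.
  rewrite (_ : - 2 * _ = - ln (g 0 / f 0)); last by field.
  rewrite expRN lnK ?posrE ?divr_gt0//; field.
  by rewrite !lt0r_neq0.
have nr0 : 0 < `|r| by rewrite normr_gt0.
(* The upper end of the interval for the intermediate value theorem: [q1] carries the radius to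
   [t1], beyond both [|r|] and [b]. There the two levels coincide, and [LF] is decreasing, so
   [LG r q1 = LF r q1 <= LF r 0]. *)
pose t1 := (Num.max `|r| b + a) / 2.
have mx : Num.max `|r| b < a by rewrite gt_max ra.
have [t1r t1b] : `|r| < t1 /\ b < t1.
  have : `|r| <= Num.max `|r| b by rewrite le_max lexx.
  have : b <= Num.max `|r| b by rewrite le_max lexx orbT.
  by rewrite /t1; split; lra.
have t1a : t1 < a by rewrite /t1; lra.
pose q1 := ln (t1 / `|r|).
have q1E : `|r * expR q1| = t1.
  have t1p : 0 < t1 / `|r| by apply: divr_gt0 => //; exact: lt_trans t1r.
  rewrite normrM (ger0_norm (expR_ge0 _)) /q1 lnK//.
  by rewrite mulrC divfK// lt0r_neq0.
have q10 : 0 < q1 by rewrite /q1 ln_gt0// ltr_pdivlMr// mul1r.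
have U : LG r q1 <= LF r 0.
  have q1a : `|r * expR q1| < a by rewrite q1E.
  have q1b : b < `|r * expR q1| by rewrite q1E.
  rewrite -(level_eq_outside q1b q1a); apply: ltW.
  exact: (level_decr dNF fE f_gt0).
have [q2 q20 L] := level_large a0 dNG gE g_gt0 (LF r 0) ra.
have q21 : q2 <= q1 by apply: le_trans q20 (ltW q10).
have D t : t \in `[q2, q1] -> `|r * expR t| < a.
  rewrite in_itv/= => /andP[_ tq]; apply: le_lt_trans t1a; rewrite -q1E.
  by rewrite !normrM ler_wpM2l// !(ger0_norm (expR_ge0 _)) ler_expR.
have C : {within `[q2, q1], continuous (LG r)}.
  by apply: derivable_within_continuous => t /D/(level_derive dNG gE)[].
have [|q qin qE] := IVT (v := LF r 0) q21 C.
  by rewrite le_max ge_min L U orbT.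
by exists q; split => //; exact: D.
Qed.

(** The last clause is [f du = g dU] for [U = u e^(-2q)], since [dU/du = e^(-2q) (1 + r q')]. *)
Lemma transport : exists q : R -> R, [/\ even_smooth a q,
  forall r, `|r| < a -> `|r * expR (q r)| < a /\ LG r (q r) = LF r 0,
  forall r, b < `|r| -> `|r| < a -> q r = 0 &
  forall r d, `|r| < a -> is_derive r (1:R) q d ->
    f r * expR (2 * q r) = (1 + r * d) * g (r * expR (q r))].
Proof.
have /choice[q Hq] : forall r, exists q, `|r| < a -> `|r * expR q| < a /\ LG r q = LF r 0.
  move=> r; have [ra|] := boolP (`|r| < a); last by exists 0.
  by have [q Hq] := transport_exists ra; exists q.
exists q; split => //.
- split.
    pose Psi (p : R^o * R^o) : R^o := LG p.1 p.2 - (f 0 - p.1 ^+ 2 * NF p.1).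
    have oD := @open_level_domain a.
    have sPsi : smooth_on (level_domain a) Psi.
      apply: (smoothB oD); first exact: (level_smooth (g 0) w1 NGs).
      apply: (smoothB oD); first exact: smooth_cst.
      apply: (smoothM oD); first exact: (smoothX oD 2 (@smooth_fst R R^o R^o _ oD)).
      apply: (smooth_comp oD (@framed_reals R) (@open_symm_itv R a) _ _ NFs.1); first by move=> p [].
      exact: (@smooth_fst R R^o R^o _ oD).
    apply: (@implicit_smooth R a (level_domain a) Psi q oD sPsi).
    + by move=> r ra; split => //; have [] := Hq r ra.
    + move=> r ra; have [_ E] := Hq r ra.
      by rewrite /Psi/= E /level !mulr0 expR0 !mulr1 subr0 subrr.
    + suff P (r t : R) : `|r| < a -> `|r * expR t| < a -> 'D_(0 : R^o, 1 : R^o) Psi (r, t) < 0.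
        by move=> [r t] [/= ? ?]; exact: P.
      move=> ra rta.
      have D1 := slice_derive (r := r) (t := t) sPsi (conj ra rta).
      have D2 := derB (level_derive dNG gE rta) (der_cst (f 0 - r ^+ 2 * NF r) t).
      have -> : 'D_(0 : R^o, 1 : R^o) Psi (r, t) = - 2 * expR (- 2 * t) * g (r * expR t) - 0.
        exact: etrans (esym (@derive_val _ _ _ _ _ _ _ D1)) (@derive_val _ _ _ _ _ _ _ D2).
      rewrite subr0.
      by rewrite !mulNr oppr_lt0 !mulr_gt0 ?expR_gt0//; exact: g_gt0.
    move=> r x y z [/= ra rx] [/= _ rz] xy yz; split => //=.
    exact: level_dom_conv rz yz.
  (* Evenness follows from uniqueness: [q r] and [q (- r)] solve the same equation because both
     levels are even in [r]. *)
  move=> r ra; have ra' : `|- r| < a by rewrite normrN.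
  have [q1 e1] := Hq r ra; have [q2 e2] := Hq (- r) ra'.
  have q2' : `|r * expR (q (- r))| < a by rewrite -normrN -mulNr.
  apply: (level_inj dNG gE g_gt0 q2' q1).
  rewrite -(level_even _ _ NGs q2') e2 e1; apply: (level_even _ _ NFs).
  by rewrite expR0 mulr1.
- move=> r br ra; have [q1 e1] := Hq r ra.
  apply: (level_inj dNG gE g_gt0 q1); first by rewrite expR0 mulr1.
  by rewrite e1; apply: level_eq_outside; rewrite expR0 mulr1.
move=> r d ra dq; have [q1 e1] := Hq r ra.
have Q1 := der_exp (derZ (- 2) dq).
have Q2 := derM (derX 2 (der_id r)) dq.
have Q3 := derM (derX 2 (der_id r)) (der_comp (derM (der_id r) (der_exp dq)) (dNG q1)).
have Q4 := derM (derX 2 (der_id r)) (dNF ra).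
have D := derB (derB (derB (derZ (g 0) Q1) (derZ (2 * w1) Q2)) Q3) (derB (der_cst (f 0) r) Q4).
have Z : is_derive r (1:R) (fun y => g 0 * expR (- 2 * q y) - 2 * w1 * (y ^+ 2 * q y) -
      y ^+ 2 * NG (y * expR (q y)) - (f 0 - y ^+ 2 * NF y)) 0.
  apply: near_eq_is_derive (der_cst 0 r).
  have : \forall x \near r, `|x| < a.
    by apply: open_nbhs_nbhs; split => //; exact: open_symm_itv.
  apply: filterS => x xa; have [_ ] := Hq x xa.
  rewrite /level !mulr0 expR0 !mulr1 subr0 => <-; ring.
have := @derive_val _ _ _ _ _ _ _ Z; rewrite (@derive_val _ _ _ _ _ _ _ D) /= => {Q1 Q2 Q3 Q4 D Z} Z.
have := e1; rewrite /level !mulr0 expR0 !mulr1 subr0 => {}e1.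
rewrite fE// gE//.
have e2 : expR (- 2 * q r) = (expR (q r) ^+ 2)^-1.
  by rewrite expr2 -expRD -expRN; congr expR; ring.
have e3 : expR (2 * q r) = expR (q r) ^+ 2.
  by rewrite expr2 -expRD; congr expR; ring.
rewrite e3; move: Z e1; rewrite e2.
have : expR (q r) != 0 by rewrite lt0r_neq0// expR_gt0.
move: (expR (q r)) (NG _) (NF _) (EG _) (EF _) (g 0) (f 0) => X ng nf eg ef G0 F0.
move: (q r) => Y X0 Z e1.
move: Z; set Zl := (X in X = 0) => Z.
apply/eqP; rewrite -subr_eq0; apply/eqP.
(* The levels carry a factor [r^2], and the operator [r d/dr - 2] removes it; so [r] times the
   differentiated equation is combined with minus twice the equation itself. *)
transitivity (X ^+ 2 / 2 * (r * Zl - 2 * (G0 / X ^+ 2 - 2 * w1 * r ^+ 2 * Y - r ^+ 2 * ng - (F0 - r ^+ 2 * nf)))).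
  by rewrite /Zl /=; field.
by rewrite Z e1 subrr !mulr0 subrr mulr0.
Qed.

End TwoProfiles.

(** By [level_shift], [- q] solves at the new radius the equation that determines [p], and solutions
    are unique. *)
Lemma transport_inverse (a w1 f0 g0 : R) (f EF NF NG : R -> R) (r q p : R) :
  (forall r : R, `|r| < a -> is_derive r (1:R) NF (r * (2 * EF r))) ->
  (forall r, `|r| < a -> f r = f0 + w1 * r ^+ 2 + r ^+ 4 * EF r) ->
  (forall r, `|r| < a -> 0 < f r) ->
  `|r| < a -> level NG g0 w1 r q = level NF f0 w1 r 0 ->
  `|r * expR q * expR p| < a ->
  level NF f0 w1 (r * expR q) p = level NG g0 w1 (r * expR q) 0 -> p = - q.
Proof.
move=> dNF fE f0' ra e1 ta e2.
apply: (level_inj dNF fE f0' ta); first by rewrite -mulrA -expRD subrr expR0 mulr1.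
by rewrite e2 !level_shift add0r addNr e1.
Qed.

Lemma radial_transport (a b : R) (f g f1 g1 : R -> R) : 0 <= b -> b < a ->
  even_smooth a f -> even_smooth a g -> even_smooth a f1 -> even_smooth a g1 ->
  (forall r : R, `|r| < a -> is_derive r (1:R) f (r * f1 r)) ->
  (forall r : R, `|r| < a -> is_derive r (1:R) g (r * g1 r)) ->
  f1 0 = g1 0 ->
  (forall r, `|r| < a -> 0 < f r) -> (forall r, `|r| < a -> 0 < g r) ->
  (forall r, b < `|r| -> `|r| < a -> f r = g r) ->
  exists q p : R -> R, [/\ even_smooth a q /\ even_smooth a p,
    forall r, `|r| < a -> `|r * expR (q r)| < a /\ p (r * expR (q r)) = - q r,
    forall r, `|r| < a -> `|r * expR (p r)| < a /\ q (r * expR (p r)) = - p r,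
    forall r, b < `|r| -> `|r| < a -> q r = 0 &
    forall r d, `|r| < a -> is_derive r (1:R) q d ->
      f r * expR (2 * q r) = (1 + r * d) * g (r * expR (q r))].
Proof.
move=> b0 ba fs gs f1s g1s df dg fg1 f_gt0 g_gt0 fg.
have a0 : 0 < a by exact: le_lt_trans ba.
have [EF EFs fE] := quartic_remainder a0 fs f1s df.
have [EG EGs gE] := quartic_remainder a0 gs g1s dg.
rewrite fg1 in fE; set w1 := g1 0 / 2 in fE gE.
have twice E : even_smooth a E -> even_smooth a (fun r => 2 * E r).
  move=> [Es Ee]; split=> [|r ra]; last by rewrite Ee.
  apply: (smoothM (@open_symm_itv _ a)) => //.
  by apply: smooth_cst; exact: open_symm_itv.
have [N [Ns Ne] dN] := even_smooth_antiderivative a0 (twice _ EFs).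
have [NG NGs dNG] := even_smooth_antiderivative a0 (twice _ EGs).
pose t0 := (a + b) / 2.
have bt0 : b < t0 by rewrite /t0; lra.
have ta0 : t0 < a by rewrite /t0; lra.
pose del := f 0 - g 0.
(* The primitives are fixed only up to constants. On [b < t < a] the profiles agree, which forces
   [EF - EG = - del / t^4] and makes [D] constant; subtracting its value at the midpoint lets both
   areas be measured from the common part near the boundary. *)
pose D t := N t - NG t - del / t ^+ 2.
pose NF t := N t - D t0.
have NFs : even_smooth a NF.
  split=> [|r ra]; last by rewrite /NF Ne.
  apply: (smoothB (@open_symm_itv _ a)) => //.
  by apply: smooth_cst; exact: open_symm_itv.
have dNF (r : R) : `|r| < a -> is_derive r (1:R) NF (r * (2 * EF r)).
  by move=> ra; apply: is_derive_eq (derB (dN r ra) (der_cst (D t0) r)) _; rewrite subr0.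
have dD (t : R) : b < t -> t < a -> is_derive t (1:R) D 0.
  move=> bt at'; have tp : 0 < t by exact: le_lt_trans bt.
  have tn : `|t| = t by rewrite gtr0_norm.
  have ta : `|t| < a by rewrite tn.
  have t2 : t ^+ 2 != 0 by rewrite expf_neq0// lt0r_neq0.
  apply: is_derive_eq (derB (derB (dN t ta) (dNG t ta))
    (derZ del (der_inv (f := fun t => t ^+ 2) t2 (derX 2 (der_id t))))) _.
  have := fg t; rewrite tn => /(_ bt at').
  rewrite (fE _ ta) (gE _ ta) => E.
  have -> : EF t = EG t - del / t ^+ 4.
    apply: (@mulfI _ (t ^+ 4)); first by rewrite expf_neq0// lt0r_neq0.
    have -> : t ^+ 4 * EF t = t ^+ 4 * EG t - del by rewrite /del; lra.
    by field; rewrite lt0r_neq0.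
  by rewrite /=; field; rewrite lt0r_neq0.
have NFG t : b < `|t| -> `|t| < a -> NF t - NG t = del / t ^+ 2.
  have P s : b < s -> s < a -> NF s - NG s = del / s ^+ 2.
    move=> bs sa.
    have := derive0_const_itv dD bs sa bt0 ta0; rewrite /NF => E.
    by rewrite -E /D; ring.
  case: (leP 0 t) => t00; first by rewrite ger0_norm//; exact: P.
  rewrite ltr0_norm// => bt ta; have := P _ bt ta.
  have ta' : `|t| < a by rewrite ltr0_norm.
  by rewrite NFs.2// NGs.2// sqrrN.
have NGF t : b < `|t| -> `|t| < a -> NG t - NF t = (g 0 - f 0) / t ^+ 2.
  by move=> bt ta; rewrite -opprB NFG// -mulNr /del opprB.
have [q [qs q1 q2 q3]] := transport b0 ba NFs NGs dNF dNG fE gE f_gt0 g_gt0 NFG.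
have [p [ps p1 p2 p3]] := transport b0 ba NGs NFs dNG dNF gE fE g_gt0 f_gt0 NGF.
exists q, p; split => //.
  move=> r ra; have [h1 h2] := q1 r ra; split => //; have [h3 h4] := p1 _ h1.
  exact: (transport_inverse dNF fE f_gt0 ra h2 h3 h4).
move=> r ra; have [h1 h2] := p1 r ra; split => //; have [h3 h4] := q1 _ h1.
exact: (transport_inverse dNG gE g_gt0 ra h2 h3 h4).
Qed.

End RadialTransport.

(** * Radial functions on Euclidean space *)

Section Euclidean.
Variables (R : realType) (m : nat).
Implicit Types u v w z : 'rV[R]_m.

Definition dot u v : R^o := \sum_i u 0 i * v 0 i.

Lemma dotC u v : dot u v = dot v u.
Proof. by apply: eq_bigr => i _; rewrite mulrC. Qed.

Lemma dotDl u v w : dot (u + v) w = dot u w + dot v w.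
Proof. by rewrite /dot -big_split/=; apply: eq_bigr => i _; rewrite mxE mulrDl. Qed.

Lemma dotZl (c : R) u v : dot (c *: u) v = c * dot u v.
Proof. by rewrite /dot mulr_sumr; apply: eq_bigr => i _; rewrite mxE mulrA. Qed.

Lemma dotNl u v : dot (- u) v = - dot u v.
Proof. by rewrite -scaleN1r dotZl mulN1r. Qed.

Lemma dotDr u v w : dot w (u + v) = dot w u + dot w v.
Proof. by rewrite dotC dotDl !(dotC _ w). Qed.

Lemma dotZr (c : R) u v : dot v (c *: u) = c * dot v u.
Proof. by rewrite dotC dotZl dotC. Qed.

Lemma dotNr u v : dot v (- u) = - dot v u.
Proof. by rewrite dotC dotNl dotC. Qed.

Lemma dot0l v : dot 0 v = 0.
Proof. by rewrite -(scale0r 0) dotZl mul0r. Qed.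

Lemma dot0r v : dot v 0 = 0.
Proof. by rewrite dotC dot0l. Qed.

Lemma dot_ge0 v : 0 <= dot v v.
Proof. by apply: sumr_ge0 => i _; rewrite -expr2 sqr_ge0. Qed.

Lemma dot_eq0 v : dot v v = 0 -> v = 0.
Proof.
move=> /eqP; rewrite psumr_eq0; last by move=> i _; rewrite -expr2 sqr_ge0.
move=> /allP H; apply/rowP => i; rewrite mxE.
by have := H i (mem_index_enum _); rewrite /= mulf_eq0 orbb => /eqP.
Qed.

Definition nrm v : R := Num.sqrt (dot v v).

Lemma nrm_sqr v : nrm v ^+ 2 = dot v v.
Proof. by rewrite sqr_sqrtr// dot_ge0. Qed.

Lemma nrm_ge0 v : 0 <= nrm v. Proof. exact: sqrtr_ge0. Qed.

Lemma norm_nrm v : `|nrm v| = nrm v. Proof. by rewrite ger0_norm// nrm_ge0. Qed.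

Lemma nrm0 : nrm 0 = 0. Proof. by rewrite /nrm dot0l sqrtr0. Qed.

Lemma nrmZ (c : R) v : nrm (c *: v) = `|c| * nrm v.
Proof. by rewrite /nrm dotZl dotZr mulrA -expr2 sqrtrM ?sqr_ge0// sqrtr_sqr. Qed.

Lemma linear_row_smooth (W : normedModType R) (L : {linear 'rV[R]_m -> W}) (U : set 'rV[R]_m) :
  open U -> smooth_on U L.
Proof.
move=> oU; apply/smooth_onP => k.
apply: (@Ck_eq _ _ _ oU k _ (fun z => \sum_i coord_fun i z *: L (delta_mx 0 i))).
  by move=> z _; rewrite [in RHS](row_sum_delta z) linear_sum; apply: eq_bigr => i _; rewrite linearZ.
apply: Ck_sum => // i; apply: CkZ => //; last exact: Ck_cst.
by apply: (@Ck_lin_comp _ _ _ oU k _ _ (coord_fun i : {linear 'rV[R]_m -> R^o}) id); [exact: continuous_coord_fun|exact: Ck_id].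
Qed.

Lemma linear_row_continuous (W : normedModType R) (L : {linear 'rV[R]_m -> W}) : continuous L.
Proof. by move=> z; apply: smooth_continuous (linear_row_smooth L openT) _. Qed.

Lemma linear_row_is_diff (W : normedModType R) (L : {linear 'rV[R]_m -> W}) z : is_diff z L L.
Proof.
by apply: DiffDef; [apply: linear_differentiable|apply: diff_lin]; exact: linear_row_continuous.
Qed.

Section DotSmooth.
Variables (V : normedModType R) (U : set V).
Hypothesis oU : open U.

Lemma smooth_dot (f g : V -> 'rV[R]_m) : smooth_on U f -> smooth_on U g ->
  smooth_on U (fun x => dot (f x) (g x)).
Proof.
move=> /smooth_onP sf /smooth_onP sg; apply/smooth_onP => k.
apply: Ck_sum => // i; apply: CkM => //.
  by apply: (Ck_lin_comp oU (L := coord_fun i : {linear 'rV[R]_m -> R^o})); [exact: continuous_coord_fun|exact: sf].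
by apply: (Ck_lin_comp oU (L := coord_fun i : {linear 'rV[R]_m -> R^o})); [exact: continuous_coord_fun|exact: sg].
Qed.

End DotSmooth.

Lemma dot_is_bilinear :
  bilinear_for
    (GRing.Scale.Law.clone _ _ *:%R _) (GRing.Scale.Law.clone _ _ *:%R _) dot.
Proof. by split=> [u'|u'] c x y /=; rewrite ?dotDl ?dotDr ?dotZl ?dotZr. Qed.

HB.instance Definition _ := bilinear_isBilinear.Build R 'rV[R]_m 'rV[R]_m R^o _ _
  dot dot_is_bilinear.

Lemma is_diff_dot (V : normedModType R) (f df g dg : V -> 'rV[R]_m) x :
  is_diff x f df -> is_diff x g dg ->
  is_diff x (fun y => dot (f y) (g y)) (fun t => dot (f x) (dg t) + dot (df t) (g x)).
Proof.
move=> hf hg.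
have cB : continuous (fun p : 'rV[R]_m * 'rV[R]_m => dot p.1 p.2).
  move=> p; have := smooth_dot openT (@smooth_fst R _ _ setT openT) (@smooth_snd R _ _ setT openT).
  by move=> /smooth_continuous; apply.
have hB : is_diff (f x, g x) (fun p : 'rV[R]_m * 'rV[R]_m => dot p.1 p.2)
   (fun q => dot (f x) q.2 + dot q.1 (g x)).
  by apply: DiffDef; [exact: differentiable_bilin|rewrite diff_bilin].
exact: (is_diff_comp (is_diff_pair hf hg) hB).
Qed.

Definition eball (a : R) : set 'rV[R]_m := [set z | nrm z < a].

Lemma nrm_continuous : continuous nrm.
Proof.
move=> z; apply: (@continuous_comp _ _ _ (fun z => dot z z) Num.sqrt); last exact: sqrt_continuous.
by apply: (smooth_continuous (smooth_dot openT (smooth_id openT) (smooth_id openT))).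
Qed.

Lemma open_eball a : open (eball a).
Proof.
rewrite (_ : eball a = nrm @^-1` [set x : R | x < a]) //.
by apply: open_comp => [r _|]; [exact: nrm_continuous|exact: open_lt].
Qed.

(** The norm is not differentiable at [0], so the chain rule is replaced by a comparison of [E] with
    a multiple of the smooth function [|z|^2]; this treats [z = 0] and [z] nonzero alike. *)
Lemma radial_is_diff (a : R) (E E1 : R -> R) z : even_smooth a E1 ->
  (forall r : R, `|r| < a -> is_derive r (1:R) E (r * E1 r)) -> nrm z < a ->
  is_diff z (fun z => E (nrm z) : R^o) (fun v => E1 (nrm z) * dot z v).
Proof.
move=> [sE1 _] dE za; set r0 := nrm z.
have ra0 : `|r0| < a by rewrite norm_nrm.
(* [Phi' = r (E1 r - E1 r0)] is a small multiple of [r] near [r0]. The mean value theorem then gives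
   [|Phi r| <= (e / k) (r + r0) |r - r0| = (e / k) |r^2 - r0^2|], and [|z|^2] grows at most linearly
   with slope [k] near the point. *)
pose Phi r := E r - E r0 - E1 r0 / 2 * (r ^+ 2 - r0 ^+ 2).
have dPhi (r : R) : `|r| < a -> is_derive r (1:R) Phi (r * (E1 r - E1 r0)).
  move=> ra; apply: is_derive_eq (derB (derB (dE r ra) (der_cst (E r0) r))
    (derZ (E1 r0 / 2) (derB (derX 2 (der_id r)) (der_cst (r0 ^+ 2) r)))) _.
  by rewrite /=; field.
have sq := is_diff_dot (is_diff_id z) (is_diff_id z).
have sqPhi : is_diff z (fun z => Phi (nrm z) : R^o) (\0 : {linear 'rV[R]_m -> R^o}).
  apply: is_diff_eps => [|e e0]; first exact: cst_continuous.
  have [k k0 Hk] : exists2 k, 0 < k & \forall h \near (0 : 'rV[R]_m), `|dot (h + z) (h + z) - dot z z| <= k * `|h|.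
    have [d1 d2] := sq.
    have cd : continuous ('d (fun y => dot (id y) (id y)) z) by apply: diff_continuous.
    have [k k0 Hk] := linear_lipschitz cd.
    exists (k + 1); first by rewrite addr_gt0.
    have := is_diff_epsE (differentiableP d1) (@ltr01 R).
    apply: filterS => h H; have -> : dot (h + z) (h + z) - dot z z =
      (dot (h + z) (h + z) - dot z z - 'd (fun y => dot (id y) (id y)) z h) + 'd (fun y => dot (id y) (id y)) z h.
      by rewrite subrK.
    by rewrite mulrDl addrC; apply: le_trans (ler_normD _ _) (lerD (Hk h) H).
  have e1 : 0 < e / k by rewrite divr_gt0.
  have cE1 : {for (r0 : R^o), continuous (E1 : R^o -> R^o)} by exact: smooth_continuous sE1 ra0.
  have [d /= d0 Hd] : exists2 d, 0 < d & forall r, `|r - r0| < d -> `|E1 r - E1 r0| <= e / k.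
    move/cvgrPdist_le : cE1 => /(_ _ e1) /nbhs_ballP[d /= d0 Hd].
    by exists d => // r rd; rewrite distrC; apply: Hd; rewrite /ball/= distrC.
  have n1 : \forall h \near (0 : 'rV[R]_m), `|nrm (h + z) - r0| < d.
    have : \forall y \near z, `|nrm y - r0| < d.
      by have /cvgrPdist_lt/(_ _ d0) := @nrm_continuous z; apply: filterS => y; rewrite distrC.
    by rewrite (near_shift 0) subr0.
  have n2 : \forall h \near (0 : 'rV[R]_m), nrm (h + z) < a.
    have : \forall y \near z, nrm y < a.
      by apply: open_nbhs_nbhs; split => //; exact: open_eball.
    by rewrite (near_shift 0) subr0.
  near=> h.
  have h1 : `|nrm (h + z) - r0| < d by near: h.
  have h2 : nrm (h + z) < a by near: h.
  have h3 : `|dot (h + z) (h + z) - dot z z| <= k * `|h| by near: h.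
  have ra : `|nrm (h + z)| < a by rewrite norm_nrm.
  have P0 : Phi (nrm z) = 0 by rewrite /Phi /r0 !subrr mulr0 subrr.
  rewrite P0 !subr0.
  have [c [c1 c2]] := MVT_symm dPhi ra0 ra.
  rewrite -/r0 in P0; rewrite P0 subr0 => ->.
  have r00 : 0 <= r0 by exact: nrm_ge0.
  have r10 : 0 <= nrm (h + z) by exact: nrm_ge0.
  have cc : `|c| <= nrm (h + z) + r0.
    move: c1 c2; case: (leP r0 (nrm (h + z))) => _ c1 c2; rewrite ger0_norm; lra.
  have cd : `|E1 c - E1 r0| <= e / k.
    apply: Hd; apply: le_lt_trans h1.
    move: c1 c2; case: (leP r0 (nrm (h + z))) => l c1 c2.
      by rewrite !ger0_norm ?subr_ge0//; lra.
    by rewrite !ler0_norm ?subr_le0 ?(ltW l)//; lra.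
  rewrite !normrM.
  apply: (@le_trans _ _ ((nrm (h + z) + r0) * (e / k) * `|nrm (h + z) - r0|)).
    by rewrite ler_wpM2r// ler_pM.
  have -> : (nrm (h + z) + r0) * (e / k) * `|nrm (h + z) - r0| = e / k * `|dot (h + z) (h + z) - dot z z|.
    rewrite -!nrm_sqr subr_sqr normrM [`|_ + nrm z|]ger0_norm ?addr_ge0//.
    by rewrite -/r0; ring.
  have -> : e * `|h| = e / k * (k * `|h|) by field; rewrite lt0r_neq0.
  by rewrite ler_pM2l.
have D := is_diffD (is_diffD sqPhi (is_diff_cst (E r0 : R^o) z)) (is_diffZ (E1 r0 / 2)
  (is_diffB sq (is_diff_cst (r0 ^+ 2 : R^o) z))).
have F : (fun z => E (nrm z) : R^o) = 
   (fun y => Phi (nrm y) + E r0 + E1 r0 / 2 * (dot y y - r0 ^+ 2)).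
  by apply/funext => y; rewrite /Phi -nrm_sqr; ring.
rewrite F; apply: is_diff_eq D _.
apply/funext => v /=; rewrite !fctE /= !add0r subr0 (dotC v z).
by rewrite [LHS](_ : _ = E1 r0 / 2 * (dot z v + dot z v))//; field.
Unshelve. all: by end_near. Qed.

Lemma radial_smooth (a : R) (E : R -> R) : 0 < a -> even_smooth a E ->
  smooth_on (eball a) (fun z => E (nrm z) : R^o).
Proof.
move=> a0 sE; apply/smooth_onP => k; elim: k E sE => [|k IH] E sE;
  have [E1 sE1 dE] := even_smooth_radial_derivative a0 sE.
  by split=> // z za; have [] := radial_is_diff sE1 dE za.
apply: (@Ck_is_diff _ _ _ (@open_eball a) k _ _ (fun z v => E1 (nrm z) * dot z v)).
  by move=> z za; exact: radial_is_diff sE1 dE za.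
move=> v; apply: CkM; [exact: open_eball|exact: IH|].
have oB := @open_eball a.
have : smooth_on (eball a) (fun z => dot z v).
  by apply: smooth_dot => //; [exact: smooth_id|exact: smooth_cst].
by move=> /smooth_onP.
Qed.

End Euclidean.

(** * The equivariant contactomorphism *)

Section EvenSmoothClosure.
Variables (R : realType) (a : R).
Implicit Types (f g q : R -> R).
Let oI := @open_symm_itv R a.

Lemma even_smooth_cst (c : R) : even_smooth a (fun=> c).
Proof. by split=> //; exact: smooth_cst. Qed.

Lemma even_smoothD f g : even_smooth a f -> even_smooth a g -> even_smooth a (fun r => f r + g r).
Proof.
by move=> [fs fe] [gs ge]; split=> [|r ra]; [exact: (smoothD oI fs gs)|rewrite fe// ge].
Qed.

Lemma even_smoothB f g : even_smooth a f -> even_smooth a g -> even_smooth a (fun r => f r - g r).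
Proof.
by move=> [fs fe] [gs ge]; split=> [|r ra]; [exact: (smoothB oI fs gs)|rewrite fe// ge].
Qed.

Lemma even_smoothM f g : even_smooth a f -> even_smooth a g -> even_smooth a (fun r => f r * g r).
Proof.
by move=> [fs fe] [gs ge]; split=> [|r ra]; [exact: (smoothM oI fs gs)|rewrite fe// ge].
Qed.

Lemma even_smoothV f : (forall r, `|r| < a -> f r != 0) -> even_smooth a f ->
  even_smooth a (fun r => (f r)^-1).
Proof.
by move=> f0 [fs fe]; split=> [|r ra]; [exact: (smoothV oI f0 fs)|rewrite fe].
Qed.

Lemma even_smooth_exp f : even_smooth a f -> even_smooth a (fun r => expR (f r)).
Proof. by move=> [fs fe]; split=> [|r ra]; [exact: (smooth_exp oI fs)|rewrite fe]. Qed.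

Lemma even_smooth_sqr : even_smooth a (fun r : R => r ^+ 2).
Proof. by split=> [|r ra]; [exact: (smoothX oI 2 (smooth_id oI))|rewrite sqrrN]. Qed.

Lemma even_smooth_comp f q : even_smooth a f -> even_smooth a q ->
  (forall r, `|r| < a -> `|r * expR (q r)| < a) ->
  even_smooth a (fun r => f (r * expR (q r))).
Proof.
move=> [fs fe] [qs qe] qa; split=> [|r ra]; last by rewrite qe// mulNr fe// qa.
apply: (smooth_comp oI (@framed_reals R) oI _ _ fs); first exact: qa.
exact: (smoothM oI (smooth_id oI) (smooth_exp oI qs)).
Qed.

End EvenSmoothClosure.

(** The three relations compare, in this order, the coefficients of [db], [b dr] and [dr] in the
    pulled back form. The rotation contributes [e^(2q) r^2 / 2] times the differential of
    [m b + l]. *)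
Record contact_data (R : realType) (a b : R) (q p e k m l e1 k1 m1 l1 : R -> R) : Prop := ContactData {
  cd_q : even_smooth a q; cd_p : even_smooth a p; cd_e : even_smooth a e;
  cd_k : even_smooth a k; cd_m : even_smooth a m; cd_l : even_smooth a l;
  cd_e1 : even_smooth a e1; cd_k1 : even_smooth a k1;
  cd_m1 : even_smooth a m1; cd_l1 : even_smooth a l1;
  cd_qp : forall r, `|r| < a -> `|r * expR (q r)| < a /\ p (r * expR (q r)) = - q r;
  cd_pq : forall r, `|r| < a -> `|r * expR (p r)| < a /\ q (r * expR (p r)) = - p r;
  cd_e_gt0 : forall r, `|r| < a -> 0 < e r;
  cd_de : forall r : R, `|r| < a -> is_derive r (1:R) e (r * e1 r);
  cd_dk : forall r : R, `|r| < a -> is_derive r (1:R) k (r * k1 r);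
  cd_dm : forall r : R, `|r| < a -> is_derive r (1:R) m (r * m1 r);
  cd_dl : forall r : R, `|r| < a -> is_derive r (1:R) l (r * l1 r);
  cd_em : forall r, `|r| < a -> e r + expR (2 * q r) * r ^+ 2 * m r / 2 = expR (2 * q r);
  cd_em1 : forall r, `|r| < a -> e1 r = - (expR (2 * q r) * r ^+ 2 * m1 r / 2);
  cd_kl1 : forall r, `|r| < a -> k1 r = - (expR (2 * q r) * r ^+ 2 * l1 r / 2);
  cd_id : forall r, b < `|r| -> `|r| < a -> [/\ q r = 0, e r = 1, k r = 0, m r = 0 & l r = 0]
}.

Lemma contact_data_exists (R : realType) (a b : R) (Fp Fm Gp Gm Fp1 Fm1 Gp1 Gm1 : R -> R) :
  0 <= b -> b < a ->
  even_smooth a Fp -> even_smooth a Fm -> even_smooth a Gp -> even_smooth a Gm ->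
  even_smooth a Fp1 -> even_smooth a Fm1 -> even_smooth a Gp1 -> even_smooth a Gm1 ->
  (forall r : R, `|r| < a -> is_derive r (1:R) Fp (r * Fp1 r)) ->
  (forall r : R, `|r| < a -> is_derive r (1:R) Fm (r * Fm1 r)) ->
  (forall r : R, `|r| < a -> is_derive r (1:R) Gp (r * Gp1 r)) ->
  (forall r : R, `|r| < a -> is_derive r (1:R) Gm (r * Gm1 r)) ->
  Fp1 0 = Gp1 0 -> Fm1 0 = Gm1 0 ->
  (forall r, `|r| < a -> Fm r < Fp r) -> (forall r, `|r| < a -> Gm r < Gp r) ->
  (forall r, b < `|r| -> `|r| < a -> Fp r = Gp r /\ Fm r = Gm r) ->
  exists q p e k m l e1 k1 m1 l1 : R -> R,
    contact_data a b q p e k m l e1 k1 m1 l1 /\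
    forall r, `|r| < a -> e r * Fp r + k r = Gp (r * expR (q r)) /\
                          e r * Fm r + k r = Gm (r * expR (q r)).
Proof.
move=> b0 ba sFp sFm sGp sGm sFp1 sFm1 sGp1 sGm1 dFp dFm dGp dGm hp hm Flt Glt FG.
have a0 : 0 < a by exact: le_lt_trans ba.
have sF := even_smoothB sFp sFm. have sG := even_smoothB sGp sGm.
have sF1 := even_smoothB sFp1 sFm1. have sG1 := even_smoothB sGp1 sGm1.
have dF (r : R) : `|r| < a -> is_derive r (1:R) (fun r => Fp r - Fm r) (r * (Fp1 r - Fm1 r)).
  by move=> ra; apply: is_derive_eq (derB (dFp r ra) (dFm r ra)) _; rewrite mulrBr.
have dG (r : R) : `|r| < a -> is_derive r (1:R) (fun r => Gp r - Gm r) (r * (Gp1 r - Gm1 r)).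
  by move=> ra; apply: is_derive_eq (derB (dGp r ra) (dGm r ra)) _; rewrite mulrBr.
have [||||q [p [[sq sp] qp pq q0 qrel]]] := radial_transport b0 ba sF sG sF1 sG1 dF dG.
- by rewrite hp hm.
- by move=> r ra; rewrite subr_gt0 Flt.
- by move=> r ra; rewrite subr_gt0 Glt.
- by move=> r br ra; have [-> ->] := FG r br ra.
have [q1 sq1 dq] := even_smooth_radial_derivative a0 sq.
have [q2 sq2 dq1] := even_smooth_radial_derivative a0 sq1.
(* [A = 1 + r q'] is the factor by which [q] stretches [u], up to [e^(-2q)]. It is positive because
   the area relation makes it a quotient of positive quantities. *)
pose A (r : R) := 1 + r ^+ 2 * q1 r.
have sA : even_smooth a A.
  apply: even_smoothD; first exact: even_smooth_cst.
  by apply: even_smoothM => //; exact: even_smooth_sqr.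
have Arel r : `|r| < a -> (Fp r - Fm r) * expR (2 * q r) = A r * (Gp (r * expR (q r)) - Gm (r * expR (q r))).
  by move=> ra; rewrite (qrel r (r * q1 r) ra (dq r ra)) /A; ring.
have A_gt0 r : `|r| < a -> 0 < A r.
  move=> ra; have [ta _] := qp r ra.
  have := Arel r ra; have g0 : 0 < Gp (r * expR (q r)) - Gm (r * expR (q r)) by rewrite subr_gt0 Glt.
  move=> E; rewrite -(pmulr_lgt0 _ g0) -E mulr_gt0 ?expR_gt0//.
  by rewrite subr_gt0 Flt.
have A_neq0 r : `|r| < a -> A r != 0 by move=> ra; rewrite lt0r_neq0// A_gt0.
have sAV := even_smoothV A_neq0 sA.
have c2 := even_smooth_cst a (2 : R).
have sE2 : even_smooth a (fun r => expR (2 * q r)) by apply: even_smooth_exp; exact: even_smoothM.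
have dA (r : R) : `|r| < a -> is_derive r (1:R) A (r * (2 * q1 r + r ^+ 2 * q2 r)).
  move=> ra; apply: is_derive_eq (derD (der_cst 1 r) (derM (derX 2 (der_id r)) (dq1 r ra))) _.
  by rewrite /=; ring.
have dE2 (r : R) : `|r| < a -> is_derive r (1:R) (fun r => expR (2 * q r)) (r * (2 * q1 r * expR (2 * q r))).
  by move=> ra; apply: is_derive_eq (der_exp (derZ 2 (dq r ra))) _; ring.
have dAV (r : R) : `|r| < a -> is_derive r (1:R) (fun r => (A r)^-1) (- (r * (2 * q1 r + r ^+ 2 * q2 r)) / A r ^+ 2).
  by move=> ra; exact: der_inv (A_neq0 r ra) (dA r ra).
(* By the area relation, [e^(2q) / A] is the ratio of the new column height to the old one. Then
   [cd_em] forces [m = 2 (1 - 1/A) / r^2], which is the smooth function [2 q1 / A]. *)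
pose e (r : R) := expR (2 * q r) / A r.
pose m (r : R) := 2 * q1 r / A r.
pose e1 (r : R) := - (expR (2 * q r) * r ^+ 2 * (2 * (q2 r - 2 * (q1 r * q1 r)) * ((A r)^-1 * (A r)^-1)) / 2).
pose m1 (r : R) := 2 * (q2 r - 2 * (q1 r * q1 r)) * ((A r)^-1 * (A r)^-1).
have sm1 : even_smooth a m1.
  apply: even_smoothM; last exact: even_smoothM.
  by apply: even_smoothM => //; apply: even_smoothB => //; apply: even_smoothM => //; exact: even_smoothM.
have se1 : even_smooth a e1.
  have [H1 H2] : even_smooth a (fun r => expR (2 * q r) * r ^+ 2 * m1 r * (- 2^-1)).
    apply: even_smoothM; last exact: even_smooth_cst.
    by apply: even_smoothM => //; apply: even_smoothM => //; exact: even_smooth_sqr.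
  have H r : e1 r = expR (2 * q r) * r ^+ 2 * m1 r * (- 2^-1) by rewrite /e1 mulrN.
  by rewrite (_ : e1 = fun r => expR (2 * q r) * r ^+ 2 * m1 r * (- 2^-1))//; apply/funext.
have de (r : R) : `|r| < a -> is_derive r (1:R) e (r * e1 r).
  move=> ra; apply: is_derive_eq (derM (dE2 r ra) (dAV r ra)) _.
  have An := A_neq0 r ra; move: An; rewrite /e1 /A => An; field; exact: An.
have dm (r : R) : `|r| < a -> is_derive r (1:R) m (r * m1 r).
  move=> ra; apply: is_derive_eq (derM (derZ 2 (dq1 r ra)) (dAV r ra)) _.
  have An := A_neq0 r ra; move: An; rewrite /m1 /A => An; field; exact: An.
have se : even_smooth a e by exact: even_smoothM.
have sm : even_smooth a m by apply: even_smoothM => //; exact: even_smoothM.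
(* The translation is chosen to match the lower sheets; the upper ones follow from the ratio of
   column heights. *)
pose k (r : R) := Gm (r * expR (q r)) - e r * Fm r.
have qa r : `|r| < a -> `|r * expR (q r)| < a by move=> /qp[].
have sk : even_smooth a k.
  by apply: even_smoothB; [exact: even_smooth_comp|exact: even_smoothM].
pose k1 (r : R) := expR (2 * q r) * A r * Gm1 (r * expR (q r)) - (e1 r * Fm r + e r * Fm1 r).
have sk1 : even_smooth a k1.
  apply: even_smoothB; last by apply: even_smoothD; exact: even_smoothM.
  by apply: even_smoothM; [exact: even_smoothM|exact: even_smooth_comp].
have EE r : expR (2 * q r) = expR (q r) ^+ 2 by rewrite expr2 -expRD; congr expR; ring.
have dk (r : R) : `|r| < a -> is_derive r (1:R) k (r * k1 r).
  move=> ra; apply: is_derive_eq (derB (der_comp (derM (der_id r) (der_exp (dq r ra))) (dGm _ (qa r ra)))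
    (derM (de r ra) (dFm r ra))) _.
  by rewrite /k1 EE /A; ring.
have z0 : `|0 : R| < a by rewrite normr0.
(* [cd_kl1] determines [l1] only after division by [r^2]. The value [k1 0] is
   [e^(2 q 0) (Gm1 0 - Fm1 0)], which vanishes by equality of the lower second derivatives. *)
have k10 : k1 0 = 0.
  by rewrite /k1 /e1 /e /A hm !(expr0n, mul0r, mulr0, addr0, oppr0, add0r, mulr1, divr1) subrr.
have [k2 sk2 k12] := even_smooth_div_sqr a0 sk1 k10.
pose l1 (r : R) := - 2 * (k2 r * expR (- 2 * q r)).
have sl1 : even_smooth a l1.
  apply: even_smoothM; first exact: even_smooth_cst.
  apply: even_smoothM => //; apply: even_smooth_exp; apply: even_smoothM => //.
  exact: even_smooth_cst.
have [l0 sl0 dl0] := even_smooth_antiderivative a0 sl1.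
(* [l] is constant near the boundary; this constant of integration makes it zero there, so that the
   map is the identity and not a rotation. *)
pose t0 := (a + b) / 2; pose l (r : R) := l0 r - l0 t0.
have bt0 : b < t0 by rewrite /t0; lra.
have ta0 : t0 < a by rewrite /t0; lra.
have sl : even_smooth a l by apply: even_smoothB => //; exact: even_smooth_cst.
have dl (r : R) : `|r| < a -> is_derive r (1:R) l (r * l1 r).
  by move=> ra; apply: is_derive_eq (derB (dl0 r ra) (der_cst (l0 t0) r)) _; rewrite subr0.
have near_out (r : R) : b < `|r| -> `|r| < a -> \forall x \near r, b < `|x| /\ `|x| < a.
  move=> br ra; apply: filterI.
    apply: open_nbhs_nbhs; split => //.
    rewrite (_ : (fun y => _) = (fun r : R^o => `|r|) @^-1` [set x : R | b < x]) //.
    by apply: open_comp => [x _|]; [exact: norm_continuous|exact: open_gt].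
  by apply: open_nbhs_nbhs; split => //; exact: open_symm_itv.
have out r : b < `|r| -> `|r| < a -> [/\ q1 r = 0, e r = 1, m r = 0, k r = 0 & l1 r = 0].
  have der0 (f : R -> R) d x : b < `|x| -> `|x| < a ->
     (forall r, b < `|r| -> `|r| < a -> f r = 0) -> is_derive x (1:R) f (x * d) -> d = 0.
    move=> bx xa f0 df.
    have D : is_derive x (1:R) f 0.
      apply: near_eq_is_derive (der_cst 0 x).
      by apply: filterS (near_out x bx xa) => y [by' ya]; rewrite f0.
    have := @derive_val _ _ _ _ _ _ _ D; rewrite (@derive_val _ _ _ _ _ _ _ df) => /eqP.
    rewrite mulf_eq0 => /orP[/eqP x0|/eqP//].
    by move: bx; rewrite x0 normr0 ltNge b0.
  have Q1 x : b < `|x| -> `|x| < a -> q1 x = 0.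
    by move=> bx xa; apply: (der0 q (q1 x) x bx xa q0); exact: dq.
  have E1 x : b < `|x| -> `|x| < a -> e x = 1.
    by move=> bx xa; rewrite /e /A Q1// q0// !mulr0 addr0 expR0 divr1.
  have K0 x : b < `|x| -> `|x| < a -> k x = 0.
    move=> bx xa; rewrite /k E1// q0// expR0 mulr1 mul1r.
    by have [_ ->] := FG x bx xa; rewrite subrr.
  move=> br ra; split; [exact: Q1|exact: E1|by rewrite /m Q1// mulr0 mul0r|exact: K0|].
  have k1r : k1 r = 0 by apply: (der0 k (k1 r) r br ra K0); exact: dk.
  move: k1r; rewrite k12// => /eqP; rewrite mulf_eq0 expf_eq0/= => /orP[/eqP r0|/eqP k20].
    by move: br; rewrite r0 normr0 ltNge b0.
  by rewrite /l1 k20 mul0r mulr0.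
have lout r : b < `|r| -> `|r| < a -> l r = 0.
  have P s : b < s -> s < a -> l s = 0.
    move=> bs sa; have D (x : R) : b < x -> x < a -> is_derive x (1:R) l 0.
      move=> bx xa; have xx : `|x| = x by rewrite ger0_norm// ltW// (le_lt_trans b0).
      have xa' : `|x| < a by rewrite xx.
      apply: is_derive_eq (dl x xa') _.
      by have [||_ _ _ _ ->] := out x; rewrite ?mulr0 ?xx.
    by rewrite (derive0_const_itv D bs sa bt0 ta0) /l subrr.
  case: (leP 0 r) => r0; first by rewrite ger0_norm//; exact: P.
  rewrite ltr0_norm// => br ra; rewrite -sl.2; last by rewrite ltr0_norm.
  exact: P.
exists q, p, e, k, m, l, e1, k1, m1, l1; split.
  split => //.
  - by move=> r ra; rewrite /e divr_gt0 ?expR_gt0// A_gt0.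
  - move=> r ra; have An := A_neq0 r ra; move: An; rewrite /e /m /A => An; field; exact: An.
  - move=> r ra; rewrite k12// /l1 (_ : - 2 * q r = - (2 * q r)); last by ring.
    rewrite expRN; field; by rewrite lt0r_neq0// expR_gt0.
  by move=> r br ra; have [? ? ? ? ?] := out r br ra; split => //; [exact: q0|exact: lout].
move=> r ra; split; last by rewrite /k addrC subrK.
have := Arel r ra; rewrite /k => E.
have -> : Gp (r * expR (q r)) = Gm (r * expR (q r)) + e r * (Fp r - Fm r).
  have An := A_neq0 r ra; apply: (mulfI An).
  rewrite mulrDr /e.
  have -> : A r * (expR (2 * q r) / A r * (Fp r - Fm r)) = (Fp r - Fm r) * expR (2 * q r).
    by field.
  by rewrite E; ring.
ring.
Qed.

(** * The complex structure and the contact form *)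

Section ComplexStructure.
Variables (R : realType) (n : nat).
Implicit Types u v w z : 'rV[R]_(n + n).

Definition Jmul z : 'rV[R]_(n + n) := row_mx (- rsubmx z) (lsubmx z).

Lemma Jmul_is_linear : linear Jmul.
Proof.
move=> c u v; rewrite /Jmul scale_row_mx add_row_mx; congr row_mx; last by rewrite linearP.
by rewrite linearP opprD scalerN.
Qed.

HB.instance Definition _ := GRing.isLinear.Build R 'rV[R]_(n + n) 'rV[R]_(n + n) _ Jmul Jmul_is_linear.

Lemma JmulD u v : Jmul (u + v) = Jmul u + Jmul v. Proof. exact: linearD. Qed.

Lemma JmulZ (c : R) u : Jmul (c *: u) = c *: Jmul u. Proof. exact: linearZ. Qed.

Lemma dot_row u1 u2 (v1 v2 : 'rV[R]_n) : u1 = row_mx v1 v2 ->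
  dot u1 u2 = dot v1 (lsubmx u2) + dot v2 (rsubmx u2).
Proof.
move=> ->; rewrite /dot big_split_ord/=; congr (_ + _); apply: eq_bigr => i _.
  by rewrite row_mxEl mxE.
by rewrite row_mxEr mxE.
Qed.

Lemma dot_sub u v : dot u v = dot (lsubmx u) (lsubmx v) + dot (rsubmx u) (rsubmx v).
Proof. by apply: dot_row; rewrite hsubmxK. Qed.

Lemma dot_JJ u v : dot (Jmul u) (Jmul v) = dot u v.
Proof.
by rewrite [RHS]dot_sub (@dot_row _ _ (- rsubmx u) (lsubmx u))// /Jmul row_mxKl row_mxKr dotNl dotNr opprK addrC.
Qed.

Lemma Jmul_Jmul u : Jmul (Jmul u) = - u.
Proof. by rewrite /Jmul row_mxKl row_mxKr -opp_row_mx hsubmxK. Qed.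

Lemma dot_Jl u v : dot (Jmul u) v = - dot u (Jmul v).
Proof. by rewrite -dot_JJ Jmul_Jmul dotNl. Qed.

Lemma dot_Jself u : dot (Jmul u) u = 0.
Proof.
have /eqP := dot_Jl u u; rewrite (dotC u) -addr_eq0 -mulr2n mulrn_eq0 => /eqP//.
Qed.

Lemma alpha_stE (p v : Defs.space R n) : alpha_st p v = v.1 + 2^-1 * dot (Jmul p.2) v.2.
Proof.
rewrite /alpha_st; congr (_ + _ * _).
rewrite (@dot_row _ _ (- rsubmx p.2) (lsubmx p.2))// addrC /dot -big_split/=.
by apply: eq_bigr => j _; rewrite [(- rsubmx _) _ _]mxE mulNr.
Qed.

Lemma euclidean_normE z : euclidean_norm z = nrm z.
Proof. by rewrite /euclidean_norm /nrm /dot; congr Num.sqrt; apply: eq_bigr => i _; rewrite expr2. Qed.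

Lemma round_ballE (r : R) : round_ball (n := n) r = eball r.
Proof. by apply/seteqP; split => z; rewrite /round_ball /eball/= euclidean_normE. Qed.

End ComplexStructure.

Section ContactMap.
Variables (R : realType) (n : nat) (a b : R).
Variables (q p e k m l e1 k1 m1 l1 : R -> R).
Hypothesis a0 : 0 < a.
Hypothesis H : contact_data a b q p e k m l e1 k1 m1 l1.
Local Notation V := ('rV[R]_(n + n)).
Local Notation sp := (Defs.space R n).
Implicit Types (x y v : sp) (z : V).

Definition angle x : R^o := x.1 * m (nrm x.2) + l (nrm x.2).

Definition contact_map x : sp :=
  (e (nrm x.2) * x.1 + k (nrm x.2),
   (expR (q (nrm x.2)) * cos (angle x)) *: x.2
   + (expR (q (nrm x.2)) * sin (angle x)) *: Jmul x.2).

Definition back_radius z : R := nrm z * expR (p (nrm z)).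

Definition back_height y : R^o := (y.1 - k (back_radius y.2)) / e (back_radius y.2).

Definition back_angle y : R^o :=
  back_height y * m (back_radius y.2) + l (back_radius y.2).

Definition contact_map_inv y : sp :=
  (back_height y,
   (expR (p (nrm y.2)) * cos (back_angle y)) *: y.2
   - (expR (p (nrm y.2)) * sin (back_angle y)) *: Jmul y.2).

Definition cylinder : set sp := [set x | nrm x.2 < a].

Lemma nrm_rot z (E t : R) : 0 <= E ->
  nrm ((E * cos t) *: z + (E * sin t) *: Jmul z) = nrm z * E.
Proof.
move=> E0; rewrite /nrm !dotDl !dotDr !dotZl !dotZr dot_JJ dot_Jself (dotC z) dot_Jself.
rewrite (_ : _ + _ = (E ^+ 2) * (cos t ^+ 2 + sin t ^+ 2) * dot z z); last by ring.
by rewrite cos2Dsin2 mulr1 sqrtrM ?sqr_ge0// sqrtr_sqr ger0_norm// mulrC.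
Qed.

Lemma nrm_rotN z (E t : R) : 0 <= E ->
  nrm ((E * cos t) *: z - (E * sin t) *: Jmul z) = nrm z * E.
Proof.
by move=> E0; rewrite -(nrm_rot z (- t) E0) cosN sinN mulrN scaleNr.
Qed.

Lemma nrm_contact_map x : nrm (contact_map x).2 = nrm x.2 * expR (q (nrm x.2)).
Proof. by rewrite /contact_map/= nrm_rot// expR_ge0. Qed.

Lemma nrm_contact_map_inv y : nrm (contact_map_inv y).2 = back_radius y.2.
Proof. by rewrite /contact_map_inv/= nrm_rotN// expR_ge0. Qed.

Let absn z : nrm z < a -> `|nrm z| < a. Proof. by rewrite norm_nrm. Qed.

Lemma back_radius_lt z : nrm z < a -> back_radius z < a.
Proof.
move=> /absn/(cd_pq H)[+ _]; by rewrite ger0_norm ?mulr_ge0 ?nrm_ge0 ?expR_ge0.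
Qed.

Lemma contact_map_cylinder x : cylinder x -> cylinder (contact_map x).
Proof.
by rewrite /cylinder/= nrm_contact_map => /absn/(cd_qp H)[+ _]; rewrite ger0_norm ?mulr_ge0 ?nrm_ge0 ?expR_ge0.
Qed.

Lemma contact_map_inv_cylinder y : cylinder y -> cylinder (contact_map_inv y).
Proof. by rewrite /cylinder/= nrm_contact_map_inv; exact: back_radius_lt. Qed.

Lemma rotK z (E E' c s : R) : E * E' = 1 -> c ^+ 2 + s ^+ 2 = 1 ->
  (E' * c) *: ((E * c) *: z + (E * s) *: Jmul z)
  - (E' * s) *: Jmul ((E * c) *: z + (E * s) *: Jmul z) = z.
Proof.
move=> EE cs; rewrite JmulD !JmulZ Jmul_Jmul; move: (Jmul z) => w.
apply/rowP => i; rewrite !mxE.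
transitivity (E * E' * (c ^+ 2 + s ^+ 2) * z 0 i); first by ring.
by rewrite EE cs !mul1r.
Qed.

Lemma rotKN z (E E' c s : R) : E * E' = 1 -> c ^+ 2 + s ^+ 2 = 1 ->
  (E' * c) *: ((E * c) *: z - (E * s) *: Jmul z)
  + (E' * s) *: Jmul ((E * c) *: z - (E * s) *: Jmul z) = z.
Proof.
move=> EE cs; have cs' : c ^+ 2 + (- s) ^+ 2 = 1 by rewrite sqrrN.
by have := rotK z EE cs'; rewrite !mulrN !scaleNr opprK.
Qed.

Lemma contact_mapK x : cylinder x -> contact_map_inv (contact_map x) = x.
Proof.
move=> xa; have [_ pE] := cd_qp H (absn xa).
have rE : back_radius (contact_map x).2 = nrm x.2.
  by rewrite /back_radius nrm_contact_map pE -mulrA -expRD subrr expR0 mulr1.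
have e0 : e (nrm x.2) != 0 by rewrite lt0r_neq0// (cd_e_gt0 H (absn xa)).
have hE : back_height (contact_map x) = x.1.
  by rewrite /back_height rE /contact_map/= addrK mulrC mulKf.
have aE : back_angle (contact_map x) = angle x by rewrite /back_angle hE rE.
rewrite /contact_map_inv aE hE nrm_contact_map pE /contact_map/=.
rewrite rotK; [by case: x {xa pE rE e0 hE aE}|by rewrite -expRD subrr expR0|exact: cos2Dsin2].
Qed.

Lemma contact_map_invK y : cylinder y -> contact_map (contact_map_inv y) = y.
Proof.
move=> ya; have [_ qE] := cd_pq H (absn ya).
have ra := back_radius_lt ya.
have e0 : e (back_radius y.2) != 0.
  by rewrite lt0r_neq0// (cd_e_gt0 H)// ger0_norm ?mulr_ge0 ?nrm_ge0 ?expR_ge0.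
have aE : angle (contact_map_inv y) = back_angle y.
  by rewrite /angle nrm_contact_map_inv.
rewrite /contact_map aE nrm_contact_map_inv [q _]qE /contact_map_inv/=.
rewrite rotKN; [|by rewrite -expRD subrr expR0|exact: cos2Dsin2].
by rewrite /back_height mulrC divfK// subrK; case: y {ya qE ra e0 aE}.
Qed.

Lemma contact_map_id x : b < nrm x.2 -> nrm x.2 < a -> contact_map x = x.
Proof.
rewrite -(norm_nrm x.2) => bx xa; have [q0 e0 k0 m0 l0] := cd_id H bx xa.
rewrite /contact_map /angle q0 e0 k0 m0 l0 mulr0 !addr0 expR0 cos0 sin0 !mul1r scale1r scale0r addr0.
by case: x {bx xa q0 e0 k0 m0 l0}.
Qed.

Lemma contact_map_inv_id x : b < nrm x.2 -> nrm x.2 < a -> contact_map_inv x = x.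
Proof. by move=> bx xa; rewrite -{1}(contact_map_id bx xa) contact_mapK. Qed.

Lemma open_cylinder : open cylinder.
Proof.
apply: (@open_comp _ _ (snd : sp -> V) (eball a)); last exact: open_eball.
by move=> x _; exact: cvg_snd.
Qed.

Lemma smooth_radial_snd (E : R -> R) : even_smooth a E ->
  smooth_on cylinder (fun x => E (nrm x.2) : R^o).
Proof.
move=> sE; have := radial_smooth (m := n + n) a0 sE => sE'.
apply: (smooth_comp open_cylinder (@framed_row R (n + n)) (@open_eball _ _ a) _ _ sE') => //.
exact: (smooth_snd open_cylinder).
Qed.

Lemma smooth_J_snd : smooth_on cylinder (fun x => Jmul x.2).
Proof.
have := smooth_lin_comp open_cylinder (linear_row_continuous (L := @Jmul R n : {linear V -> V})) (smooth_snd open_cylinder).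
by [].
Qed.

Lemma contact_map_smooth : smooth_on cylinder contact_map.
Proof.
have oC := open_cylinder.
have s1 := @smooth_fst R R^o V _ oC. have s2 := @smooth_snd R R^o V _ oC.
have sa : smooth_on cylinder angle.
  by apply: (smoothD oC); [apply: (smoothM oC) => //|]; apply: smooth_radial_snd; [exact: cd_m H|exact: cd_l H].
have sE := smooth_exp oC (smooth_radial_snd (cd_q H)).
apply: (smooth_pair oC).
  apply: (smoothD oC); last exact: smooth_radial_snd (cd_k H).
  by apply: (smoothM oC) => //; exact: smooth_radial_snd (cd_e H).
apply: (smoothD oC).
  apply: (smoothZ oC) => //; apply: (smoothM oC) => //; exact: smooth_cos_comp.
apply: (smoothZ oC); last exact: smooth_J_snd.
apply: (smoothM oC) => //; exact: smooth_sin_comp.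
Qed.

Lemma contact_map_inv_smooth : smooth_on cylinder contact_map_inv.
Proof.
have oC := open_cylinder.
have s1 := @smooth_fst R R^o V _ oC. have s2 := @smooth_snd R R^o V _ oC.
have pa r : `|r| < a -> `|r * expR (p r)| < a by move=> /(cd_pq H)[].
have sb E : even_smooth a E -> smooth_on cylinder (fun y => E (back_radius y.2) : R^o).
  by move=> sE; exact: smooth_radial_snd (even_smooth_comp sE (cd_p H) pa).
have sh : smooth_on cylinder back_height.
  apply: (smoothM oC); first by apply: (smoothB oC) => //; exact: sb (cd_k H).
  apply: (smoothV oC) => [y ya|]; last exact: sb (cd_e H).
  by rewrite lt0r_neq0// (cd_e_gt0 H)// ger0_norm ?back_radius_lt ?mulr_ge0 ?nrm_ge0 ?expR_ge0.
have sa : smooth_on cylinder back_angle.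
  by apply: (smoothD oC); [apply: (smoothM oC) => //|]; apply: sb; [exact: cd_m H|exact: cd_l H].
have sE := smooth_exp oC (smooth_radial_snd (cd_p H)).
apply: (smooth_pair oC) => //.
apply: (smoothB oC).
  apply: (smoothZ oC) => //; apply: (smoothM oC) => //; exact: smooth_cos_comp.
apply: (smoothZ oC); last exact: smooth_J_snd.
apply: (smoothM oC) => //; exact: smooth_sin_comp.
Qed.

Lemma radial_snd_is_diff (E E1 : R -> R) x : even_smooth a E1 ->
  (forall r : R, `|r| < a -> is_derive r (1:R) E (r * E1 r)) -> cylinder x ->
  is_diff x (fun x => E (nrm x.2) : R^o) (fun v => E1 (nrm x.2) * dot x.2 v.2).
Proof.
move=> sE1 dE xa.
exact: (is_diff_comp (is_diff_snd x) (radial_is_diff sE1 dE xa)).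
Qed.

Lemma contact_map_alpha x v : cylinder x ->
  alpha_st (contact_map x) ('d contact_map x v) = expR (2 * q (nrm x.2)) * alpha_st x v.
Proof.
move=> xa.
have ra := absn xa.
have [q1 sq1 dq] := even_smooth_radial_derivative a0 (cd_q H).
have D1 : is_diff x (fst : sp -> R^o) fst := is_diff_fst x.
have D2 : is_diff x (snd : sp -> V) snd := is_diff_snd x.
have De := radial_snd_is_diff (cd_e1 H) (cd_de H) xa.
have Dk := radial_snd_is_diff (cd_k1 H) (cd_dk H) xa.
have Dm := radial_snd_is_diff (cd_m1 H) (cd_dm H) xa.
have Dl := radial_snd_is_diff (cd_l1 H) (cd_dl H) xa.
have Dq := radial_snd_is_diff sq1 dq xa.
have DJ := is_diff_comp D2 (linear_row_is_diff (@Jmul R n : {linear V -> V}) x.2).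
have DA := is_diffD (is_diffS D1 Dm) Dl.
have DE := is_diff_comp Dq (is_diff_derive1 (is_derive_expR (q (nrm x.2)))).
have Dc := is_diff_comp DA (is_diff_derive1 (is_derive_cos (angle x))).
have Ds := is_diff_comp DA (is_diff_derive1 (is_derive_sin (angle x))).
have DZ := is_diffD (is_diffS (is_diffS DE Dc) D2) (is_diffS (is_diffS DE Ds) DJ).
have DB := is_diffD (is_diffS De D1) Dk.
pose r := nrm x.2; pose d (v : sp) : R := dot x.2 v.2.
pose da (v : sp) : R := x.1 * (m1 r * d v) + v.1 * m r + l1 r * d v.
pose E := expR (q r); pose c := cos (angle x); pose s := sin (angle x).
pose dC (v : sp) : R := E * (da v * - s) + (q1 r * d v * E) * c.
pose dS (v : sp) : R := E * (da v * c) + (q1 r * d v * E) * s.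
have [_ ->] : is_diff x contact_map (fun v => (e r * v.1 + (e1 r * d v) * x.1 + k1 r * d v,
   ((E * c) *: v.2 + dC v *: x.2) + ((E * s) *: Jmul v.2 + dS v *: Jmul x.2))).
  exact: is_diff_pair DB DZ.
rewrite !alpha_stE /= -/r -/E -/c -/s JmulD !JmulZ Jmul_Jmul.
rewrite !(dotDl, dotDr, dotZl, dotZr, dotNl) dot_JJ dot_JJ dot_Jself -/(d v).
rewrite (dot_Jl x.2 v.2).
have cs : c ^+ 2 + s ^+ 2 = 1 by exact: cos2Dsin2.
have E2 : expR (2 * q r) = E ^+ 2 by rewrite /E expr2 -expRD; congr expR; ring.
have := cd_em H ra; have := cd_em1 H ra; have := cd_kl1 H ra; rewrite -/r E2 => h1 h2 h3.
have eE : e r = E ^+ 2 - E ^+ 2 * r ^+ 2 * m r / 2 by rewrite -{1}h3 addrK.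
rewrite {}h2 {}h1 /dC /dS /da -nrm_sqr -/r (dotC x.2 (Jmul x.2)) dot_Jself.
move: (dot x.2 (Jmul v.2)) => w.
(* The derivative of [q] drops out because it moves the point radially and [<J z, z> = 0]. What
   remains collapses by [c^2 + s^2 = 1] and the relation for [e]. *)
transitivity (e r * v.1 - (E ^+ 2 * r ^+ 2 * m1 r / 2) * d v * x.1 - (E ^+ 2 * r ^+ 2 * l1 r / 2) * d v
  + 2^-1 * E ^+ 2 * (c ^+ 2 + s ^+ 2) * (- w + r ^+ 2 * (x.1 * (m1 r * d v) + v.1 * m r + l1 r * d v))).
  by ring.
by rewrite cs eE; field.
Qed.

End ContactMap.

(** * Domains of shapes *)

Section Balls.
Variables (R : realType) (m : nat).
Implicit Types (z : 'rV[R]_m) (r : R).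

Definition cball r : set 'rV[R]_m := [set z | nrm z <= r].

Lemma closed_cball r : closed (cball r).
Proof.
rewrite (_ : cball r = @nrm R m @^-1` [set x : R | x <= r]) //.
by apply: closed_comp => [z _|]; [exact: nrm_continuous|exact: closed_le].
Qed.

Lemma coord_le_nrm z i : `|z 0 i| <= nrm z.
Proof.
rewrite -(ler_pXn2r (n := 2)) ?nnegrE ?nrm_ge0// nrm_sqr real_normK ?num_real//.
rewrite /dot (bigD1 i)//= -expr2 lerDl; apply: sumr_ge0 => j _.
by rewrite -expr2 sqr_ge0.
Qed.

Lemma compact_cball r : compact (cball r).
Proof.
apply: bounded_closed_compact; last exact: closed_cball.
exists r; split; first exact: num_real.
move=> M rM z zr.
have r0 : 0 <= r by apply: le_trans zr; exact: nrm_ge0.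
have M0 : 0 <= M by apply: ltW; exact: le_lt_trans rM.
rewrite /= [`|z|]mx_normrE; apply: bigmax_le => // -[i j] _ /=.
rewrite ord1; apply: le_trans (coord_le_nrm z j) _.
by apply: le_trans zr _; exact: ltW.
Qed.

Lemma closure_eball r : 0 < r -> closure (@eball R m r) = cball r.
Proof.
move=> r0; apply/seteqP; split.
  apply: (@subset_trans _ (closure (cball r))); first by apply: closureS => z /ltW.
  by rewrite -(closure_id _).1//; exact: closed_cball.
move=> z zr B Bz.
have cv : (fun t : R => t *: z) @ (1 : R) --> z.
  by rewrite -[X in _ --> X]scale1r; exact: scalel_continuous.
have /nbhs_ballP[d /= d0 Hd] := cv B Bz.
pose t := 1 - Num.min (d / 2) (2^-1).
have mn : 0 < Num.min (d / 2) (2^-1) by rewrite lt_min !divr_gt0//= invr_gt0.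
have t1 : t < 1 by rewrite /t ltrBlDr ltrDl.
have t0 : 0 <= t.
  have : Num.min (d / 2) 2^-1 <= 2^-1 :> R by rewrite ge_min lexx orbT.
  by rewrite /t => ?; lra.
exists (t *: z); split.
  rewrite /eball/= nrmZ ger0_norm//.
  have [->|z0] := eqVneq (nrm z) 0; first by rewrite mulr0.
  by apply: lt_le_trans zr; rewrite gtr_pMl// lt_neqAle eq_sym z0 nrm_ge0.
apply: Hd; rewrite /ball/= /t subKr gtr0_norm//.
have : Num.min (d / 2) 2^-1 <= d / 2 by rewrite ge_min lexx.
by move=> ?; lra.
Qed.

Lemma frontier_eball r : 0 < r -> frontier (@eball R m r) = [set z | nrm z = r].
Proof.
move=> r0; rewrite /frontier closure_eball// (interior_id _).1; last exact: open_eball.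
apply/seteqP; split => z /=; rewrite /cball /eball/=.
  by move=> [zr /negP]; rewrite -leNgt => rz; apply/eqP; rewrite eq_le zr.
by move=> ->; split; [exact: lexx|rewrite ltxx].
Qed.

End Balls.

(** * The region between two graphs over a ball *)

Section Region.
Variables (R : realType) (m : nat) (rho : R) (fm fp : 'rV[R]_m -> R^o).
Local Notation V := ('rV[R]_m).
Hypothesis rho0 : 0 < rho.
Hypothesis cfm : {within cball rho, continuous fm}.
Hypothesis cfp : {within cball rho, continuous fp}.
Hypothesis cfm0 : forall z, nrm z < rho -> {for z, continuous fm}.
Hypothesis cfp0 : forall z, nrm z < rho -> {for z, continuous fp}.
Hypothesis flt : forall z, nrm z < rho -> fm z < fp z.
Hypothesis feq : forall z, nrm z = rho -> fm z = fp z.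

Definition region : set (R^o * V) := [set x | nrm x.2 <= rho /\ fm x.2 <= x.1 /\ x.1 <= fp x.2].
Definition open_region : set (R^o * V) := [set x | nrm x.2 < rho /\ fm x.2 < x.1 /\ x.1 < fp x.2].

(** The region is the image of a cylinder under this map, which collapses the vertical segments over
    the boundary sphere. Compactness, closure and connectedness are all transferred from the
    cylinder. *)
Let par (k : R^o * V) : R^o * V := ((1 - k.1) * fm k.2 + k.1 * fp k.2, k.2).
Let K : set (R^o * V) := [set` `[0, 1]%R] `*` cball rho.
Let K0 : set (R^o * V) := [set k | 0 < k.1 /\ k.1 < 1 /\ nrm k.2 < rho].

Let fle z : nrm z <= rho -> fm z <= fp z.
Proof. by rewrite le_eqVlt => /orP[/eqP/feq ->//|/flt/ltW]. Qed.

Lemma compact_itv_cball : compact K.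
Proof. by apply: compact_setX; [exact: segment_compact|exact: compact_cball]. Qed.

Lemma par_continuous : {within K, continuous par}.
Proof.
apply/subspace_continuousP => k Kk.
have c2 : snd @ within K (nbhs k) --> within (cball rho) (nbhs k.2).
  move=> A HA; have HN : \forall y \near k, cball rho y.2 -> A y.2.
    exact: (@cvg_snd _ _ (nbhs k.1) (nbhs k.2) _ _ HA).
  by apply: filterS HN => y H [_ Ky]; exact: H.
have c1 : fst @ within K (nbhs k) --> k.1.
  move=> A HA; have HN : \forall y \near k, A y.1.
    exact: (@cvg_fst _ _ (nbhs k.1) (nbhs k.2) _ _ HA).
  by apply: filterS HN => y H _.
have c2' : snd @ within K (nbhs k) --> k.2.
  move=> A HA; have HN : \forall y \near k, A y.2.
    exact: (@cvg_snd _ _ (nbhs k.1) (nbhs k.2) _ _ HA).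
  by apply: filterS HN => y H _.
have k2 : cball rho k.2 by case: Kk.
have cm : fm \o snd @ within K (nbhs k) --> fm k.2.
  by apply: cvg_comp c2 _; move/subspace_continuousP : cfm; exact.
have cp : fp \o snd @ within K (nbhs k) --> fp k.2.
  by apply: cvg_comp c2 _; move/subspace_continuousP : cfp; exact.
have c3 : (fun k : R^o * V => (1 - k.1) * fm k.2 + k.1 * fp k.2 : R^o) @ within K (nbhs k) --> ((1 - k.1) * fm k.2 + k.1 * fp k.2 : R^o).
  apply: cvgD; apply: cvgM => //.
  by apply: cvgB => //; exact: cvg_cst.
exact: (cvg_pair c3 c2').
Qed.

Lemma par_image : par @` K = region.
Proof.
apply/seteqP; split=> x.
  move=> [k [/= + kr] <-]; rewrite in_itv/= => /andP[k0 k1].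
  split => //=; have := fle kr; set A := fm k.2; set B := fp k.2 => AB.
  by split; nra.
move=> [xr [x1 x2]].
have [E|E] := eqVneq (fm x.2) (fp x.2).
  exists (0, x.2); first by split => //=; rewrite in_itv/= lexx ler01.
  rewrite /par/= subr0 mul1r mul0r addr0.
  have -> : fm x.2 = x.1 by apply/eqP; rewrite eq_le x1 E x2.
  by case: (x).
have lt : 0 < fp x.2 - fm x.2 by rewrite subr_gt0 lt_neqAle E fle.
exists ((x.1 - fm x.2) / (fp x.2 - fm x.2), x.2).
  split => //=; rewrite in_itv/=; apply/andP; split.
    by apply: divr_ge0; [rewrite subr_ge0|exact: ltW].
  by rewrite ler_pdivrMr// mul1r lerD2r.
rewrite /par/= [X in (X, _)](_ : _ = x.1); first by case: (x).
by field; rewrite subr_eq0 eq_sym.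
Qed.

Lemma par_image0 : par @` K0 = open_region.
Proof.
apply/seteqP; split=> x.
  move=> [k [/= k0 [k1 kr]] <-]; split => //=; have := flt kr; set A := fm k.2; set B := fp k.2 => AB.
  by split; nra.
move=> [xr [x1 x2]].
have lt : 0 < fp x.2 - fm x.2 by rewrite subr_gt0 flt.
exists ((x.1 - fm x.2) / (fp x.2 - fm x.2), x.2).
  split => /=; first by apply: divr_gt0 => //; rewrite subr_gt0.
  by split => //; rewrite ltr_pdivrMr// mul1r ltrD2r.
rewrite /par/= [X in (X, _)](_ : _ = x.1); first by case: (x).
by field; rewrite lt0r_neq0.
Qed.

Lemma compact_region : compact region.
Proof. by rewrite -par_image; apply: continuous_compact; [exact: par_continuous|exact: compact_itv_cball]. Qed.

(** The segment from the centre [(1/2, 0)] of the cylinder to [k]. It stays in the open cylinder for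
    [t < 1], which gives density of the open region, and the images of these segments share a point,
    which gives connectedness. *)
Let ray (k : R^o * V) (t : R) : R^o * V := (2^-1 + t * (k.1 - 2^-1), t *: k.2).

Let ray_continuous k : continuous (ray k).
Proof.
move=> t.
have c1 : {for t, continuous (fun t : R => 2^-1 + t * (k.1 - 2^-1) : R^o)}.
  by apply: cvgD; [exact: cvg_cst|apply: cvgM; [exact: cvg_id|exact: cvg_cst]].
have c2 : {for t, continuous (fun t : R => t *: k.2)} by exact: scalel_continuous.
exact: (cvg_pair c1 c2).
Qed.

Let ray1 k : ray k 1 = k.
Proof. by rewrite /ray mul1r scale1r addrC subrK; case: k. Qed.

Let rayK0 k t : K k -> 0 <= t -> t < 1 -> K0 (ray k t).
Proof.
move=> [/=]; rewrite in_itv/= => /andP[k0 k1] kr t0 t1; split => /=; first by nra.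
split; first by nra.
rewrite nrmZ ger0_norm//; apply: (@le_lt_trans _ _ (t * rho)); last by rewrite gtr_pMl.
by rewrite ler_wpM2l.
Qed.

Lemma region_closure : closure open_region = region.
Proof.
apply/seteqP; split.
  apply: (@subset_trans _ (closure region)).
    by apply: closureS => x [? [? ?]]; split; [exact: ltW|split; exact: ltW].
  rewrite -(closure_id _).1//; apply: compact_closed; last exact: compact_region.
  exact: norm_hausdorff.
rewrite -par_image => _ [k Kk <-] B Bk.
move/subspace_continuousP : par_continuous => /(_ k Kk B Bk).
rewrite /within/= => HN.
have := @ray_continuous k 1; rewrite /continuous_at ray1 => /(_ _ HN) /nbhs_ballP[d /= d0 Hd].
pose t := 1 - Num.min (d / 2) (2^-1).
have mn : 0 < Num.min (d / 2) (2^-1) by rewrite lt_min !divr_gt0//= invr_gt0.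
have t1 : t < 1 by rewrite /t ltrBlDr ltrDl.
have t0 : 0 <= t.
  have : Num.min (d / 2) 2^-1 <= 2^-1 :> R by rewrite ge_min lexx orbT.
  by rewrite /t => ?; lra.
have Kt := rayK0 Kk t0 t1.
exists (par (ray k t)); split.
  by rewrite -par_image0; exists (ray k t).
apply: Hd.
  rewrite /ball/= /t subKr gtr0_norm//.
  have : Num.min (d / 2) 2^-1 <= d / 2 by rewrite ge_min lexx.
  by move=> ?; lra.
case: Kt => /= h1 [h2 h3]; split; first by rewrite /= in_itv/= !ltW.
by rewrite /cball/=; exact: ltW.
Qed.

Let par_continuous0 k : nrm k.2 < rho -> {for k, continuous par}.
Proof.
move=> kr.
have c1 : {for k, continuous (fst : R^o * V -> R^o)} by exact: cvg_fst.
have c2 : {for k, continuous (snd : R^o * V -> V)} by exact: cvg_snd.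
have cm : {for k, continuous (fm \o snd : R^o * V -> R^o)}.
  by apply: continuous_comp => //; exact: cfm0.
have cp : {for k, continuous (fp \o snd : R^o * V -> R^o)}.
  by apply: continuous_comp => //; exact: cfp0.
have c3 : {for k, continuous (fun k : R^o * V => (1 - k.1) * fm k.2 + k.1 * fp k.2 : R^o)}.
  apply: cvgD; apply: cvgM => //.
  by apply: cvgB => //; exact: cvg_cst.
exact: (cvg_pair c3 c2).
Qed.

Lemma open_open_region : open open_region.
Proof.
rewrite openE => x [xr [x1 x2]].
have c1 : {for x, continuous (fst : R^o * V -> R^o)} by exact: cvg_fst.
have c2 : {for x, continuous (snd : R^o * V -> V)} by exact: cvg_snd.
have cm : {for x, continuous (fun y : R^o * V => y.1 - fm y.2 : R^o)}.
  by apply: cvgB => //; apply: continuous_comp => //; exact: cfm0.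
have cp : {for x, continuous (fun y : R^o * V => fp y.2 - y.1 : R^o)}.
  by apply: cvgB => //; apply: continuous_comp => //; exact: cfp0.
have cn : {for x, continuous (fun y : R^o * V => nrm y.2 : R^o)}.
  by apply: continuous_comp => //; exact: nrm_continuous.
have N1 : \forall y \near x, nrm y.2 < rho.
  by apply: (cn [set t : R | t < rho]); apply: open_nbhs_nbhs; split => //; exact: open_lt.
have N2 : \forall y \near x, 0 < y.1 - fm y.2.
  by apply: (cm [set t : R | 0 < t]); apply: open_nbhs_nbhs; split; [exact: open_gt|rewrite /= subr_gt0].
have N3 : \forall y \near x, 0 < fp y.2 - y.1.
  by apply: (cp [set t : R | 0 < t]); apply: open_nbhs_nbhs; split; [exact: open_gt|rewrite /= subr_gt0].
rewrite /interior/=; near=> y; split; first by near: y.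
by split; rewrite -subr_gt0; near: y.
Unshelve. all: by end_near. Qed.

Lemma connected_open_region : connected open_region.
Proof.
rewrite -par_image0.
rewrite (_ : par @` K0 = \bigcup_(k in K0) ((par \o ray k) @` [set` `[0, 1]%R])); last first.
  apply/seteqP; split=> [x [k Kk <-]|x [k Kk [t t01 <-]]].
    by exists k => //; exists 1; rewrite /= ?ray1// in_itv/= ler01 lexx.
  exists (ray k t) => //; move: t01 Kk => /=; rewrite in_itv/= => /andP[t0 t1] [k0 [k1 kr]].
  split; rewrite /=; first by nra.
  split; first by nra.
  by rewrite nrmZ ger0_norm//; have := nrm_ge0 k.2; nra.
apply: bigcup_connected.
  exists (par (2^-1, 0)) => k _; exists 0; first by rewrite /= in_itv/= lexx ler01.
  by rewrite /= /ray mul0r addr0 scale0r.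
move=> k [k0 [k1 kr]]; apply: connected_continuous_connected; first exact: segment_connected.
apply: continuous_in_subspaceT => t; rewrite inE/= in_itv/= => /andP[t0 t1].
apply: continuous_comp; first exact: ray_continuous.
apply: par_continuous0; rewrite /= nrmZ ger0_norm//; have := nrm_ge0 k.2; nra.
Qed.

Lemma open_region_bounds : bounds (region `\` open_region) open_region.
Proof.
split.
- rewrite -par_image0; exists (par (2^-1, 0)); exists (2^-1, 0) => //.
  split; rewrite /= ?invr_gt0//; split; last by rewrite nrm0.
  by rewrite invf_lt1// ltr1n.
- exact: open_open_region.
- exact: connected_open_region.
- by rewrite region_closure; exact: compact_region.
by rewrite /frontier region_closure (interior_id _).1//; exact: open_open_region.
Qed.

End Region.

Section ShapeDomain.
Variables (R : realType) (m : nat) (rho : R) (S : vshape 'rV[R]_m).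
Hypothesis rho0 : 0 < rho.
Hypothesis sS : shadow S = eball rho.

Lemma shape_facts :
  [/\ {within cball rho, continuous (fminus S)}, {within cball rho, continuous (fplus S)},
    smooth_on (eball rho) (fminus S) /\ smooth_on (eball rho) (fplus S),
    forall z, nrm z < rho -> fminus S z < fplus S z
    & forall z, nrm z = rho -> fminus S z = fplus S z].
Proof.
have [_ _ [_ s1 s2] [c1 c2 lt eq] _] := shapeP S.
rewrite sS in s1 s2 c1 c2 lt eq.
rewrite (closure_eball _ rho0) in c1 c2; rewrite (frontier_eball _ rho0) in eq.
by split.
Qed.

Lemma shape_hypersurface :
  S = region rho (fminus S) (fplus S) `\` open_region rho (fminus S) (fplus S) :> set _.
Proof.
have [_ _ _ lt eq] := shape_facts.
have [_ _ _ _ SE] := shapeP S.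
rewrite [LHS]SE sS frontier_eball//; apply/seteqP; split=> x.
  move=> [[[xr E]|[xr E]]|[xr E]]; split.
  - by split; [exact: ltW|rewrite E; split => //; exact: ltW (lt _ xr)].
  - by move=> [_ []]; rewrite E ltxx.
  - by split; [exact: ltW|rewrite E; split => //; exact: ltW (lt _ xr)].
  - by move=> [_ [_]]; rewrite E ltxx.
  - by split; [rewrite xr|rewrite E eq].
  - by move=> []; rewrite xr ltxx.
move=> [[xr [x1 x2]] xo].
have [xlt|] := ltP (nrm x.2) rho; last first.
  move=> rx; have E : nrm x.2 = rho by apply/eqP; rewrite eq_le xr.
  by right; split => //; apply/eqP; rewrite eq_le x2 -eq// x1.
left; have [E|E] := eqVneq x.1 (fminus S x.2); first by left.
right; split => //; apply/eqP; rewrite eq_le x2/= leNgt; apply/negP => lt2.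
by apply: xo; split => //; split => //; rewrite lt_neqAle eq_sym E.
Qed.

(** The domain is defined by choice; uniqueness of the bounded domain, part of the definition of a
    shape, identifies it with the region between the sheets. *)
Lemma shape_domainE : shape_domain S = region rho (fminus S) (fplus S).
Proof.
have [c1 c2 [s1 s2] lt eq] := shape_facts.
have oB := @open_eball R m rho.
have c3 z : nrm z < rho -> {for z, continuous (fminus S)} by exact: smooth_continuous s1.
have c4 z : nrm z < rho -> {for z, continuous (fplus S)} by exact: smooth_continuous s2.
have B : bounds S (open_region rho (fminus S) (fplus S)).
  by rewrite shape_hypersurface; exact: open_region_bounds.
have [_ [U [_ uU]] _ _ _] := shapeP S.
rewrite /shape_domain (@xget_unique _ _ _ (open_region rho (fminus S) (fplus S)))//.
  exact: region_closure.
by move=> W bW; rewrite -(uU _ bW) (uU _ B).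
Qed.

End ShapeDomain.

(** * Existence of a contactomorphism *)

Section RadialFunctions.
Variable R : realType.

Lemma mul_row_tr m (u v : 'rV[R]_m) : u *m v^T = (dot u v)%:M.
Proof.
apply/matrixP => i j; rewrite !ord1 !mxE eqxx mulr1n.
by apply: eq_bigr => s _; rewrite mxE.
Qed.

(** The Householder reflection along [z - w] exchanges two vectors of equal length, because
    [|z - w|^2 = 2 <z, z - w>]. *)
Lemma orthogonal_transitive m (z w : 'rV[R]_m) : dot z z = dot w w ->
  exists2 A : 'M[R]_m, A *m A^T = 1%:M & z *m A = w.
Proof.
move=> zw; have [<-|neq] := eqVneq z w.
  by exists 1%:M; rewrite ?trmx1 mulmx1.
pose u := z - w; pose d : R := dot u u.
have d0 : d != 0 by apply: contra_neq neq => /dot_eq0/eqP; rewrite subr_eq0 => /eqP.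
pose A : 'M[R]_m := 1%:M - (2 / d) *: (u^T *m u).
have tA : A^T = A.
  by rewrite /A linearB/= trmx1 linearZ/= trmx_mul trmxK.
exists A.
  have MA : (u^T *m u) *m A = - (u^T *m u).
    rewrite /A mulmxBr mulmx1 -scalemxAr mulmxA -(mulmxA u^T u) mul_row_tr mul_mx_scalar -/d.
    rewrite -scalemxAl scalerA divfK// -{1}[u^T *m u]scale1r -scalerBl.
    by rewrite (_ : 1 - 2 = -1 :> R) ?scaleN1r//; ring.
  by rewrite tA {1}/A mulmxBl mul1mx -scalemxAl MA scalerN opprK /A subrK.
rewrite /A mulmxBr mulmx1 -scalemxAr mulmxA mul_row_tr mul_scalar_mx scalerA.
have -> : 2 / d * dot z u = 1.
  have -> : d = 2 * dot z u.
    rewrite /d /u !(dotDl, dotDr, dotNl, dotNr) zw (dotC w z); ring.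
  have := d0; rewrite /d => d0'; field.
  apply: contra_neq d0' => E.
  have -> : dot u u = 2 * dot z u.
    by rewrite /u !(dotDl, dotDr, dotNl, dotNr) zw (dotC w z); ring.
  by rewrite E mulr0.
by rewrite scale1r /u opprB addrC subrK.
Qed.

Variable n : nat.
Hypothesis n1 : (1 <= n)%N.
Local Notation V := ('rV[R]_(n + n)).

Definition axis : V := \row_(j < n + n) (j == 0%N :> nat)%:R.

Lemma nrm_axis : nrm axis = 1.
Proof.
rewrite /nrm (_ : dot _ _ = 1) ?sqrtr1//.
have nn : (0 < n + n)%N by rewrite addn_gt0 n1.
rewrite /dot (bigD1 (Ordinal nn))//= !mxE/= mulr1 big1 ?addr0// => i.
by rewrite -val_eqE/= mxE => /negbTE ->; rewrite mulr0.
Qed.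

Lemma nrm_scale_axis (r : R) : nrm (r *: axis) = `|r|.
Proof. by rewrite nrmZ nrm_axis mulr1. Qed.

Lemma radial_profileE (f : V -> R^o) (r : R) : radial_profile f r = f (r *: axis).
Proof. by []. Qed.

Variables (rho : R) (f : V -> R^o).
Hypothesis rho0 : 0 < rho.
Hypothesis rf : radially_symmetric (eball rho) f.

Lemma radial_eq (z w : V) : nrm z < rho -> nrm w = nrm z -> f w = f z.
Proof.
move=> zr wz; have [|A AA <-] := @orthogonal_transitive _ z w; last exact: rf.
by rewrite -!nrm_sqr wz.
Qed.

Lemma radial_nrm (z : V) : nrm z < rho -> f z = radial_profile f (nrm z).
Proof.
move=> zr; rewrite radial_profileE; apply/esym; apply: radial_eq => //.
by rewrite nrm_scale_axis norm_nrm.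
Qed.

Hypothesis sf : smooth_on (eball rho) f.

Lemma even_smooth_profile : even_smooth rho (radial_profile f).
Proof.
have oI := @open_symm_itv R rho.
split=> [|r ra].
  apply: (smooth_comp oI (@framed_row R (n + n)) (@open_eball R _ rho) _ _ sf).
    by move=> r; rewrite /eball/= nrm_scale_axis.
  by apply: (smoothZ oI); [exact: smooth_id|exact: smooth_cst].
rewrite !radial_profileE; apply: radial_eq; first by rewrite nrm_scale_axis.
by rewrite !nrm_scale_axis normrN.
Qed.

Lemma profile_second_derivative (F1 : R -> R) : even_smooth rho F1 ->
  (forall r : R, `|r| < rho -> is_derive r (1:R) (radial_profile f) (r * F1 r)) ->
  derive1n 2 (radial_profile f) 0 = F1 0.
Proof.
move=> [sF1 _] dF; have z0 : `|0 : R| < rho by rewrite normr0.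
rewrite derive1nS derive1n1 derive1E.
have D1 := smooth_is_derive1 sF1 z0.
have D := derM (der_id (0 : R)) D1.
have N : \forall x \near (0 : R), x * F1 x = (radial_profile f)^`()%classic x.
  have : \forall x \near (0 : R), `|x| < rho.
    by apply: open_nbhs_nbhs; split => //; exact: open_symm_itv.
  apply: filterS => x xr; rewrite derive1E.
  by rewrite (@derive_val _ _ _ _ _ _ _ (dF x xr)).
have := near_eq_is_derive N D => D'.
by rewrite (@derive_val _ _ _ _ _ _ _ D') mul0r add0r mul1r.
Qed.

End RadialFunctions.

Section Germs.
Variables (R : realType) (V W : normedModType R).

(** The differentials agree at the nearby points of [O], and they are continuous. This lets the
    contact condition, which is imposed on every local extension, be checked on a single one. *)
Lemma diff_eq_on_closure (O U : set V) (f g : V -> W) p v : open O -> open U -> U p ->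
  closure O p -> smooth_on U f -> smooth_on U g ->
  (forall x, O x -> U x -> f x = g x) -> 'd f p v = 'd g p v.
Proof.
move=> oO oU Up Op sf sg fg.
have sh := smoothB oU (smooth_derive v sf) (smooth_derive v sg).
have ch := smooth_continuous sh Up.
rewrite -!deriveE; [|exact: smooth_diff sg Up|exact: smooth_diff sf Up].
apply/eqP; rewrite -subr_eq0; apply/negPn/negP => h0.
have h1 : 0 < `|'D_v f p - 'D_v g p| by rewrite normr_gt0.
move/cvgrPdist_lt : ch => /(_ _ h1) N.
have [y [Oy [Uy ]]] := Op _ (filterI (open_nbhs_nbhs (conj oU Up)) N).
rewrite (_ : 'D_v f y = 'D_v g y) ?subrr ?subr0 ?ltxx//.
apply: near_eq_derive; near=> x; apply: fg; near: x; exact: open_nbhs_nbhs.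
Unshelve. all: by end_near. Qed.

End Germs.

Section ExtendedContactMap.
Variables (R : realType) (n : nat) (a b : R).
Variables (q p e k m l e1 k1 m1 l1 : R -> R).
Hypothesis b0 : 0 <= b.
Hypothesis ba : b < a.
Hypothesis H : contact_data a b q p e k m l e1 k1 m1 l1.
Local Notation V := ('rV[R]_(n + n)).
Local Notation sp := (Defs.space R n).
Implicit Types (x y v : sp).

Local Notation cm := (@contact_map R n q e k m l).
Local Notation ci := (@contact_map_inv R n p e k m l).
Local Notation cyl := (@cylinder R n a).

Let a0 : 0 < a. Proof. exact: le_lt_trans ba. Qed.

(** The coefficients are controlled only for radii below [a], so the formula cannot be used at the
    equator. As it is the identity for radii between [b] and [a], the two branches fit together
    smoothly. *)
Definition ext_map x : sp := if nrm x.2 < a then cm x else x.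
Definition ext_inv x : sp := if nrm x.2 < a then ci x else x.

Lemma ext_mapK x : ext_inv (ext_map x) = x.
Proof.
rewrite /ext_map; case: ifP => xa; rewrite /ext_inv ?xa//.
by have ya : nrm (cm x).2 < a := contact_map_cylinder H xa; rewrite ya (contact_mapK H).
Qed.

Lemma ext_invK x : ext_map (ext_inv x) = x.
Proof.
rewrite /ext_inv; case: ifP => xa; rewrite /ext_map ?xa//.
by have ya : nrm (ci x).2 < a := contact_map_inv_cylinder H xa; rewrite ya (contact_map_invK H).
Qed.

Let out : set sp := [set x | b < nrm x.2].

Let open_out : open out.
Proof.
apply: (@open_comp _ _ (fun x : sp => nrm x.2) [set t : R | b < t]); last exact: open_gt.
move=> x _; apply: (@continuous_comp _ _ _ (snd : sp -> V)); first exact: cvg_snd.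
exact: nrm_continuous.
Qed.

Lemma ext_map_out x : out x -> ext_map x = x.
Proof. by move=> bx; rewrite /ext_map; case: ifP => // xa; exact: (contact_map_id H). Qed.

Lemma ext_inv_out x : out x -> ext_inv x = x.
Proof. by move=> bx; rewrite /ext_inv; case: ifP => // xa; exact: (contact_map_inv_id H). Qed.

Lemma ext_inv_germ x : exists U g, [/\ open U, U x, smooth_on U g & forall y, U y -> ext_inv y = g y].
Proof.
have [xa|ax] := ltP (nrm x.2) a.
  exists cyl, ci; split => //; [exact: open_cylinder|exact: (contact_map_inv_smooth a0 H)|].
  by move=> y ya; rewrite /ext_inv ya.
exists out, id; split => //; [exact: lt_le_trans ax|exact: smooth_id|exact: ext_inv_out].
Qed.

Lemma ext_map_germ x : exists U g, [/\ open U, U x, smooth_on U g, forall y, U y -> ext_map y = g y &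
  (exists2 c, 0 < c & forall v, alpha_st (ext_map x) ('d g x v) = c * alpha_st x v) /\
  forall w, exists v, 'd g x v = w].
Proof.
have [xa|ax] := ltP (nrm x.2) a.
  exists cyl, cm; split => //; [exact: open_cylinder|exact: (contact_map_smooth a0 H)| |].
    by move=> y ya; rewrite /ext_map ya.
  split.
    exists (expR (2 * q (nrm x.2))); first exact: expR_gt0.
    by move=> v; rewrite /ext_map xa; exact: (contact_map_alpha a0 H).
  (* The differential of the inverse supplies preimages. Surjectivity is needed because the contact
     condition asks for equal images, not inclusions. *)
  have ya := contact_map_cylinder H xa.
  have d1 := smooth_diff (contact_map_smooth a0 H) xa.
  have d2 := smooth_diff (contact_map_inv_smooth a0 H) ya.
  have d1' : differentiable cm (ci (cm x)) by rewrite (contact_mapK H xa).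
  have D := is_diff_comp (differentiableP d2) (differentiableP d1').
  have E w : 'd (cm \o ci) (cm x) w = w.
    have dD : differentiable (cm \o ci) (cm x) by case: D.
    rewrite -(deriveE _ dD).
    have -> : 'D_w (cm \o ci) (cm x) = 'D_w id (cm x); last exact: derive_id.
    apply: near_eq_derive; have : \forall y \near cm x, cyl y.
      by apply: open_nbhs_nbhs; split => //; exact: open_cylinder.
    by apply: filterS => y /(contact_map_invK H).
  move=> w; exists ('d ci (cm x) w).
  have D2 : 'd (cm \o ci) (cm x) w = 'd cm (ci (cm x)) ('d ci (cm x) w).
    by case: D => _ D2; exact: (congr1 (fun h => h w) D2).
  have := etrans (esym D2) (E w).
  by rewrite (contact_mapK H xa).
exists out, id; split => //; [exact: lt_le_trans ax|exact: smooth_id|exact: ext_map_out|].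
have xo : out x by exact: lt_le_trans ax.
have [_ ->] := is_diff_id x; split; last by move=> w; exists w.
by exists 1 => // v; rewrite mul1r ext_map_out.
Qed.

Variables (D O : set sp) (D' : set sp).
Hypothesis oO : open O.
Hypothesis DO : closure O = D.
Hypothesis mapD : forall x, D x -> D' (ext_map x).
Hypothesis invD : forall x, D' x -> D (ext_inv x).

Lemma ext_map_contactomorphism : cooriented_contactomorphism D D' ext_map.
Proof.
split.
  split; last first.
    exists ext_inv; split.
    - move=> x _; have [U [g [oU Ux sg gE]]] := ext_inv_germ x.
      by exists g, U; split => // y _ Uy; rewrite gE.
    - by move=> x Dx; split; [exact: mapD|exact: ext_mapK].
    - by move=> x Dx; split; [exact: invD|exact: ext_invK].
  move=> x _; have [U [g [oU Ux sg gE _]]] := ext_map_germ x.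
  by exists g, U; split => // y _ Uy; rewrite gE.
move=> x g Dx [U [oU Ux sg gE]].
have [U' [g' [oU' Ux' sg' gE' [[c c0 cE] surj]]]] := ext_map_germ x.
have oUU : open (U `&` U') by exact: openI.
have dE v : 'd g x v = 'd g' x v.
  apply: (@diff_eq_on_closure _ _ _ O (U `&` U')) => //.
  - by rewrite DO.
  - by apply: smooth_sub sg => ? [].
  - by apply: smooth_sub sg' => ? [].
  move=> y Oy [Uy Uy']; rewrite gE//; first exact: gE'.
  by rewrite -DO; exact: subset_closure.
split; apply/seteqP; split => w.
- by move=> [v xv <-]; rewrite /xi_st/= dE cE xv mulr0.
- move=> ww; have [v vw] := surj w; exists v; last by rewrite dE.
  move: ww; rewrite /xi_st/= -vw cE => /eqP; rewrite mulf_eq0 (gt_eqF c0)/= => /eqP.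
  by [].
- by move=> [v xv <-]; rewrite /positive_side/= dE cE mulr_gt0.
move=> ww; have [v vw] := surj w; exists v; last by rewrite dE.
by move: ww; rewrite /positive_side/= -vw cE pmulr_rgt0.
Qed.

End ExtendedContactMap.

Section Sufficiency.
Variables (R : realType) (n : nat).
Hypothesis n1 : (1 <= n)%N.
Local Notation V := ('rV[R]_(n + n)).

(** Radial symmetry replaces a compactness argument: a neighbourhood of the single point
    [rho *: axis] determines the width of the annulus on which the sheets agree. *)
Lemma equiv_near_boundary (rho : R) (S T : vshape V) : 0 < rho -> shadow S = eball rho ->
  shadow T = eball rho -> shape_equiv S T ->
  radially_symmetric (eball rho) (fplus S) -> radially_symmetric (eball rho) (fminus S) ->
  radially_symmetric (eball rho) (fplus T) -> radially_symmetric (eball rho) (fminus T) ->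
  exists b, [/\ 0 <= b, b < rho & forall z, b < nrm z -> nrm z <= rho ->
    fplus S z = fplus T z /\ fminus S z = fminus T z].
Proof.
move=> rho0 sS sT [_ [N [oN fN NE]]] r1 r2 r3 r4.
rewrite sS frontier_eball// in fN; rewrite sS closure_eball// in NE.
have Na : N (rho *: axis R n) by apply: fN; rewrite /= (nrm_scale_axis n1) gtr0_norm.
have cv : (fun t : R => t *: axis R n) @ (rho : R) --> rho *: axis R n by exact: scalel_continuous.
have /nbhs_ballP[d /= d0 Hd] := cv N (open_nbhs_nbhs (conj oN Na)).
exists (Num.max 0 (rho - d)); split.
- by rewrite le_max lexx.
- by rewrite gt_max rho0 gtrDl oppr_lt0.
move=> z; rewrite gt_max => /andP[z0 zd]; rewrite le_eqVlt => /orP[/eqP zr|zr].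
  by apply: NE; [rewrite /cball/= zr|exact: fN].
have Nz : N (nrm z *: axis R n).
  by apply: Hd; rewrite /ball/= gtr0_norm ?subr_gt0//; lra.
have E f : radially_symmetric (eball rho) f -> f z = f (nrm z *: axis R n).
  by move=> rf; exact: (radial_nrm n1 rf).
rewrite (E _ r1) (E _ r2) (E _ r3) (E _ r4); apply: NE => //.
by rewrite /cball/= (nrm_scale_axis n1) norm_nrm ltW.
Qed.

Lemma contactomorphic_of_second_derivatives (rho : R) (S T : vshape V) : 0 < rho ->
  shadow S = eball rho -> shadow T = eball rho -> shape_equiv S T ->
  radially_symmetric (eball rho) (fplus S) -> radially_symmetric (eball rho) (fminus S) ->
  radially_symmetric (eball rho) (fplus T) -> radially_symmetric (eball rho) (fminus T) ->
  derive1n 2 (radial_profile (fplus S)) 0 = derive1n 2 (radial_profile (fplus T)) 0 ->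
  derive1n 2 (radial_profile (fminus S)) 0 = derive1n 2 (radial_profile (fminus T)) 0 ->
  cooriented_contactomorphic (shape_domain S) (shape_domain T).
Proof.
move=> rho0 sS sT eST r1 r2 r3 r4.
have pa (r : R) : `|r| < rho -> nrm (r *: axis R n) < rho by rewrite (nrm_scale_axis n1).
move=> dp dm.
have [b [b0 brho bE]] := equiv_near_boundary rho0 sS sT eST r1 r2 r3 r4.
have [c1 c2 [s2 s1] ltS eqS] := shape_facts rho0 sS.
have [c3 c4 [s4 s3] ltT eqT] := shape_facts rho0 sT.
have e1 := even_smooth_profile n1 r1 s1. have e2 := even_smooth_profile n1 r2 s2.
have e3 := even_smooth_profile n1 r3 s3. have e4 := even_smooth_profile n1 r4 s4.
have [F1 sF1 dF1] := even_smooth_radial_derivative rho0 e1.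
have [F2 sF2 dF2] := even_smooth_radial_derivative rho0 e2.
have [F3 sF3 dF3] := even_smooth_radial_derivative rho0 e3.
have [F4 sF4 dF4] := even_smooth_radial_derivative rho0 e4.
have h1 : F1 0 = F3 0.
  by rewrite -(profile_second_derivative rho0 sF1 dF1) dp (profile_second_derivative rho0 sF3 dF3).
have h2 : F2 0 = F4 0.
  by rewrite -(profile_second_derivative rho0 sF2 dF2) dm (profile_second_derivative rho0 sF4 dF4).
clear dp dm.
have [|||q [p [e [k [m [l [e1' [k1' [m1' [l1' [H rel]]]]]]]]]]] :=
  contact_data_exists b0 brho e1 e2 e3 e4 sF1 sF2 sF3 sF4 dF1 dF2 dF3 dF4 h1 h2.
- by move=> r /pa ra; exact: ltS ra.
- by move=> r /pa ra; exact: ltT ra.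
- by move=> r br ra; apply: (bE (r *: axis R n)); rewrite (nrm_scale_axis n1) // ltW.
rewrite (shape_domainE rho0 sS) (shape_domainE rho0 sT).
exists (ext_map rho q e k m l).
(* On each column the map is affine with positive slope and takes both sheets of one shape to those
   of the other, so inequalities between height and sheets are preserved in both directions. *)
have key x : nrm x.2 < rho ->
   [/\ nrm (ext_map (n := n) rho q e k m l x).2 < rho, 0 < e (nrm x.2),
     (ext_map rho q e k m l x).1 = e (nrm x.2) * x.1 + k (nrm x.2),
     fplus T (ext_map rho q e k m l x).2 = e (nrm x.2) * fplus S x.2 + k (nrm x.2) &
     fminus T (ext_map rho q e k m l x).2 = e (nrm x.2) * fminus S x.2 + k (nrm x.2)].
  move=> xr; rewrite /ext_map xr.
  have ya : nrm (contact_map q e k m l x).2 < rho := contact_map_cylinder H xr.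
  have xr' : `|nrm x.2| < rho by rewrite norm_nrm.
  have [h3 h4] := rel _ xr'.
  split => //; first exact: cd_e_gt0 H _ xr'.
    by rewrite (radial_nrm n1 r3 ya) nrm_contact_map -h3 (radial_nrm n1 r1 xr).
  by rewrite (radial_nrm n1 r4 ya) nrm_contact_map -h4 (radial_nrm n1 r2 xr).
have bd x : nrm x.2 = rho -> ext_map rho q e k m l x = x.
  by move=> xr; rewrite /ext_map xr ltxx.
have mapD x : region rho (fminus S) (fplus S) x ->
    region rho (fminus T) (fplus T) (ext_map rho q e k m l x).
  move=> [xr [x1 x2]]; move: (xr); rewrite le_eqVlt => /orP[/eqP E|xlt].
    have bx : b < nrm x.2 by rewrite E.
    have [E1 E2] := bE x.2 bx xr.
    by rewrite bd//; split => //; rewrite -E1 -E2.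
  have [k1 k2 k3 k4 k5] := key _ xlt; split; first exact: ltW.
  by rewrite k3 k4 k5 !lerD2r !(ler_pM2l k2).
have invD y : region rho (fminus T) (fplus T) y ->
    region rho (fminus S) (fplus S) (ext_inv rho p e k m l y).
  move=> Dy; set x := ext_inv _ _ _ _ _ _ _.
  have yx : ext_map rho q e k m l x = y by exact: ext_invK H y.
  have [xlt|] := ltP (nrm x.2) rho.
    have [k1 k2 k3 k4 k5] := key _ xlt; split; first exact: ltW.
    move: Dy => [_]; rewrite -yx k3 k4 k5 !lerD2r !(ler_pM2l k2).
    by [].
  move=> rx; have xy : x = y by rewrite -yx /ext_map ltNge rx.
  rewrite xy; move: rx; rewrite xy; move: Dy => [yr [y1 y2]] ry.
  have E : nrm y.2 = rho by apply/eqP; rewrite eq_le yr.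
  have by' : b < nrm y.2 by rewrite E.
  by have [E1 E2] := bE y.2 by' yr; split => //; rewrite E1 E2.
apply: (ext_map_contactomorphism b0 brho H _ _ mapD invD).
  by apply: open_open_region; [move=> z zr; exact: smooth_continuous s2 zr|move=> z zr; exact: smooth_continuous s1 zr].
by apply: region_closure => //.
Qed.

End Sufficiency.

(** * Invariance of the second derivatives *)

Lemma linear_inj_surj (K : fieldType) (vT : vectType K) (L : {linear vT -> vT}) :
  (forall v, L v = 0 -> v = 0) -> forall w, exists v, L v = w.
Proof.
move=> injL w; pose f := linfun L.
have kf : lker f == 0%VS.
  rewrite -subv0; apply/subvP => v; rewrite memv_ker memv0 lfunE/= => /eqP/injL ->.
  by rewrite eqxx.
have lf : limg f = fullv.
  apply/eqP; rewrite eqEdim subvf/=.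
  by have := limg_ker_dim f fullv; rewrite (eqP kf) capv0 dimv0 add0n => ->.
have : w \in limg f by rewrite lf memvf.
by move=> /memv_imgP[v _ ->]; exists v; rewrite lfunE.
Qed.

Section LocalMax.
Variable R : realType.

Lemma diff_local_max (V : normedModType R) (F : V -> R^o) x v : differentiable F x ->
  (\forall y \near x, F y <= F x) -> 'd F x v = 0.
Proof.
move=> dF mF.
have P u : 'd F x u <= 0.
  rewrite leNgt; apply/negP => d0.
  have cv : (fun t : R^o => t *: u + x) @ (0 : R^o) --> x.
    rewrite -[X in _ --> X]add0r; apply: cvgD; last exact: cvg_cst.
    by rewrite -[X in _ --> X](scale0r u); exact: scalel_continuous.
  have D : is_diff (0 : R^o) (fun t : R^o => F (t *: u + x)) (fun t => 'd F x (t *: u)).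
    have D0 : is_diff (0 : R^o) (fun t : R^o => t *: u + x) (fun t => t *: u + 0).
      exact: is_diffD (is_diff_scalel (0 : R^o) u) (is_diff_cst x (0 : R^o)).
    have dF' : is_diff (0 *: u + x) F ('d F x).
      by rewrite scale0r add0r; exact: differentiableP.
    by apply: is_diff_eq (is_diff_comp D0 dF') _; apply/funext => t /=; rewrite addr0.
  have e0 : 0 < 'd F x u / 2 by rewrite divr_gt0.
  have N1 := is_diff_epsE D e0.
  have N2 : \forall t \near (0 : R^o), F (t *: u + x) <= F x by exact: cv mF.
  have [r /= r0 Hr] := (nbhs_ballP (0 : R^o) _).1 (filterI N1 N2).
  have r2 : ball (0 : R^o) r (r / 2).
    by rewrite /ball/= sub0r normrN gtr0_norm ?divr_gt0//; lra.
  have rr : 0 < r / 2 by rewrite divr_gt0.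
  have [] := Hr _ r2; rewrite addr0 scale0r add0r linearZ/= (gtr0_norm rr).
  rewrite ler_norml => /andP[H1 _] H2; move: H1; rewrite /GRing.scale/=.
  have : 0 < 'd F x u * r by rewrite mulr_gt0.
  by lra.
apply/eqP; rewrite eq_le P/=.
by have := P (- v); rewrite linearN oppr_le0.
Qed.

(** The one-sided version serves at a pole, where only the ray into the domain is available. *)
Lemma diff_right_max (V : normedModType R) (F : V -> R^o) x u : differentiable F x ->
  (exists2 r : R, 0 < r & forall t : R, 0 < t -> t < r -> F (t *: u + x) <= F x) -> 'd F x u <= 0.
Proof.
move=> dF [r' r'0 mF].
rewrite leNgt; apply/negP => d0.
have D : is_diff (0 : R^o) (fun t : R^o => F (t *: u + x)) (fun t => 'd F x (t *: u)).
  have D0 : is_diff (0 : R^o) (fun t : R^o => t *: u + x) (fun t => t *: u + 0).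
    exact: is_diffD (is_diff_scalel (0 : R^o) u) (is_diff_cst x (0 : R^o)).
  have dF' : is_diff (0 *: u + x) F ('d F x).
    by rewrite scale0r add0r; exact: differentiableP.
  by apply: is_diff_eq (is_diff_comp D0 dF') _; apply/funext => t /=; rewrite addr0.
have e0 : 0 < 'd F x u / 2 by rewrite divr_gt0.
have /nbhs_ballP[r /= r0 Hr] := is_diff_epsE D e0.
pose t : R := Num.min r r' / 2.
have m0 : 0 < Num.min r r' by rewrite lt_min r0.
have t0 : 0 < t by rewrite divr_gt0.
have tr : t < r by have : Num.min r r' <= r by [rewrite ge_min lexx]; rewrite /t; lra.
have tr' : t < r' by have : Num.min r r' <= r' by [rewrite ge_min lexx orbT]; rewrite /t; lra.
have r2 : ball (0 : R^o) r t by rewrite /ball/= sub0r normrN gtr0_norm.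
have := Hr _ r2; rewrite addr0 scale0r add0r linearZ/= (gtr0_norm t0).
rewrite ler_norml => /andP[H1 _]; have := mF t t0 tr'; move: H1; rewrite /GRing.scale/=.
have : 0 < 'd F x u * t by rewrite mulr_gt0.
by lra.
Qed.

End LocalMax.

Section ConformalSymplectic.
Variables (R : realType) (n : nat).
Hypothesis n1 : (1 <= n)%N.
Local Notation V := ('rV[R]_(n + n)).

Lemma conformal_coefficient (A : {linear V -> V}) (f1 g1 h0 : R) : 0 < h0 ->
  (forall w v, g1 * dot (A w) (A v) + 2^-1 * dot (Jmul (A w)) (A v)
     = h0 * (f1 * dot w v + 2^-1 * dot (Jmul w) v)) -> f1 = g1.
Proof.
move=> h00 E.
(* Exchanging [w] and [v] keeps the metric terms and reverses the symplectic ones, so the two parts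
   of the hypothesis separate. *)
have sym w v : g1 * dot (A w) (A v) = h0 * f1 * dot w v.
  have E1 := E w v; have E2 := E v w.
  rewrite (dot_Jl (A v)) (dot_Jl v) (dotC (A v)) (dotC v) in E2.
  rewrite (dotC (A v) (Jmul _)) (dotC v (Jmul _)) in E2; lra.
have skew w v : dot (Jmul (A w)) (A v) = h0 * dot (Jmul w) v.
  have := E w v; rewrite mulrDr mulrA sym => /addrI; lra.
have injA v : A v = 0 -> v = 0.
  move=> Av; have := skew v (Jmul v); rewrite Av /Jmul.
  rewrite -/(Jmul v) -/(Jmul 0) dot_JJ (_ : Jmul 0 = 0) ?dot0l; last exact: linear0.
  by move=> /esym/eqP; rewrite mulf_eq0 (gt_eqF h00)/= => /eqP/dot_eq0.
pose z := axis R n.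
have dz : dot z z = 1 by rewrite -nrm_sqr nrm_axis// expr1n.
have z0 : z != 0 by apply/eqP => zz; move: dz; rewrite zz dot0l => /esym/eqP; rewrite oner_eq0.
have Az : 0 < dot (A z) (A z).
  rewrite lt_neqAle dot_ge0 andbT eq_sym; apply: contra_neq z0 => /dot_eq0.
  exact: injA.
have Ez := sym z z; rewrite dz mulr1 in Ez.
have [f10|f10] := eqVneq f1 0.
  by move: Ez; rewrite f10 mulr0 => /eqP; rewrite mulf_eq0 (gt_eqF Az) orbF => /eqP.
have g10 : g1 != 0.
  by apply/eqP => g10; move/eqP: Ez; rewrite g10 mul0r eq_sym mulf_eq0 (negbTE f10) (gt_eqF h00).
pose mu := h0 * f1 / g1.
have conf w v : dot (A w) (A v) = mu * dot w v.
  by apply: (mulfI g10); rewrite sym /mu; field.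
have mu0 : 0 < mu by move: Az; rewrite conf dz mulr1.
pose c := h0 / mu.
(* Both forms are known on the image of [A], which is everything, so [J A = (h0 / mu) A J]. As [J]
   is an isometry, the square of this positive ratio is [1]. *)
have JA w : Jmul (A w) = c *: A (Jmul w).
  apply/eqP; rewrite -subr_eq0; apply/eqP/dot_eq0.
  set u := _ - _; have [v Ev] := linear_inj_surj injA u.
  rewrite -{2}Ev /u dotDl dotNl dotZl skew conf /c; field; by rewrite gt_eqF.
have := dot_JJ (A z) (A z); rewrite JA dotZl dotZr !conf dot_JJ dz mulr1 => Ec.
have c2 : c ^+ 2 = 1.
  by apply: (mulIf (lt0r_neq0 mu0)); rewrite mul1r -[RHS]Ec; ring.
have c0 : 0 < c by rewrite divr_gt0.
have c1 : c = 1.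
  move/eqP: c2; rewrite -subr_eq0 subr_sqr_1 mulf_eq0 subr_eq0 => /orP[/eqP//|/eqP cc].
  by move: c0; lra.
have hm : h0 = mu.
  have : h0 = c * mu by rewrite /c divfK// lt0r_neq0.
  by rewrite c1 mul1r.
by move: hm; rewrite /mu => hm; apply: (mulfI (lt0r_neq0 h00)); rewrite {2}hm; field.
Qed.

End ConformalSymplectic.

Section AlphaLinear.
Variables (R : realType) (n : nat).
Local Notation sp := (Defs.space R n).

Lemma alpha_stD (p v w : sp) : alpha_st p (v + w) = alpha_st p v + alpha_st p w.
Proof. by rewrite !alpha_stE/= dotDr; ring. Qed.

Lemma alpha_stZ (p v : sp) (c : R) : alpha_st p (c *: v) = c * alpha_st p v.
Proof. by rewrite !alpha_stE/= dotZr /GRing.scale/=; ring. Qed.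

Definition reeb : sp := (1, 0).

Lemma alpha_reeb p : alpha_st p reeb = 1.
Proof. by rewrite alpha_stE/= dot0r mulr0 addr0. Qed.

End AlphaLinear.
Arguments reeb {R n}.

Section RadialRegion.
Variables (R : realType) (n : nat) (rho : R).
Local Notation V := ('rV[R]_(n + n)).
Local Notation sp := (Defs.space R n).

(* The two graphs bounding the region are indexed by a boolean, [true] for the upper one. *)
Record radial_region (fb : bool -> V -> R^o) (f1 : bool -> R -> R) : Prop := RadialRegion {
  rr_smooth : forall s, smooth_on (eball rho) (fb s);
  rr_even : forall s, even_smooth rho (f1 s);
  rr_diff : forall s z, nrm z < rho ->
    is_diff z (fb s) (fun v => f1 s (nrm z) * dot z v);
  rr_lt : forall z, nrm z < rho -> fb false z < fb true z;
  rr_open : open (open_region rho (fb false) (fb true))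
}.

Definition sgn (s : bool) : R := if s then 1 else -1.

Lemma sgn_neq0 s : sgn s != 0.
Proof. by case: s; rewrite ?oppr_eq0 oner_neq0. Qed.

Variables (fb : bool -> V -> R^o) (f1 : bool -> R -> R).
Hypothesis rho0 : 0 < rho.
Hypothesis H : radial_region fb f1.

Local Notation D := (region rho (fb false) (fb true)).
Local Notation O := (open_region rho (fb false) (fb true)).

(** The sign makes it nonpositive on the region for either sheet, so that both sheets are handled by
    the same maximum arguments. *)
Definition defining s (x : sp) : R^o := sgn s * (x.1 - fb s x.2).
Definition graph s (z : V) : sp := (fb s z, z).

Lemma open_region_sub x : O x -> D x.
Proof. by move=> [? [? ?]]; split; [exact: ltW|split; exact: ltW]. Qed.

Lemma defining_graph s z : defining s (graph s z) = 0.
Proof. by rewrite /defining/= subrr mulr0. Qed.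

Lemma defining_le0 s x : D x -> defining s x <= 0.
Proof.
move=> [_ [x1 x2]]; rewrite /defining; case: s => /=; first by rewrite mul1r subr_le0.
by rewrite mulN1r oppr_le0 subr_ge0.
Qed.

Lemma graph_region s z : nrm z < rho -> D (graph s z).
Proof.
move=> zr; have lt := rr_lt H zr; split; first exact: ltW.
by case: s => /=; rewrite ?lexx; split => //; exact: ltW.
Qed.

Lemma region_boundary x : D x -> ~ O x -> nrm x.2 < rho -> exists s, x = graph s x.2.
Proof.
move=> [_ [x1 x2]] xO xr.
have [E|E] := eqVneq x.1 (fb false x.2); first by exists false; rewrite /graph -E; case: (x).
exists true; suff E2 : x.1 = fb true x.2 by rewrite /graph -E2; case: (x).
apply/eqP; rewrite eq_le x2/= leNgt; apply/negP => lt2.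
by apply: xO; split => //; split => //; rewrite lt_neqAle eq_sym E.
Qed.

Lemma defining_is_diff s x : nrm x.2 < rho ->
  is_diff x (defining s) (fun w => sgn s * (w.1 - f1 s (nrm x.2) * dot x.2 w.2)).
Proof.
move=> xr; have D1 := is_diff_comp (is_diff_snd x) (rr_diff H s xr).
have D2 := is_diffS (is_diff_cst (sgn s : R^o) x) (is_diffB (is_diff_fst x) D1).
by apply: is_diff_eq D2 _; apply/funext => w; rewrite /= scale0r addr0.
Qed.

Lemma graph_smooth s : smooth_on (eball rho) (graph s).
Proof.
by apply: (smooth_pair (@open_eball _ _ rho)); [exact: rr_smooth H s|exact: smooth_id (@open_eball _ _ rho)].
Qed.

Lemma graph_is_diff s z : nrm z < rho ->
  is_diff z (graph s) (fun v => (f1 s (nrm z) * dot z v, v)).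
Proof. by move=> zr; exact: is_diff_pair (rr_diff H s zr) (is_diff_id z). Qed.

End RadialRegion.

(** * Boundary points, poles and the coefficient at a pole *)

Section Necessity.
Variables (R : realType) (n : nat) (rho : R).
Local Notation V := ('rV[R]_(n + n)).
Local Notation sp := (Defs.space R n).
Variables (fb gb : bool -> V -> R^o) (f1 g1 : bool -> R -> R).
Hypothesis n1 : (1 <= n)%N.
Hypothesis rho0 : 0 < rho.
Hypothesis HF : radial_region rho fb f1.
Hypothesis HG : radial_region rho gb g1.
Local Notation DF := (region rho (fb false) (fb true)).
Local Notation OF := (open_region rho (fb false) (fb true)).
Local Notation DG := (region rho (gb false) (gb true)).
Local Notation OG := (open_region rho (gb false) (gb true)).

Variables (f h : sp -> sp).
Hypothesis sf : smooth_map DF f.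
Hypothesis sh : smooth_map DG h.
Hypothesis fK : forall p, DF p -> DG (f p) /\ h (f p) = p.
Hypothesis hK : forall p, DG p -> DF (h p) /\ f (h p) = p.
Hypothesis cf : forall p g, DF p -> local_extension DF f p g ->
  'd g p @` xi_st p = xi_st (f p) /\ 'd g p @` positive_side p = positive_side (f p).

(** Subtracting [alpha(v)] times the Reeb vector puts [v] into the contact plane, whose image is the
    contact plane. The conformal factor is thus the value on the image of the Reeb vector, and it is
    positive by co-orientation. *)
Lemma contact_factor x g : DF x -> local_extension DF f x g ->
  [/\ 0 < alpha_st (f x) ('d g x reeb),
      forall v, alpha_st (f x) ('d g x v) = alpha_st (f x) ('d g x reeb) * alpha_st x v
    & forall w, alpha_st (f x) w = 0 -> exists2 v, alpha_st x v = 0 & 'd g x v = w].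
Proof.
move=> Dx eg; have [Hxi Hpos] := cf Dx eg.
have pos : 0 < alpha_st (f x) ('d g x reeb).
  have : ('d g x @` positive_side x) ('d g x reeb).
    by exists reeb => //; rewrite /positive_side/= alpha_reeb.
  by rewrite Hpos.
split => // [v|w w0].
  have : ('d g x @` xi_st x) ('d g x (v - alpha_st x v *: reeb)).
    exists (v - alpha_st x v *: reeb) => //.
    by rewrite /xi_st/= -scaleNr alpha_stD alpha_stZ alpha_reeb mulr1 subrr.
  rewrite Hxi /xi_st/= linearB linearZ/= -scaleNr alpha_stD alpha_stZ mulNr => /eqP.
  by rewrite subr_eq0 mulrC => /eqP.
have : xi_st (f x) w by [].
by rewrite -Hxi => -[v v0 vw]; exists v.
Qed.

Lemma boundary_to_boundary s z : nrm z < rho -> ~ OG (f (graph fb s z)).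
Proof.
move=> zr; set x := graph fb s z; set y0 := f x => Oy0.
have Dx : DF x by exact: (graph_region HF).
have [Dy0 hy0] := fK Dx.
have [g [U1 [oU1 U1x sg gE]]] := sf Dx.
have [g2 [U2 [oU2 U2y sg2 g2E]]] := sh Dy0.
have g2y0 : g2 y0 = x by rewrite g2E.
have dg2 := smooth_diff sg2 U2y.
have dg : differentiable g (g2 y0) by rewrite g2y0; exact: smooth_diff sg U1x.
have cg2 := differentiable_continuous dg2.
have N1 : \forall y \near y0, OG y by apply: open_nbhs_nbhs; split => //; exact: rr_open HG.
have N2 : \forall y \near y0, U2 y by apply: open_nbhs_nbhs.
have N3 : \forall y \near y0, U1 (g2 y).
  by apply: cg2; rewrite g2y0; apply: open_nbhs_nbhs.
have D2 := differentiableP dg2.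
have Dd : is_diff (g2 y0) (defining fb s) (fun w => sgn R s * (w.1 - f1 s (nrm z) * dot z w.2)).
  by rewrite g2y0; exact: (defining_is_diff HF s (x := x)).
have [dH HE] := is_diff_comp D2 Dd.
have max : \forall y \near y0, (defining fb s \o g2) y <= (defining fb s \o g2) y0.
  rewrite /= g2y0 defining_graph; apply: filterS2 N1 N2 => y Oy Uy.
  have Dy := open_region_sub Oy.
  rewrite /= g2E//; by apply: (defining_le0 (rho := rho)); have [] := hK Dy.
pose Fn (u : sp) : R := sgn R s * (u.1 - f1 s (nrm z) * dot z u.2).
have E1 w : Fn ('d g2 y0 w) = 0.
  by have := diff_local_max w dH max; rewrite HE.
have DC := is_diff_comp D2 (differentiableP dg).
(* Near an interior point of the target both extensions coincide with [h] and [f], so [g \o g2] is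
   the identity there. Hence the differential of [g2] is injective, therefore bijective, and hits
   the Reeb direction, on which the defining function has nonzero derivative. *)
have E2 w : 'd g (g2 y0) ('d g2 y0 w) = w.
  have E3 : 'd (g \o g2) y0 w = w.
    have dD : differentiable (g \o g2) y0 by case: DC.
    rewrite -(deriveE _ dD).
    have -> : 'D_w (g \o g2) y0 = 'D_w id y0; last exact: derive_id.
    apply: near_eq_derive; near=> y.
    have Oy : OG y by near: y.
    have Uy : U2 y by near: y.
    have Ugy : U1 (g2 y) by near: y.
    have Dy := open_region_sub Oy; have [Dhy fhy] := hK Dy.
    by move: Ugy; rewrite /= g2E// => Ugy; rewrite gE.
  by case: DC => _ DC; rewrite -[RHS]E3; exact: (esym (congr1 (fun k => k w) DC)).
have inj v : 'd g2 y0 v = 0 -> v = 0.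
  move=> v0; have E3 : 'd g (g2 y0) 0 = v := etrans (congr1 ('d g (g2 y0)) (esym v0)) (E2 v).
  exact: etrans (esym E3) (linear0 _).
have [w Ew] := linear_inj_surj (vT := (R^o * 'rV[R]_(n + n))%type) (L := 'd g2 y0) inj reeb.
have : Fn reeb = 0 := etrans (congr1 Fn (esym Ew)) (E1 w).
rewrite /Fn /= dot0r mulr0 subr0 mulr1 => /eqP.
by rewrite (negbTE (sgn_neq0 R s)).
Unshelve. all: by end_near. Qed.

Let nrm00 : nrm (0 : V) < rho. Proof. by rewrite nrm0. Qed.

Lemma alpha_axis (b : R^o) (v : sp) : alpha_st ((b, 0) : sp) v = v.1.
Proof. by rewrite alpha_stE/= (_ : Jmul 0 = 0) ?dot0l ?mulr0 ?addr0//; exact: linear0. Qed.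

(** At a pole the tangent space of the sheet is the contact plane. Along the image of the sheet [G]
    has a local maximum, so its differential kills the image of that plane, which is the whole
    contact plane at the image point. Suitable choices of [G] exclude every image that is not a
    pole. *)
Lemma pole_tangent s (G : sp -> R^o) : differentiable G (f (graph fb s 0)) ->
  G (f (graph fb s 0)) = 0 -> (\forall y \near f (graph fb s 0), DG y -> G y <= 0) ->
  forall w, alpha_st (f (graph fb s 0)) w = 0 -> 'd G (f (graph fb s 0)) w = 0.
Proof.
set x := graph fb s 0 => dG G0 mG w w0.
have Dx : DF x by exact: (graph_region HF).
have [g [U1 [oU1 U1x sg gE]]] := sf Dx.
have eg : local_extension DF f x g by exists U1.
have [_ _ surj] := contact_factor Dx eg.
have [v v0 vw] := surj w w0.
rewrite /x /graph alpha_axis in v0.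
have gx : g x = f x by rewrite gE.
have D1 := graph_is_diff HF s nrm00.
have D2 : is_diff (graph fb s 0) g ('d g x) := differentiableP (smooth_diff sg U1x).
have dG' : differentiable G (g x) by rewrite gx.
have D3 := is_diff_comp (is_diff_comp D1 D2) (differentiableP dG').
have [dK KE] := D3.
have cgr : {for (0 : V), continuous (graph fb s)}.
  by apply: differentiable_continuous; case: D1.
have cg : {for (0 : V), continuous (g \o graph fb s)}.
  by apply: differentiable_continuous; case: (is_diff_comp D1 D2).
have max : \forall y \near (0 : V), (G \o (g \o graph fb s)) y <= (G \o (g \o graph fb s)) 0.
  have N1 : \forall y \near (0 : V), U1 (graph fb s y) by apply: cgr; apply: open_nbhs_nbhs.
  have N2 : \forall y \near (0 : V), DG (g (graph fb s y)) -> G (g (graph fb s y)) <= 0.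
    by apply: (cg [set y | DG y -> G y <= 0]); rewrite /= -/x gx.
  have N3 : \forall y \near (0 : V), eball rho y.
    by apply: open_nbhs_nbhs; split; [exact: open_eball|exact: nrm00].
  near=> y; rewrite /= -/x gx G0.
  have Uy : U1 (graph fb s y) by near: y.
  have yr : nrm y < rho by near: y.
  have Dy := graph_region HF s yr.
  suff : DG (g (graph fb s y)) -> G (g (graph fb s y)) <= 0.
    by apply; rewrite gE//; have [] := fK Dy.
  by near: y.
have := diff_local_max v.2 dK max.
have -> : 'd (G \o (g \o graph fb s)) 0 v.2 = 'd G (g x) ('d g x (f1 s (nrm (0 : V)) * dot 0 v.2, v.2)).
  exact: (congr1 (fun k => k v.2) KE).
have -> : (f1 s (nrm (0 : V)) * dot 0 v.2, v.2) = v.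
  by rewrite dot0l mulr0 -v0; case: (v).
by rewrite gx vw.
Unshelve. all: by end_near. Qed.

Lemma pole_to_pole s : f (graph fb s 0) = graph gb s 0.
Proof.
set x := graph fb s 0; set y := f x.
have Dx : DF x by exact: (graph_region HF).
have [Dy _] := fK Dx.
have yO : ~ OG y by exact: boundary_to_boundary.
have [yr|ry] := ltP (nrm y.2) rho; last first.
  exfalso; have E : nrm y.2 = rho by apply/eqP; rewrite eq_le ry andbT; case: Dy.
  (* On the equator the test function is the squared radius: the radial vector [(0, y.2)] lies in
     the contact plane, but the derivative of [G] along it is [2 rho^2]. *)
  pose G (u : sp) : R^o := dot u.2 u.2 - rho ^+ 2.
  have DG1 : is_diff y G (fun w => dot y.2 w.2 + dot w.2 y.2 - 0).
    exact: is_diffB (is_diff_dot (is_diff_snd y) (is_diff_snd y)) (is_diff_cst (rho ^+ 2 : R^o) y).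
  have [dG GE] := DG1.
  have G0 : G y = 0 by rewrite /G -nrm_sqr E subrr.
  have mG : \forall u \near y, DG u -> G u <= 0.
    near=> u; move=> [ur _]; rewrite /G -nrm_sqr subr_le0; apply: lerXn2r; rewrite ?nnegrE ?nrm_ge0//.
    exact: ltW.
  have w0 : alpha_st y ((0, y.2) : sp) = 0 by rewrite alpha_stE/= dot_Jself mulr0 addr0.
  have := pole_tangent dG G0 mG w0; rewrite GE /= subr0 -nrm_sqr E => /eqP.
  by rewrite -mulr2n mulrn_eq0/= expf_eq0/= (gt_eqF rho0).
have [t yE] : exists t, y = graph gb t y.2 := region_boundary Dy yO yr.
have DG1 := defining_is_diff HG t yr.
have [dG GE] := DG1.
have G0 : defining gb t y = 0 by rewrite yE defining_graph.
have mG : \forall u \near y, DG u -> defining gb t u <= 0.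
  by near=> u => Du; exact: (defining_le0 (rho := rho)).
have y2 : y.2 = 0.
  apply: dot_eq0.
  (* Off the axis, the rotation direction [J y.2] with its contact lift has vertical component
     [- |y.2|^2 / 2], while the radial sheet is stationary along it; so the derivative of the
     defining function vanishes only if [y.2 = 0]. *)
  have w0 : alpha_st y ((- (2^-1 * dot y.2 y.2), Jmul y.2) : sp) = 0.
    by rewrite alpha_stE/= dot_JJ addNr.
  have := pole_tangent dG G0 mG w0; rewrite GE /= (dotC y.2 (Jmul _)) dot_Jself mulr0 subr0.
  move=> /eqP; rewrite mulf_eq0 (negbTE (sgn_neq0 R t))/= oppr_eq0 mulf_eq0 invr_eq0.
  by rewrite (negbTE (_ : 2 != 0 :> R))//= => /eqP.
have [st|st] := eqVneq s t; first by rewrite yE y2 st.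
exfalso.
have [g [U1 [oU1 U1x sg gE]]] := sf Dx.
have eg : local_extension DF f x g by exists U1.
have [pos _ _] := contact_factor Dx eg.
have gx : g x = y by rewrite gE.
have pos' : 0 < ('d g x reeb).1.
  by move: pos; rewrite -/y yE y2 /graph alpha_axis.
have D2 := differentiableP (smooth_diff sg U1x).
have dG' : is_diff (g x) (defining gb t) ('d (defining gb t) y) by rewrite gx; exact: differentiableP.
have [dK KE] := is_diff_comp D2 dG'.
have lt0 := rr_lt HF nrm00.
(* It remains to exclude an exchange of the poles. From pole [s] the direction [- sgn s] times the
   Reeb vector enters the source; its image must not leave the target, although co-orientation
   preserves the sign of its vertical component. *)
have cgr : (fun r : R^o => r *: ((- sgn R s) *: reeb) + x : sp) @ (0 : R^o) --> x.
  rewrite -[X in _ --> X]add0r; apply: cvgD; last exact: cvg_cst.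
  by rewrite -[X in _ --> X](scale0r ((- sgn R s) *: reeb)); exact: scalel_continuous.
have N1 : \forall r \near (0 : R^o), U1 (r *: ((- sgn R s) *: reeb) + x).
  by apply: cgr; apply: open_nbhs_nbhs.
have [d /= d0 Hd] := (nbhs_ballP (0 : R^o) _).1 N1.
have H1 : 'd (defining gb t \o g) x ((- sgn R s) *: reeb) <= 0.
  apply: diff_right_max dK _; exists (Num.min d (fb true 0 - fb false 0)).
    by rewrite lt_min d0 subr_gt0.
  move=> r r0; rewrite lt_min => /andP[rd rf].
  have Ur : U1 (r *: ((- sgn R s) *: reeb) + x).
    by apply: Hd; rewrite /ball/= sub0r normrN gtr0_norm.
  have Dr : DF (r *: ((- sgn R s) *: reeb) + x).
    rewrite /x /graph; split; rewrite /= ?scaler0 ?addr0; first exact: ltW.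
    rewrite /GRing.scale/= mulr1 /sgn; case: (s); rewrite ?opprK; split; lra.
  by rewrite /= gx G0 gE//; apply: (defining_le0 (rho := rho)); have [] := fK Dr.
have E2 : 'd (defining gb t \o g) x ((- sgn R s) *: reeb) = sgn R t * (- sgn R s * ('d g x reeb).1).
  have -> : 'd (defining gb t \o g) x ((- sgn R s) *: reeb) = 'd (defining gb t) y ('d g x ((- sgn R s) *: reeb)).
    exact: (congr1 (fun k => k _) KE).
  by rewrite GE y2 dot0l mulr0 subr0 linearZ.
move: H1; rewrite E2 leNgt => /negP; apply.
by move: st; rewrite /sgn; case: (s); case: (t) => // _; rewrite ?opprK ?mul1r ?mulN1r ?mulNr ?mul1r ?opprK.
Unshelve. all: by end_near. Qed.

Lemma pole_coefficient s : f1 s 0 = g1 s 0.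
Proof.
set x := graph fb s 0.
have Dx : DF x by exact: (graph_region HF).
have [g [U1 [oU1 U1x sg gE]]] := sf Dx.
have eg z : nrm z < rho -> U1 (graph fb s z) -> local_extension DF f (graph fb s z) g.
  by move=> zr Uz; exists U1.
pose U' : set V := [set z | nrm z < rho /\ U1 (graph fb s z)].
have sgr := graph_smooth HF s.
have oB := @open_eball R (n + n) rho.
have oU' : open U'.
  rewrite openE => z [zr Uz]; rewrite /interior/=.
  have N1 : \forall y \near z, eball rho y by apply: open_nbhs_nbhs.
  have N2 : \forall y \near z, U1 (graph fb s y).
    by apply: (smooth_continuous sgr zr); apply: open_nbhs_nbhs.
  by apply: filterS2 N1 N2.
have U'0 : U' 0 by split; first exact: nrm00.
have fsp : framed (R^o * V : normedModType R)%type.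
  by apply: framed_prod; [exact: framed_reals|exact: framed_row].
have sgr' : smooth_on U' (graph fb s) by apply: smooth_sub sgr => z [].
have inU z : U' z -> U1 (graph fb s z) by case.
pose gam (z : V) : sp := g (graph fb s z).
have sgam : smooth_on U' gam := smooth_comp oU' fsp oU1 inU sgr' sg.
pose chi (z : V) : V := (gam z).2.
have schi : smooth_on U' chi.
  have c2 : continuous (snd : sp -> V) by move=> p; exact: cvg_snd.
  exact: (smooth_lin_comp oU' (L := snd : {linear sp -> V}) c2 sgam).
have gam0 : gam 0 = graph gb s 0 by rewrite /gam gE// pole_to_pole.
have chi0 : chi 0 = 0 by rewrite /chi gam0.
have cgam : {for (0 : V), continuous gam} by exact: smooth_continuous sgam U'0.
(* Boundary points go to boundary points, and by continuity the image stays away from the equator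
   and from the opposite sheet; hence [chi] describes the map of the sheets in their shadow
   coordinates. *)
have near_graph : \forall z \near (0 : V), [/\ U' z, nrm (chi z) < rho & gam z = graph gb s (chi z)].
  have N1 : \forall z \near (0 : V), U' z by apply: open_nbhs_nbhs.
  have N2 : \forall z \near (0 : V), nrm (chi z) < rho.
    have : \forall u \near chi 0, eball rho u.
      by rewrite chi0; apply: open_nbhs_nbhs; split => //; exact: nrm00.
    exact: (smooth_continuous schi U'0).
  have cd : {for (0 : V), continuous (fun z => defining gb (~~ s) (gam z))}.
    apply: (@continuous_comp _ _ _ gam (defining gb (~~ s))) => //.
    apply: differentiable_continuous.
    have r0 : nrm (gam 0).2 < rho by rewrite -/(chi 0) chi0.
    by case: (defining_is_diff HG (~~ s) r0).
  have d0 : defining gb (~~ s) (gam 0) != 0.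
    have lt0 := rr_lt HG nrm00; rewrite gam0 /defining/= mulf_neq0 ?sgn_neq0// subr_eq0.
    by case: (s) => /=; [rewrite gt_eqF|rewrite lt_eqF].
  have N3 : \forall z \near (0 : V), defining gb (~~ s) (gam z) != 0.
    by apply: (cd [set t : R | t != 0]); apply: open_nbhs_nbhs; split => //; exact: open_neq.
  near=> z.
  have [zr Uz] : U' z by near: z.
  have cr : nrm (chi z) < rho by near: z.
  have dz : defining gb (~~ s) (gam z) != 0 by near: z.
  split => //.
  have Dz := graph_region HF s zr.
  have gz : gam z = f (graph fb s z) by rewrite /gam gE.
  have Dg : DG (gam z) by rewrite gz; have [] := fK Dz.
  have Og : ~ OG (gam z) by rewrite gz; exact: boundary_to_boundary.
  have [t tE] := region_boundary Dg Og cr.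
  move: dz; have [<-|ts] := eqVneq t s; first by rewrite tE.
  have -> : ~~ s = t by case: (s) ts; case: (t).
  by rewrite tE defining_graph eqxx.
pose hh (z : V) : R^o := ('D_reeb g (graph fb s z)).1 + 2^-1 * dot (Jmul (chi z)) ('D_reeb g (graph fb s z)).2.
have sDg : smooth_on U' (fun z => 'D_reeb g (graph fb s z)).
  exact: (smooth_comp oU' fsp oU1 inU sgr' (smooth_derive reeb sg)).
have shh : smooth_on U' hh.
  have c1 : continuous (fst : sp -> R^o) by move=> p; exact: cvg_fst.
  have c2 : continuous (snd : sp -> V) by move=> p; exact: cvg_snd.
  apply: (smoothD oU'); first exact: (smooth_lin_comp oU' (L := fst : {linear sp -> R^o}) c1 sDg).
  apply: (smoothM oU'); first exact: smooth_cst.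
  apply: (smooth_dot oU').
    exact: (smooth_lin_comp oU' (linear_row_continuous (L := @Jmul R n : {linear V -> V})) schi).
  exact: (smooth_lin_comp oU' (L := snd : {linear sp -> V}) c2 sDg).
have identity v : \forall z \near (0 : V),
    g1 s (nrm (chi z)) * dot (chi z) ('D_v chi z) + 2^-1 * dot (Jmul (chi z)) ('D_v chi z)
    = hh z * (f1 s (nrm z) * dot z v + 2^-1 * dot (Jmul z) v).
  (* Each point must have a whole neighbourhood on which the image lies on the graph, since that
     relation is differentiated below. *)
  have := nbhs_interior near_graph; apply: filterS => z Nz.
  have [Uz cr gz] := nbhs_singleton Nz.
  have [zr U1z] := Uz.
  have Dz := graph_region HF s zr.
  have [_ fac _] := contact_factor Dz (eg _ zr U1z).
  have Eg : g (graph fb s z) = f (graph fb s z) by rewrite gE.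
  have Dg := differentiableP (smooth_diff sg U1z).
  have := fac (f1 s (nrm z) * dot z v, v).
  rewrite -Eg -/(gam z) => {}fac.
  have E1 : 'd g (graph fb s z) (f1 s (nrm z) * dot z v, v) = 'D_v gam z.
    have D := is_diff_comp (graph_is_diff HF s zr) Dg.
    by case: D => dD DE; rewrite (deriveE v dD); exact: (esym (congr1 (fun k => k v) DE)).
  have E2 : 'd g (graph fb s z) reeb = 'D_reeb g (graph fb s z).
    by rewrite (deriveE _ (smooth_diff sg U1z)).
  have dgam := smooth_diff sgam Uz.
  have E3 : ('D_v gam z).2 = 'D_v chi z.
    have [dD DE] := is_diff_comp (differentiableP dgam) (is_diff_snd (gam z)).
    rewrite (deriveE v dgam) (deriveE v (smooth_diff schi Uz)).
    exact: (esym (congr1 (fun k => k v) DE)).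
  have E4 : ('D_v gam z).1 = g1 s (nrm (chi z)) * dot (chi z) ('D_v chi z).
    have [dD DE] := is_diff_comp (differentiableP dgam) (is_diff_fst (gam z)).
    have [dB BE] := is_diff_comp (differentiableP (smooth_diff schi Uz)) (rr_diff HG s cr).
    have F1 : ('D_v gam z).1 = 'D_v (fst \o gam) z.
      by rewrite (deriveE v dgam) (deriveE v dD); exact: (esym (congr1 (fun k => k v) DE)).
    have F2 : 'D_v (gb s \o chi) z = g1 s (nrm (chi z)) * dot (chi z) ('D_v chi z).
      rewrite (deriveE v dB) (deriveE v (smooth_diff schi Uz)).
      exact: (congr1 (fun k => k v) BE).
    rewrite F1 -F2; apply: near_eq_derive.
    by apply: filterS Nz => u [_ _ gu]; rewrite /= gu.
  have F : alpha_st (gam z) ('D_v gam z) = alpha_st (gam z) ('D_reeb g (graph fb s z)) * alpha_st (graph fb s z) (f1 s (nrm z) * dot z v, v).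
    exact: etrans (etrans (congr1 (alpha_st (gam z)) (esym E1)) fac)
      (congr1 (fun u => alpha_st (gam z) u * _) E2).
  have G1 : alpha_st (gam z) ('D_v gam z) = g1 s (nrm (chi z)) * dot (chi z) ('D_v chi z)
      + 2^-1 * dot (Jmul (chi z)) ('D_v chi z).
    exact: etrans (alpha_stE _ _) (congr2 (fun a b => a + 2^-1 * dot (Jmul (chi z)) b) E4 E3).
  have G2 : alpha_st (gam z) ('D_reeb g (graph fb s z)) = hh z := alpha_stE _ _.
  have G3 : alpha_st (graph fb s z) (f1 s (nrm z) * dot z v, v)
      = f1 s (nrm z) * dot z v + 2^-1 * dot (Jmul z) v := alpha_stE _ _.
  exact: etrans (esym G1) (etrans F (congr2 (fun a b : R => a * b) G2 G3)).
have [hpos _ _] := contact_factor Dx (eg _ nrm00 (inU _ U'0)).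
have h0 : 0 < hh 0.
  have E2 : 'd g (graph fb s 0) reeb = 'D_reeb g (graph fb s 0).
    by rewrite (deriveE _ (smooth_diff sg U1x)).
  have E3 : alpha_st (f x) ('d g x reeb) = hh 0.
    apply: etrans (congr2 (@alpha_st R n) (esym (gE x Dx U1x)) E2) _.
    exact: alpha_stE.
  by rewrite -E3.
have dchi := smooth_is_diff schi U'0.
have dchi0 := smooth_diff schi U'0.
apply: (conformal_coefficient n1 (A := 'd chi 0) h0) => w v.
have Aw u : 'D_u chi 0 = 'd chi 0 u by exact: deriveE.
rewrite -!Aw.
have dDv := smooth_is_diff (smooth_derive v schi) U'0.
have [g2 g2s dg1] := even_smooth_radial_derivative rho0 (rr_even HG s).
have r0 : nrm (chi 0) < rho by rewrite chi0; exact: nrm00.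
have dK := is_diff_comp dchi (radial_is_diff g2s dg1 r0).
have dJ := is_diff_comp dchi (linear_row_is_diff (@Jmul R n : {linear V -> V}) (chi 0)).
have dL := is_diffD (is_diffS dK (is_diff_dot dchi dDv))
  (is_diffS (is_diff_cst (2^-1 : R^o) (0 : V)) (is_diff_dot dJ dDv)).
have [f2 f2s df1] := even_smooth_radial_derivative rho0 (rr_even HF s).
have dF := radial_is_diff f2s df1 nrm00.
have dJ0 := linear_row_is_diff (@Jmul R n : {linear V -> V}) 0.
have dv := is_diff_cst v (0 : V).
have dR := is_diffS (smooth_is_diff shh U'0) (is_diffD (is_diffS dF (is_diff_dot (is_diff_id (0 : V)) dv))
  (is_diffS (is_diff_cst (2^-1 : R^o) (0 : V)) (is_diff_dot dJ0 dv))).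
have EL := is_derive_diff w dL. have ER := is_derive_diff w dR.
have E := near_eq_is_derive (identity v) EL.
(* The derivative at [0] of the pulled back identity. The second derivatives of [chi] and the
   derivative of the factor [hh] are multiplied by terms that vanish because [chi 0 = 0] and the
   base point is [0]; only the linear parts of the two forms survive. *)
have Efin : g1 s (nrm (chi 0)) * (dot (chi 0) ('D_w (fun z => 'D_v chi z) 0) + dot ('D_w chi 0) ('D_v chi 0))
    + (g2 (nrm (chi 0)) * dot (chi 0) ('D_w chi 0)) * dot (chi 0) ('D_v chi 0)
    + (2^-1 * (dot (Jmul (chi 0)) ('D_w (fun z => 'D_v chi z) 0) + dot (Jmul ('D_w chi 0)) ('D_v chi 0))
       + 0 * dot (Jmul (chi 0)) ('D_v chi 0))
  = hh 0 * (f1 s (nrm (0 : V)) * (dot (0 : V) 0 + dot w v) + (f2 (nrm (0 : V)) * dot 0 w) * dot 0 v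
      + (2^-1 * (dot (Jmul (0 : V)) 0 + dot (Jmul w) v) + 0 * dot (Jmul 0) v))
    + 'D_w hh 0 * (f1 s (nrm (0 : V)) * dot 0 v + 2^-1 * dot (Jmul 0) v).
  exact: etrans (esym (@derive_val _ _ _ _ _ _ _ E)) (@derive_val _ _ _ _ _ _ _ ER).
move: Efin; rewrite chi0 nrm0 (_ : Jmul 0 = 0) ?dot0l; last exact: linear0.
move: ('D_w (fun z => 'D_v chi z) 0) ('D_w chi 0) ('D_v chi 0) ('D_w hh 0) (hh 0) => X Xw Xv Y Z.
by rewrite !(mulr0, mul0r, add0r, addr0).
Unshelve. all: by end_near. Qed.

End Necessity.

Section NecessityForShapes.
Variables (R : realType) (n : nat) (rho : R).
Hypothesis n1 : (1 <= n)%N.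
Hypothesis rho0 : 0 < rho.
Local Notation V := ('rV[R]_(n + n)).

Lemma shape_radial_region (S : vshape V) : shadow S = eball rho ->
  radially_symmetric (eball rho) (fplus S) -> radially_symmetric (eball rho) (fminus S) ->
  exists f1 : bool -> R -> R,
    [/\ radial_region rho (fun s : bool => if s then fplus S else fminus S) f1,
     derive1n 2 (radial_profile (fplus S)) 0 = f1 true 0 &
     derive1n 2 (radial_profile (fminus S)) 0 = f1 false 0].
Proof.
move=> sS r1 r2.
have [c1 c2 [s2 s1] ltS eqS] := shape_facts rho0 sS.
have [F1 sF1 dF1] := even_smooth_radial_derivative rho0 (even_smooth_profile n1 r1 s1).
have [F2 sF2 dF2] := even_smooth_radial_derivative rho0 (even_smooth_profile n1 r2 s2).
exists (fun s : bool => if s then F1 else F2).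
split; [|by rewrite (profile_second_derivative rho0 sF1 dF1)|by rewrite (profile_second_derivative rho0 sF2 dF2)].
have P (f : V -> R^o) E E1 z : radially_symmetric (eball rho) f -> E = radial_profile f ->
    even_smooth rho E1 -> (forall r : R, `|r| < rho -> is_derive r (1:R) E (r * E1 r)) ->
    nrm z < rho -> is_diff z f (fun v => E1 (nrm z) * dot z v).
  move=> rf EE sE dE zr; have [d1 d2] := radial_is_diff sE dE zr.
  have N : \forall y \near z, (E (nrm y) : R^o) = f y.
    have : \forall y \near z, eball rho y by apply: open_nbhs_nbhs; split => //; exact: open_eball.
    by apply: filterS => y yr; rewrite EE (radial_nrm n1 rf yr).
  have df := differentiable_near_eq N d1.
  apply: DiffDef; first exact: df.
  apply/funext => v.
  rewrite -(deriveE v df) -(near_eq_derive v N) (deriveE v d1).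
  exact: (congr1 (fun k => k v) d2).
split.
- by case.
- by case.
- by case => z; [exact: P r1 erefl sF1 dF1|exact: P r2 erefl sF2 dF2].
- exact: ltS.
by apply: open_open_region; [move=> z zr; exact: smooth_continuous s2 zr|move=> z zr; exact: smooth_continuous s1 zr].
Qed.

Lemma second_derivatives_of_contactomorphic (S T : vshape V) :
  shadow S = eball rho -> shadow T = eball rho ->
  radially_symmetric (eball rho) (fplus S) -> radially_symmetric (eball rho) (fminus S) ->
  radially_symmetric (eball rho) (fplus T) -> radially_symmetric (eball rho) (fminus T) ->
  cooriented_contactomorphic (shape_domain S) (shape_domain T) ->
  derive1n 2 (radial_profile (fplus S)) 0 = derive1n 2 (radial_profile (fplus T)) 0 /\
  derive1n 2 (radial_profile (fminus S)) 0 = derive1n 2 (radial_profile (fminus T)) 0.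
Proof.
move=> sS sT r1 r2 r3 r4.
have [f1 [HF -> ->]] := shape_radial_region sS r1 r2.
have [g1 [HG -> ->]] := shape_radial_region sT r3 r4.
rewrite (shape_domainE rho0 sS) (shape_domainE rho0 sT).
move=> [f [[sf [h [sh fK hK]]] cf]].
have K := pole_coefficient n1 rho0 HF HG sf sh fK hK cf.
by split; exact: K.
Qed.

End NecessityForShapes.

Theorem theorem1 (R : realType) (n : nat) (hn : (1 <= n)%N)
    (S T : vshape 'rV[R]_(n + n))
    (hequiv : shape_equiv S T)
    (hball : exists2 r : R, 0 < r & shadow S = round_ball r)
    (hfp : radially_symmetric (shadow S) (fplus S))
    (hfm : radially_symmetric (shadow S) (fminus S))
    (hgp : radially_symmetric (shadow T) (fplus T))
    (hgm : radially_symmetric (shadow T) (fminus T)) :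
  cooriented_contactomorphic (shape_domain S) (shape_domain T) <->
  (derive1n 2 (radial_profile (fplus S)) 0
     = derive1n 2 (radial_profile (fplus T)) 0 /\
   derive1n 2 (radial_profile (fminus S)) 0
     = derive1n 2 (radial_profile (fminus T)) 0).
Proof.
have [rho rho0] := hball; rewrite round_ballE => sS.
have [sST _] := hequiv; have sT : shadow T = eball rho by rewrite -sST.
rewrite sS in hfp hfm; rewrite sT in hgp hgm.
split; first exact: (second_derivatives_of_contactomorphic hn rho0 sS sT hfp hfm hgp hgm).
by move=> [dp dm]; exact: (contactomorphic_of_second_derivatives hn rho0 sS sT hequiv hfp hfm hgp hgm dp dm).
Qed.
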